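(* For every $x\ge 0$ the following Abelian limit relationships hold: $$\lim_{\alpha\to0^+}\alpha V_\alpha(x)=\lim_{T\to\infty}\frac{V(x,T)}{T}=V_0,$$ where $V_\alpha(x)$, $V(x,T)$ and $V_0$ are the value functions of the infinite horizon discounted, finite horizon, and long-run average cost problems, defined in the context.
   Context: Let $H\in[\tfrac12,1)$ and let $W_H=(W_H(t))_{t\ge 0}$ be a fractional Brownian motion with Hurst parameter $H$: a continuous zero-mean Gaussian process with $W_H(0)=0$ and $\mathrm{Cov}(W_H(s),W_H(t))=\frac12\bigl[t^{2H}+s^{2H}-|t-s|^{2H}\bigr]$ for $s,t\ge 0$. For $x\ge 0$ and $u\ge 0$ define, for $t\ge 0$, $$L_x^u(t)=-\min\Bigl\{0,\min_{s\in[0,t]}\bigl(x-us+W_H(s)\bigr)\Bigr\},\qquad X_x^u(t)=x-ut+W_H(t)+L_x^u(t).$$ Standing assumptions: $p\ge 0$ is a constant; $h:[0,\infty)\to[0,\infty)$ is continuous, non-decreasing, with $\lim_{u\to\infty}h(u)=+\infty$; $C:[0,\infty)\to[0,\infty)$ is continuous, non-decreasing, and satisfies $C(y)\le K(1+y^\gamma)$ for all $y\ge0$, for some constants $K>0$, $\gamma>0$. Value functions: - Long-run average: $I(u,x)=h(u)+\limsup_{T\to\infty}\frac1T E\bigl(\int_0^T C(X_x^u(t))\,dt+p\,L_x^u(T)\bigr)$ and $V_0=V_0(x)=\inf_{u>0}I(u,x)$ (this is known not to depend on $x$). - Discounted, for $\alpha>0$: $J_\alpha(u,x)=E\bigl(\int_0^\infty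 e^{-\alpha t}[h(u)+C(X_x^u(t))]\,dt+p\int_0^\infty e^{-\alpha t}\,dL_x^u(t)\bigr)$ and $V_\alpha(x)=\inf_{u>0}J_\alpha(u,x)$. - Finite horizon, for $T>0$: $I(u,x,T)=h(u)T+p\,E(L_x^u(T))+E\bigl(\int_0^T C(X_x^u(t))\,dt\bigr)$ and $V(x,T)=\inf_{u>0}I(u,x,T)$. *)

(* Defs.v *)
From HB Require Import structures.
From mathcomp Require Import all_boot all_order all_algebra.
From mathcomp Require Import all_classical all_reals all_analysis.

Set Implicit Arguments.
Unset Strict Implicit.
Unset Printing Implicit Defensive.

Import Order.TTheory GRing.Theory Num.Theory.
Import numFieldNormedType.Exports.

Local Open Scope classical_set_scope.
Local Open Scope ring_scope.

(* [normal_prob m 0] is not a Gaussian law in the library (it is uniform on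
   [0, 1]), so the degenerate Gaussian laws are the Dirac masses. *)
Definition gaussian_rv {d} {Omega : measurableType d} {R : realType}
    (P : probability Omega R) (X : Omega -> R) : Prop :=
  measurable_fun [set: Omega] X /\
  exists m s : R,
    if s == 0 then forall A, measurable A -> pushforward P X A = \d_m A
    else forall A, measurable A -> pushforward P X A = normal_prob m s A.

(* The process is indexed by all of [R]; only nonnegative times are constrained,
   and only those are used in the cost functionals. *)
Record fractional_brownian_motion {d} {Omega : measurableType d} {R : realType}
    (P : probability Omega R) (H : R) := FractionalBrownianMotion {
  fbm_process :> R -> {RV P >-> R} ;
  fbm_start : forall w, fbm_process 0 w = 0 ;
  fbm_continuous : forall w,
    {within `[0, +oo[, continuous (fun t => fbm_process t w)} ;
  fbm_gaussian : forall (n : nat) (a t : 'I_n -> R), (forall i, 0 <= t i) ->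
    gaussian_rv P (fun w => \sum_(i < n) a i * fbm_process (t i) w) ;
  fbm_mean : forall t, 0 <= t -> ('E_P[fbm_process t] = 0)%E ;
  fbm_covariance : forall s t, 0 <= s -> 0 <= t ->
    covariance P (fbm_process s) (fbm_process t) =
    (2^-1 * (t `^ (2 * H) + s `^ (2 * H) - `|t - s| `^ (2 * H)))%:E }.

Section costs.
Context {d} {Omega : measurableType d} {R : realType}.
Variables (P : probability Omega R) (H : R).
Variable W : fractional_brownian_motion P H.

Definition free_path (u x : R) (w : Omega) (t : R) : R := x - u * t + W t w.

(* [inf] is the minimum here (see [free_path_min]). For [t < 0] the interval is
   empty and [inf set0 = 0], so the regulator vanishes at negative times. *)
Definition regulator (u x : R) (w : Omega) (t : R) : R :=
  - Num.min 0 (inf (free_path u x w @` `[0, t])).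

Definition workload (u x : R) (w : Omega) (t : R) : R :=
  free_path u x w t + regulator u x w t.

Lemma free_path_continuous u x w :
  {within `[0, +oo[, continuous (free_path u x w)}.
Proof.
have drift : {within `[0, +oo[, continuous (fun t : R => x - u * t)}.
  apply: continuous_subspaceT => t.
  by apply: cvgB; [exact: cvg_cst | exact: mulrl_continuous].
by move=> t; apply: cvgD; [exact: drift | exact: fbm_continuous].
Qed.

Lemma free_path_min u x w t : 0 <= t ->
  exists2 s, s \in `[0, t] &
    (forall r, r \in `[0, t] -> free_path u x w s <= free_path u x w r) /\
    inf (free_path u x w @` `[0, t]) = free_path u x w s.
Proof.
move=> t0.
have cf : {within `[0, t], continuous (free_path u x w)}.
  apply: (continuous_subspaceW _ (@free_path_continuous u x w)).
  by move=> s /=; rewrite !in_itv/= => /andP[->].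
have [s st smin] := EVT_min t0 cf.
exists s => //; split => //; apply/eqP; rewrite eq_le; apply/andP; split.
  apply: ge_inf; last by exists s.
  by exists (free_path u x w s) => _ [r rt <-]; exact: smin.
apply: lb_le_inf; first by exists (free_path u x w s), s.
by move=> _ [r rt <-]; exact: smin.
Qed.

Lemma regulator_nondecreasing u x w : nondecreasing (regulator u x w).
Proof.
move=> s t st; rewrite /regulator lerN2.
have [s0|s0] := ltP s 0.
  rewrite [`[0, s]%classic]set_itv_ge ?bnd_simp -?ltNge//.
  by rewrite image_set0 inf0 minxx ge_min lexx.
have [r rs [rmin ->]] := @free_path_min u x w s s0.
have [q qt [qmin ->]] := @free_path_min u x w t (le_trans s0 st).
rewrite le_min ge_min lexx/= ge_min; apply/orP; right.
by apply: qmin; move: rs; rewrite !in_itv/= => /andP[-> /le_trans]; exact.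
Qed.

Lemma regulator_right_continuous u x w : right_continuous (regulator u x w).
Proof.
move=> a; have [a0|a0] := ltP a 0.
  have reg0 t : t < 0 -> regulator u x w t = 0.
    move=> t0; rewrite /regulator set_itv_ge ?bnd_simp -?ltNge//.
    by rewrite image_set0 inf0 minxx oppr0.
  rewrite reg0//; apply: (@cvg_trans _ (cst (0 : R) @ at_right a)); last first.
    exact: cvg_cst.
  by apply: near_eq_cvg; apply: filterS (nbhs_right_lt a0) => t /reg0 ->.
have acvg : free_path u x w t @[t --> a^'+] --> free_path u x w a.
  have := @free_path_continuous u x w; rewrite continuous_within_itvcyP => -[].
  move=> cf f0; move: a0; rewrite le_eqVlt => /predU1P[<-//|a0].
  by apply: cvg_at_right_filter; apply: cf; rewrite in_itv/= a0.
apply/cvgrPdist_le => e e0.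
have /cvgrPdist_le/(_ _ e0) [del /= del0 fd] := acvg.
near=> t.
have at_ : a < t by near: t; exact: nbhs_right_gt.
have Lat := @regulator_nondecreasing u x w _ _ (ltW at_).
rewrite distrC ger0_norm ?subr_ge0// lerBlDl /regulator.
rewrite -[leRHS]opprK lerN2 opprD opprK.
have [r ra [rmin ->]] := @free_path_min u x w a a0.
have [q qt [qmin ->]] := @free_path_min u x w t (le_trans a0 (ltW at_)).
have [qa|aq] := leP q a.
  have : free_path u x w r <= free_path u x w q.
    by apply: rmin; move: qt; rewrite !in_itv/= qa => /andP[->].
  move=> rq; rewrite lerBlDr; apply: (@le_trans _ _ (Num.min 0 (free_path u x w q))).
    by rewrite le_min !ge_min lexx rq orbT.
  by rewrite lerDl ltW.
have fqa : free_path u x w a - e <= free_path u x w q.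
  have : ball a del q.
    rewrite /ball/= distrC ger0_norm ?subr_ge0 1?ltW//.
    have qlet : q <= t by move: qt; rewrite in_itv/= => /andP[].
    rewrite ltrBlDl (le_lt_trans qlet)//.
    by near: t; apply: nbhs_right_lt; rewrite ltrDl.
  move=> /fd /(_ aq); rewrite ler_norml => /andP[_].
  by rewrite lerBlDr lerBlDl addrC.
have ra' : free_path u x w r <= free_path u x w a.
  by apply: rmin; rewrite in_itv/= a0 lexx.
rewrite le_min; apply/andP; split.
  by rewrite lerBlDr add0r ge_min ltW.
rewrite (le_trans _ fqa)// lerD2r ge_min ra' orbT//.
Unshelve. all: end_near. Qed.

HB.instance Definition _ u x w := isCumulative.Build R _ R (regulator u x w)
  (@regulator_nondecreasing u x w) (@regulator_right_continuous u x w).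

Variables (h C : R -> R) (p : R).

Local Open Scope ereal_scope.

Definition average_cost (u x : R) : \bar R :=
  (h u)%:E + limf_esup (fun T : R => (T^-1)%:E *
    \int[P]_w (\int[lebesgue_measure]_(t in `[0%R, T]) (C (workload u x w t))%:E
               + p%:E * (regulator u x w T)%:E)) (pinfty_nbhs R).

Definition average_value (x : R) : \bar R :=
  ereal_inf [set average_cost u x | u in `]0%R, +oo[].

(* For [0 <= x] the regulator is 0 on ]-oo, 0], so [dL] has no atom at 0 and it
   does not matter that the Stieltjes integral includes that endpoint. *)
Definition discounted_cost (alpha u x : R) : \bar R :=
  \int[P]_w (
    \int[lebesgue_measure]_(t in `[0%R, +oo[)
      (expR (- (alpha * t)) * (h u + C (workload u x w t)))%:E
    + p%:E * \int[lebesgue_stieltjes_measure (regulator u x w)]_(t in `[0%R, +oo[)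
               (expR (- (alpha * t)))%:E).

Definition discounted_value (alpha x : R) : \bar R :=
  ereal_inf [set discounted_cost alpha u x | u in `]0%R, +oo[].

Definition finite_horizon_cost (u x T : R) : \bar R :=
  (h u * T)%:E + p%:E * 'E_P[fun w => regulator u x w T]
  + \int[P]_w \int[lebesgue_measure]_(t in `[0%R, T]) (C (workload u x w t))%:E.

Definition finite_horizon_value (x T : R) : \bar R :=
  ereal_inf [set finite_horizon_cost u x T | u in `]0%R, +oo[].

End costs.

(* Main.v *)
(* Write L and X for the regulator and the workload.  Reflection gives
   X_0^u <= X_x^u <= max(x - ut + W(t), X_0^u), and X_0^u(t) is the maximum over
   s in [0, t] of W(t) - W(s) - u(t - s), which by stationarity of increments has
   the law of the maximum of W(s) - us; hence E C(X_0^u(t)) increases with t to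
   some G(u).  Gaussian moments make E C(X_x^u(t)) - E C(X_0^u(t)) bounded on
   compacts and asymptotically small, and chaining gives E L(t) = ut + o(t), so
   both the Cesaro averages (finite horizon, long-run average) and the Abel
   averages (discounted; Tonelli for the dL integral) of the cost at rate u tend
   to h(u) + pu + G(u).  The exchange of limit and infimum over u uses that the
   averages are nonincreasing in u, compactness of bounded rate intervals, and
   the divergence of h. *)
Require Import Defs.
From mathcomp Require Import all_boot all_order all_algebra.
From mathcomp Require Import all_classical all_reals all_analysis.
From mathcomp Require Import measurable_realfun.
From mathcomp Require Import ring lra.
Import Order.TTheory GRing.Theory Num.Theory.
Import numFieldNormedType.Exports.
Local Open Scope classical_set_scope.
Local Open Scope ring_scope.

(** * Gaussian laws *)

(** Three obstacles shape the proof. The process is described only through Gaussian linear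
    combinations and covariances, so the equality in law of two path maxima has to be built up: a
    centred Gaussian law is determined by its variance, hence cosines of linear combinations of
    increments have the expected integrals; bounded limits of trigonometric functions reach
    indicators of unions of half-spaces; dyadic grids and continuity of paths reach the maximum.
    Next, $G(u)$ is not known to be finite, so costs live in the extended reals, are compared by
    adding errors rather than by subtracting costs, and limits are tested against real levels from
    both sides. Finally, convergence at each fixed $u$ only bounds the limit of the infimum from
    above; the bound from below needs one neighbourhood of the parameter for all rates at once. The
    condition $H\ge 1/2$ enters in the chaining, where increments over $2^{-n}T$ have variance at
    most $2^{-n}T^{2H}$, and $H<1$ makes $t^H$ negligible against the drift $ut$. *)

Lemma probability_integral_cst {d} {T : measurableType d} {R : realType}
    (P : probability T R) (r : R) : (\int[P]_w r%:E = r%:E)%E.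
Proof. by rewrite integral_cst//= probability_setT mule1. Qed.

Section gaussian.
Context {R : realType}.
Local Notation mu := (@lebesgue_measure R).

(** The density and the Radon-Nikodym derivative have the same integral over every measurable set,
    hence agree almost everywhere, and the change of variables for the derivative applies. *)
Lemma integral_normal_prob (m s : R) (g : R -> R) :
  (forall x, 0 <= g x) -> measurable_fun setT g ->
  (\int[normal_prob m s]_x (g x)%:E = \int[mu]_x (g x * normal_pdf m s x)%:E)%E.
Proof.
move=> g0 mg.
rewrite -(Radon_Nikodym_SigmaFinite.change_of_variables (normal_prob_dominates m s))//=; last first.
  exact/measurable_EFinP.
apply: ge0_ae_eq_integral => //=.
- apply: emeasurable_funM; first exact/measurable_EFinP.
  apply: (measurable_int mu); apply: Radon_Nikodym_SigmaFinite.f_integrable.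
  exact: normal_prob_dominates.
- apply/measurable_EFinP/measurable_funM => //; exact: measurable_normal_pdf.
- move=> x _; rewrite mule_ge0 ?lee_fin//.
  apply: Radon_Nikodym_SigmaFinite.f_ge0; exact: normal_prob_dominates.
- by move=> x _; rewrite lee_fin mulr_ge0// normal_pdf_ge0.
under [X in ae_eq _ _ _ X]eq_fun do rewrite EFinM.
apply: ae_eqe_mul2l => /=.
apply: integral_ae_eq => //=.
+ apply: Radon_Nikodym_SigmaFinite.f_integrable; exact: normal_prob_dominates.
+ by apply: measurableT_comp => //; exact: measurable_normal_pdf.
+ move=> E _ mE; rewrite -Radon_Nikodym_SigmaFinite.f_integral//.
  exact: normal_prob_dominates.
Qed.

(** Substitution $x=m+sz$; the Jacobian [s] turns the peak of scale [s] into that of scale 1. *)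
Lemma normal_prob_affine (m s : R) (g : R -> R) :
  0 < s -> (forall x, 0 <= g x) -> continuous g ->
  (\int[normal_prob m s]_x (g x)%:E = \int[normal_prob 0 1]_z (g (m + s * z))%:E)%E.
Proof.
move=> s0 g0 cg; have s_neq0 : s != 0 by rewrite gt_eqF.
have cF : continuous (fun z : R => m + s * z).
  by move=> z; apply: cvgD; [exact: cvg_cst|exact: mulrl_continuous].
rewrite !integral_normal_prob//; last 2 first.
- by apply: continuous_measurable_fun => z; apply: continuous_comp; [exact: cF|exact: cg].
- exact: continuous_measurable_fun.
pose F (z : R^o) : R^o := m + s * z.
have dF (z : R) : derivable F z 1 by apply: derivableD => //; apply: derivableM.
have F'E : F^`()%classic = cst s.
  apply/funext => z; rewrite /F derive1E deriveD// deriveM// !derive_cst derive_id.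
  by rewrite scaler0 add0r addr0 /GRing.scale/= mulr1.
rewrite (increasing_ge0_integration_by_substitutionT (F := F))//.
- apply: eq_integral => z _; rewrite !fctE F'E -mulrA; congr (_ * _)%:E.
  rewrite !normal_pdfE ?oner_neq0// /normal_peak /normal_fun.
  rewrite addrAC subrr add0r subr0 expr1n mul1r exprMn.
  rewrite [RHS]mulrC [LHS]mulrAC [LHS]mulrC; congr (_ * _).
    by congr expR; field.
  rewrite -[s ^+ 2 * pi *+ 2]mulrnAr sqrtrM ?sqr_ge0// sqrtr_sqr gtr0_norm//.
  by rewrite invfM mulrAC mulVf ?mul1r.
- by move=> x y xy; rewrite ltrD2l ltr_pM2l.
- by rewrite F'E => x; exact: cvg_cst.
- by rewrite F'E; exact: is_cvg_cst.
- by rewrite F'E; exact: is_cvg_cst.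
- by apply: cvg_comp (cvg_addrl_Ny m); apply: (gt0_cvgMrNy s0).
- by apply: cvg_comp (cvg_addrl m); apply: (gt0_cvgMry s0).
- by move=> z; apply: cvgM; [exact: cg|exact: continuous_normal_pdf].
- by move=> x; rewrite mulr_ge0// normal_pdf_ge0.
Qed.

(** [gaussian_rv] leaves the sign of the scale free; as only its square enters the density, one may
    pass to its absolute value. *)
Lemma normal_probN (m s : R) : normal_prob m (- s) = normal_prob m s.
Proof.
rewrite /normal_prob; apply/funext => A; apply: eq_integral => x _; congr EFin.
rewrite /normal_pdf oppr_eq0; case: ifPn => // s0.
by rewrite /normal_peak /normal_fun sqrrN.
Qed.

(** A single formula for both kinds of Gaussian law: a Dirac mass is the case [s = 0]. Nonnegative
    test functions spare any integrability condition. *)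
Lemma gaussian_law {d} {Omega : measurableType d} (P : probability Omega R)
    (X : Omega -> R) : gaussian_rv P X ->
  exists m s : R, 0 <= s /\ forall g : R -> R, (forall x, 0 <= g x) -> continuous g ->
  (\int[P]_w (g (X w))%:E = \int[normal_prob 0 1]_z (g (m + s * z))%:E)%E.
Proof.
move=> [mX [m [s Xlaw]]]; exists m, `|s|; split => // g g0 cg.
have mg : measurable_fun setT (EFin \o g).
  by apply/measurable_EFinP; exact: continuous_measurable_fun.
rewrite -[LHS](@ge0_integral_pushforward _ _ _ _ _ _ mX P setT (EFin \o g))//; last first.
  by move=> ? _; rewrite lee_fin.
move: Xlaw; have [->|s0] := eqVneq s 0 => Xlaw.
  rewrite [LHS](eq_measure_integral \d_m); last by move=> A mA _; exact: Xlaw.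
  rewrite integral_dirac// diracT mul1e normr0.
  under eq_integral do rewrite mul0r addr0.
  by rewrite probability_integral_cst.
transitivity (\int[normal_prob m s]_x (g x)%:E)%E.
  have mid : measurable_fun setT (idfun : measurableTypeR R -> R).
    by move=> _ A mA; rewrite setTI.
  (* Pushing forward along the identity moves [normal_prob] from [measurableTypeR R] to [R], where
     the law of [X] lives. *)
  transitivity (\int[pushforward (normal_prob m s) (idfun : measurableTypeR R -> R)]_x (g x)%:E)%E.
    by apply: eq_measure_integral => A mA _; exact: Xlaw.
  rewrite (@ge0_integral_pushforward _ _ _ _ _ _ mid _ setT (EFin \o g))//.
  by move=> ? _; rewrite lee_fin.
have -> : (\int[normal_prob m s]_x (g x)%:E = \int[normal_prob m `|s|]_x (g x)%:E)%E.
  have [sp|sn] := ltP 0 s; first by rewrite gtr0_norm.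
  by apply: eq_measure_integral => A _ _ /=; rewrite ler0_norm// normal_probN.
by rewrite normal_prob_affine// normr_gt0.
Qed.

End gaussian.

Section gaussian_moments.
Context {R : realType}.
Local Notation mu := (@lebesgue_measure R).
Local Notation N01 := (normal_prob (0 : R) 1).

(** Half of the exponent is spent on the power: $y^k/k!\le e^y$ at $y=z^2/4$. What remains,
    $e^{-z^2/4}$, is the Gaussian profile of variance 2. *)
Lemma moment_bound (k : nat) (z : R) :
  z ^+ (2 * k) * normal_fun 0 1 z <= 4 ^+ k * k`!%:R * normal_fun 0 (Num.sqrt 2) z.
Proof.
have nf2 : normal_fun 0 (Num.sqrt 2) z = expR (- (z ^+ 2 / 4)).
  rewrite /normal_fun subr0 sqr_sqrtr//; congr expR.
  by rewrite mulNr; congr (- (_ / _)); ring.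
have -> : normal_fun 0 1 z = normal_fun 0 (Num.sqrt 2) z * normal_fun 0 (Num.sqrt 2) z.
  by rewrite nf2 -expRD /normal_fun subr0 expr1n; congr expR; field.
rewrite mulrA ler_wpM2r ?normal_fun_ge0// nf2 expRN ler_pdivrMr ?expR_gt0//.
have y0 : 0 <= z ^+ 2 / 4 by rewrite divr_ge0// sqr_ge0.
have key : (z ^+ 2 / 4) ^+ k / k`!%:R <= expR (z ^+ 2 / 4).
  case: k => [|k].
    by rewrite expr0 fact0 divr1 -[leLHS]expR0 ler_expR.
  by apply: le_trans (expR_ge1Dxn k y0); rewrite lerDr.
move: key; rewrite ler_pdivrMr ?ltr0n ?fact_gt0// expr_div_n ler_pdivrMr ?exprn_gt0//.
by rewrite -exprM => /le_trans; apply; rewrite [leRHS]mulrC -mulrA [k`!%:R * _]mulrC.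
Qed.

Lemma normal_moment_lty (k : nat) : (\int[N01]_z ((z : R) ^+ (2 * k))%:E < +oo)%E.
Proof.
have ge0 (z : R) : 0 <= z ^+ (2 * k) by rewrite exprM exprn_ge0// sqr_ge0.
rewrite integral_normal_prob//.
pose c := 4 ^+ k * k`!%:R * normal_peak 1 / normal_peak (Num.sqrt 2 : R).
have s20 : Num.sqrt 2 != 0 :> R by rewrite sqrtr_eq0 -ltNge.
have pk0 : 0 < normal_peak (Num.sqrt 2 : R) by exact: normal_peak_gt0.
apply: (@le_lt_trans _ _ (\int[mu]_z (c%:E * (normal_pdf 0 (Num.sqrt 2) z)%:E))%E).
  apply: ge0_le_integral => //=.
  - by move=> z _; rewrite lee_fin mulr_ge0// normal_pdf_ge0.
  - apply/measurable_EFinP/measurable_funM; last exact: measurable_normal_pdf.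
    exact: exprn_measurable.
  - apply/measurable_EFinP/measurable_funM => //; exact: measurable_normal_pdf.
  - move=> z _; rewrite lee_fin !normal_pdfE ?oner_neq0//.
    rewrite [leRHS](_ : _ = normal_peak 1 * (4 ^+ k * k`!%:R * normal_fun 0 (Num.sqrt 2) z)); last first.
      by rewrite /c mulrA divfK ?gt_eqF// mulrA [_ * normal_peak 1]mulrC.
    by rewrite mulrCA ler_wpM2l// ?normal_peak_ge0// moment_bound.
rewrite integralZl//; last exact: integrable_normal_pdf.
by rewrite integral_normal_pdf mule1 ltry.
Qed.

End gaussian_moments.

Section central_moments.
Context {d} {T : measurableType d} {R : realType} (Q : probability T R) (Z : T -> R).
Hypothesis mZ : measurable_fun setT Z.
Hypothesis Z_moment : forall k, (\int[Q]_z (Z z ^+ (2 * k))%:E < +oo)%E.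

Definition mean : R := fine (\int[Q]_z (Z z)%:E)%E.
(** The index counts pairs: this is the moment of order [2 * k], whose integrand is nonnegative. *)
Definition central_moment (k : nat) : R :=
  fine (\int[Q]_z ((Z z - mean) ^+ (2 * k))%:E)%E.

Let exprn2_ge0 (x : R) (k : nat) : 0 <= x ^+ (2 * k).
Proof. by rewrite exprM exprn_ge0// sqr_ge0. Qed.

Lemma integrable_of_moments : Q.-integrable setT (EFin \o Z).
Proof.
have ik k : Q.-integrable setT (fun z => (Z z ^+ (2 * k))%:E).
  apply/integrableP; split; first exact/measurable_EFinP/measurable_funX.
  under eq_integral do rewrite gee0_abs ?lee_fin//.
  exact: Z_moment.
apply: (le_integrable _ _ _ (integrableD _ (ik 0%N) (ik 1%N))) => //.
  exact/measurable_EFinP.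
move=> z _ /=; rewrite lee_fin muln0 muln1 expr0 [leRHS]ger0_norm ?addr_ge0 ?sqr_ge0//.
have [|/ltW z1] := lerP `|Z z| 1; first by move/le_trans; apply; rewrite lerDl sqr_ge0.
by rewrite -real_normK ?num_real// ler_wpDl// expr2 ler_peMr.
Qed.

Lemma central_momentE k :
  (\int[Q]_z ((Z z - mean) ^+ (2 * k))%:E = (central_moment k)%:E)%E.
Proof.
rewrite /central_moment fineK// ge0_fin_numE; last first.
  by apply: integral_ge0 => z _; rewrite lee_fin.
(* The bound is $(a+b)^{2k}\le 2^{2k}(a^{2k}+b^{2k})$, obtained by replacing the smaller of [a], [b]
   by the larger. *)
apply: (@le_lt_trans _ _ (\int[Q]_z ((2 ^+ (2 * k))%:E * (Z z ^+ (2 * k))%:E +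
    (2 ^+ (2 * k) * mean ^+ (2 * k))%:E))%E).
  apply: ge0_le_integral => //.
  - by move=> z _; rewrite lee_fin.
  - by apply/measurable_EFinP/measurable_funX/measurable_funB.
  - by apply/measurable_EFinP/measurable_funD => //; apply: measurable_funM => //;
      exact: measurable_funX.
  - move=> z _; rewrite -EFinM -EFinD lee_fin -mulrDr -(ger0_norm (exprn2_ge0 _ _)) normrX.
    have /= := ler_normB (Z z) mean; set a := `|Z z|; set b := `|mean| => zab.
    have a0 : 0 <= a by exact: normr_ge0.
    have b0 : 0 <= b by exact: normr_ge0.
    have zE : Z z ^+ (2 * k) = a ^+ (2 * k) by rewrite /a -normrX ger0_norm.
    have mE : mean ^+ (2 * k) = b ^+ (2 * k) by rewrite /b -normrX ger0_norm.
    rewrite zE mE; have [ab|/ltW ba] := leP a b.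
      apply: (@le_trans _ _ ((2 * b) ^+ (2 * k))).
        by apply: lerXn2r; rewrite ?nnegrE ?mulr_ge0// (le_trans zab)// mulr_natl mulr2n lerD2r.
      by rewrite exprMn ler_wpM2l ?exprn_ge0// lerDr exprn_ge0.
    apply: (@le_trans _ _ ((2 * a) ^+ (2 * k))).
      by apply: lerXn2r; rewrite ?nnegrE ?mulr_ge0// (le_trans zab)// mulr_natl mulr2n lerD2l.
    by rewrite exprMn ler_wpM2l ?exprn_ge0// lerDl exprn_ge0.
rewrite ge0_integralD//=; last 3 first.
- by move=> z _; rewrite -EFinM lee_fin mulr_ge0// exprn_ge0.
- by apply/measurable_funeM/measurable_EFinP/measurable_funX.
- by move=> z _; rewrite lee_fin mulr_ge0// exprn_ge0.
rewrite ge0_integralZl//; last 2 first.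
- exact/measurable_EFinP/measurable_funX.
- by move=> z _; rewrite lee_fin.
rewrite probability_integral_cst lte_add_pinfty ?ltry//.
by rewrite lte_mul_pinfty ?lee_fin ?exprn_ge0// Z_moment.
Qed.

Lemma central_moment_ge0 k : 0 <= central_moment k.
Proof. by rewrite fine_ge0// integral_ge0// => z _; rewrite lee_fin. Qed.

(** A zero variance would put all the mass on the single point [mean]. *)
Lemma variance_gt0 : (forall c, Q (Z @^-1` [set c]) = 0%E) -> 0 < central_moment 1.
Proof.
move=> Z0; rewrite lt_neqAle central_moment_ge0 andbT; apply/eqP => K0.
have := central_momentE 1; rewrite -K0.
under eq_integral do rewrite -[X in X%:E]ger0_norm//.
have mf : measurable_fun setT (fun z => ((Z z - mean) ^+ (2 * 1))%:E).
  by apply/measurable_EFinP/measurable_funX/measurable_funB.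
move/(ae_eq_integral_abs Q measurableT mf) => [A [mA A0 sA]].
have mZm : measurable (Z @^-1` [set mean]) by rewrite -[X in measurable X]setTI; exact: mZ.
have : (Q setT <= Q A + Q (Z @^-1` [set mean]))%E.
  apply: le_trans (measureU2 _ mA mZm) => //.
  apply: le_measure; rewrite ?inE//; first exact: measurableU.
  move=> z _; have [zm|zm] := eqVneq (Z z) mean; [by right|left; apply: sA => /=].
  move=> /(_ I) [] /eqP; rewrite muln1 sqrf_eq0 subr_eq0.
  by rewrite (negbTE zm).
by rewrite A0 Z0 adde0 /= probability_setT lee_fin ler10.
Qed.

End central_moments.

Section centered_gaussian.
Context {R : realType}.
Local Notation N01 := (normal_prob (0 : R) 1 : probability (measurableTypeR R) R).
Local Notation Z := (fun z : measurableTypeR R => (z : R)).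

(** Kept symbolic, like the moments below: a centred Gaussian variable is a multiple of
    [Z - normal_mean] in law, and the multiple is read off from its variance divided by
    [normal_moment 1]. *)
Definition normal_mean : R := mean N01 Z.
Definition normal_moment (k : nat) : R := central_moment N01 Z k.

Lemma integrable_normal : N01.-integrable setT (EFin \o Z).
Proof. apply: integrable_of_moments => //; exact: normal_moment_lty. Qed.

Lemma normal_momentE k :
  (\int[N01]_z ((Z z - normal_mean) ^+ (2 * k))%:E = (normal_moment k)%:E)%E.
Proof. apply: central_momentE => //; exact: normal_moment_lty. Qed.

Lemma normal_moment_ge0 k : 0 <= normal_moment k.
Proof. exact: central_moment_ge0. Qed.

Lemma normal_variance_gt0 : 0 < normal_moment 1.
Proof.
apply: variance_gt0 => //; first exact: normal_moment_lty.
move=> c; rewrite -[LHS]/(\int[lebesgue_measure]_(x in [set c]) (normal_pdf 0 1 x)%:E)%E.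
by rewrite integral_set1.
Qed.

Context {d} {Omega : measurableType d} (P : probability Omega R).

Lemma centered_gaussian_law (X : Omega -> R) : gaussian_rv P X ->
    (\int[P]_w (X w)%:E = 0)%E ->
  exists s : R, 0 <= s /\ forall g : R -> R, (forall x, 0 <= g x) -> continuous g ->
  (\int[P]_w (g (X w))%:E = \int[N01]_z (g (s * (Z z - normal_mean)))%:E)%E.
Proof.
move=> /gaussian_law[m [s [s0 Xlaw]]] EX0; exists s; split => // g g0 cg.
suff mE : m = - s * normal_mean.
  by rewrite Xlaw//; apply: eq_integral => z _; rewrite mE mulrBr mulNr addrC.
have : (\int[P]_w (X w)%:E = \int[N01]_z (m + s * Z z)%:E)%E.
  (* The law is known on nonnegative test functions only, so positive and negative parts are treated
     separately. *)
  rewrite integralE [RHS]integralE; congr (_ - _)%E.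
    under eq_integral do rewrite funeposE -EFin_max.
    under [RHS]eq_integral do rewrite funeposE -EFin_max.
    apply: (Xlaw (fun x => Num.max x 0)); first by move=> x; rewrite le_max lexx orbT.
    by move=> x; apply: continuous_max => //; exact: cvg_cst.
  under eq_integral do rewrite funenegE -EFinN -EFin_max.
  under [RHS]eq_integral do rewrite funenegE -EFinN -EFin_max.
  apply: (Xlaw (fun x => Num.max (- x) 0)); first by move=> x; rewrite le_max lexx orbT.
  by move=> x; apply: continuous_max => //; [exact: opp_continuous|exact: cvg_cst].
rewrite EX0.
under eq_integral do rewrite EFinD EFinM.
rewrite integralD//; last 2 first.
- exact: finite_measure_integrable_cst.
- by apply: integrableZl => //; exact: integrable_normal.
rewrite integralZl//; last exact: integrable_normal.
rewrite probability_integral_cst.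
rewrite -[(\int[N01]_z _)%E]fineK; last first.
  by apply: integrable_fin_num => //; exact: integrable_normal.
by rewrite -EFinM -EFinD => -[] /eqP; rewrite eq_sym addr_eq0 => /eqP; rewrite mulNr.
Qed.

(** The test function $x^2$ gives $s^2$ [normal_moment 1] $=v$ with $s\ge 0$. Hence the variance
    alone fixes the law of a centred Gaussian variable, including the degenerate one. *)
Lemma centered_gaussian_law_var (X : Omega -> R) (v : R) : gaussian_rv P X ->
    (\int[P]_w (X w)%:E = 0)%E -> (\int[P]_w (X w ^+ 2)%:E = v%:E)%E ->
  forall g : R -> R, (forall x, 0 <= g x) -> continuous g ->
  (\int[P]_w (g (X w))%:E =
   \int[N01]_z (g (Num.sqrt (v / normal_moment 1) * (Z z - normal_mean)))%:E)%E.
Proof.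
move=> gX EX EX2 g g0 cg; have [s [s0 Xlaw]] := centered_gaussian_law X gX EX.
suff -> : Num.sqrt (v / normal_moment 1) = s by exact: Xlaw.
have := Xlaw (fun x => x ^+ 2) (@sqr_ge0 _) (@sqr_continuous _).
rewrite EX2; under eq_integral do rewrite exprMn EFinM -[2%N]muln1.
rewrite ge0_integralZl//; last 3 first.
- by apply/measurable_EFinP/measurable_funX/measurable_funB.
- by move=> z _; rewrite lee_fin muln1 sqr_ge0.
- by rewrite lee_fin muln1 sqr_ge0.
rewrite normal_momentE -EFinM => -[->]; rewrite muln1.
by rewrite mulfK ?gt_eqF ?normal_variance_gt0// sqrtr_sqr ger0_norm.
Qed.

Lemma centered_gaussian_moment (X : Omega -> R) (v : R) (k : nat) : 0 <= v -> gaussian_rv P X ->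
    (\int[P]_w (X w)%:E = 0)%E -> (\int[P]_w (X w ^+ 2)%:E = v%:E)%E ->
  (\int[P]_w (X w ^+ (2 * k))%:E = ((v / normal_moment 1) ^+ k * normal_moment k)%:E)%E.
Proof.
move=> v0 gX EX EX2.
rewrite (centered_gaussian_law_var X v gX EX EX2 (fun x => x ^+ (2 * k))); last 2 first.
- by move=> x; rewrite exprM exprn_ge0// sqr_ge0.
- exact: exprn_continuous.
under eq_integral do rewrite exprMn EFinM.
have e0 (x : R) : 0 <= x ^+ (2 * k) by rewrite exprM exprn_ge0// sqr_ge0.
rewrite ge0_integralZl//; last 2 first.
- by apply/measurable_EFinP/measurable_funX/measurable_funB.
- by move=> z _; rewrite lee_fin.
by rewrite normal_momentE -EFinM exprM sqr_sqrtr// divr_ge0// normal_moment_ge0.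
Qed.

End centered_gaussian.

(** * Equality of multidimensional laws *)

Section polynomial_threshold.
Context {R : realType}.

Lemma bernoulli_inequality (z : R) (n : nat) : -1 <= z -> 1 + n%:R * z <= (1 + z) ^+ n.
Proof.
move=> z1; elim: n => [|n IHn]; first by rewrite mul0r addr0 expr0.
rewrite exprS; apply: (@le_trans _ _ ((1 + z) * (1 + n%:R * z))).
  rewrite -subr_ge0 -natr1 [leRHS](_ : _ = n%:R * z ^+ 2); last by ring.
  by rewrite mulr_ge0// sqr_ge0.
by rewrite ler_wpM2l// -lerBlDl sub0r.
Qed.

(** Write $q=r^2$: then $nr^n\le\sum_{i<n}r^i\le 1/(1-r)$ stays bounded while the other factor $r^n$
    tends to 0. *)
Lemma cvg_mul_expr (q : R) : 0 <= q < 1 -> n%:R * q ^+ n @[n --> \oo] --> (0 : R).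
Proof.
move=> /andP[q0 q1]; set r := Num.sqrt q.
have r0 : 0 <= r by exact: sqrtr_ge0.
have r1 : r < 1 by rewrite -sqrtr1 ltr_sqrt.
have qE : q = r * r by rewrite -expr2 sqr_sqrtr.
have nr n : n%:R * r ^+ n <= (1 - r)^-1.
  rewrite -[leRHS]mul1r ler_pdivlMr ?subr_gt0//.
  have -> : n%:R * r ^+ n = \sum_(i < n) r ^+ n.
    by rewrite sumr_const card_ord -[RHS]mulr_natl.
  apply: (@le_trans _ _ (\sum_(i < n) r ^+ i * (1 - r))).
    rewrite mulr_suml; apply: ler_sum => i _; rewrite ler_wpM2r ?subr_ge0 ?(ltW r1)//.
    by apply: ler_wiXn2l => //; [exact: ltW|exact: ltnW].
  rewrite -mulr_suml mulrC -[1 - r]opprB mulNr -subrX1 opprB.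
  by rewrite gerBl exprn_ge0.
apply: (@squeeze_cvgr _ _ _ _ (cst 0) (fun n => (1 - r)^-1 * r ^+ n)).
- near=> n; rewrite mulr_ge0 ?exprn_ge0//= qE exprMn mulrA ler_wpM2r ?exprn_ge0// nr.
- exact: cvg_cst.
- rewrite -[X in _ --> X](mulr0 (1 - r)^-1); apply: cvgMr.
  by apply: cvg_expr; rewrite ger0_norm.
Unshelve. all: end_near. Qed.

(* Turns a [0, 1]-valued function into an indicator by algebra operations and
   bounded pointwise limits only. *)
Lemma cvg_threshold (y : R) : 0 <= y <= 1 ->
  (1 - y ^+ n) ^+ (n * 2 ^ n) @[n --> \oo] --> ((y < 2^-1)%R%:R : R).
Proof.
move=> /andP[y0 y1].
have yn1 n : y ^+ n <= 1 by rewrite exprn_ile1.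
have [yh|hy] := ltP y 2^-1.
  (* Bernoulli: the value is at least $1-n2^ny^n=1-n(2y)^n$, and $2y<1$. *)
  apply: (@squeeze_cvgr _ _ _ _ (fun n => 1 - n%:R * (2 * y) ^+ n) (cst 1)).
  - near=> n; rewrite exprn_ile1 ?subr_ge0 ?gerBl ?exprn_ge0// andbT.
    apply: le_trans (bernoulli_inequality _ _ _); last by rewrite lerN2 yn1.
    by rewrite mulrN natrM natrX exprMn mulrA.
  - rewrite -[X in _ --> X]subr0; apply: cvgB; first exact: cvg_cst.
    apply: cvg_mul_expr; rewrite mulr_ge0//=.
    by rewrite -[ltRHS](@divff _ 2)// ltr_pM2l.
  - exact: cvg_cst.
(* With $z=y^n$ and $N=n2^n$, Bernoulli gives $(1+z)^N\ge 1+n(2y)^n\ge n+1$, while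
   $(1-z)^N(1+z)^N\le 1$. The extra factor [n] in the exponent settles the tie $y=1/2$, where
   $(1-2^{-n})^{2^n}$ would tend to $1/e$. *)
apply: (@squeeze_cvgr _ _ _ _ (cst 0) (fun n => n.+1%:R^-1)).
- near=> n; rewrite exprn_ge0 ?subr_ge0//=.
  set N := (n * 2 ^ n)%N; set z := y ^+ n.
  have z0 : 0 <= z by rewrite exprn_ge0.
  have bz : n.+1%:R <= (1 + z) ^+ N.
    apply: le_trans (bernoulli_inequality _ _ _); last by rewrite (le_trans _ z0)// lerN10.
    rewrite -natr1 addrC lerD2l natrM natrX /z -mulrA -exprMn ler_peMr//.
    by rewrite exprn_ege1// -[leLHS](@divff _ 2)// ler_pM2l.
  rewrite -[leRHS]mul1r ler_pdivlMr//.
  apply: (@le_trans _ _ ((1 - z) ^+ N * (1 + z) ^+ N)).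
    by rewrite ler_wpM2l// exprn_ge0// subr_ge0 yn1.
  rewrite -exprMn exprn_ile1//.
    by rewrite mulr_ge0 ?subr_ge0 ?yn1// addr_ge0.
  by rewrite -subr_sqr expr1n gerBl sqr_ge0.
- exact: cvg_cst.
- exact: cvg_harmonic.
Unshelve. all: end_near. Qed.

(** As soon as $|x|/(n+1)<\pi$ the sine has the sign of [x], so the sequence is eventually constant.
    Stretching the period in this way turns periodic functions into half-lines. *)
Lemma cvg_sin_gt0 (x : R) : ((0 < sin (x / n.+1%:R))%R%:R : R) @[n --> \oo] --> ((0 < x)%R%:R : R).
Proof.
apply: cvg_near_cst; near=> n.
have xn : `|x| / n.+1%:R < pi.
  rewrite ltr_pdivrMr// (@lt_le_trans _ _ n.+1%:R)//; last first.
    by rewrite ler_peMl// (le_trans _ (pi_ge2 R))// ler1n.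
  rewrite (@le_lt_trans _ _ n%:R) ?ltr_nat//; near: n; exact: nbhs_infty_ger.
have [x0|x0|<-] := ltgtP 0 x; last by rewrite mul0r sin0 ltxx.
- by rewrite sin_gt0_pi// divr_gt0//= (le_lt_trans _ xn)// ler_wpM2r// ler_norm.
- rewrite -[x]opprK mulNr sinN oppr_gt0 ltNge ltW// sin_gt0_pi//.
  by rewrite divr_gt0 ?oppr_gt0//= (le_lt_trans _ xn)// ler_wpM2r// -normrN ler_norm.
Unshelve. all: end_near. Qed.

End polynomial_threshold.

(** * A Cramer-Wold principle for unions of half-spaces *)

Section cramer_wold.
Context {d} {Omega : measurableType d} {R : realType} (P : probability Omega R).
Context {n : nat} (X Y : 'I_n -> Omega -> R).
Hypothesis mX : forall i, measurable_fun setT (X i).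
Hypothesis mY : forall i, measurable_fun setT (Y i).
Hypothesis cosXY : forall (a : 'I_n -> R) (b : R),
  (\int[P]_w (cos (\sum_i a i * X i w + b))%:E =
   \int[P]_w (cos (\sum_i a i * Y i w + b))%:E)%E.

(* The pairs [(f (X w), f (Y w))] for [f] in the smallest class containing the
   trigonometric functions and stable under bounded pointwise limits. *)
Inductive trig_closure : (Omega -> R) -> (Omega -> R) -> Prop :=
| TrigCos (a : 'I_n -> R) (b : R) : trig_closure
    (fun w => cos (\sum_i a i * X i w + b)) (fun w => cos (\sum_i a i * Y i w + b))
| TrigLin (c : R) U V U' V' : trig_closure U V -> trig_closure U' V' ->
    trig_closure (fun w => c * U w + U' w) (fun w => c * V w + V' w)
| TrigLim (U_ V_ : nat -> Omega -> R) U V (M : R) :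
    (forall k, trig_closure (U_ k) (V_ k)) ->
    (forall k w, `|U_ k w| <= M) -> (forall k w, `|V_ k w| <= M) ->
    (forall w, U_ ^~ w @ \oo --> U w) -> (forall w, V_ ^~ w @ \oo --> V w) ->
    trig_closure U V.

Lemma trig_closure_bounded U V : trig_closure U V ->
  exists2 M : R, 0 <= M & forall w, `|U w| <= M /\ `|V w| <= M.
Proof.
elim=> [a b|c {}U {}V U' V' _ [M M0 bM] _ [M' M'0 bM']|U_ V_ {}U {}V M _ _ bU bV cU cV].
- by exists 1 => // w; rewrite !ler_norml !cos_le1 !cos_geN1.
- exists (`|c| * M + M'); first by rewrite addr_ge0// mulr_ge0.
  move=> w; have [UM VM] := bM w; have [U'M V'M] := bM' w.
  by split; rewrite (le_trans (ler_normD _ _))// lerD// normrM ler_wpM2l.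
- exists `|M| => // w; have leM := ler_norm M; split.
    apply: (cvgr_to_le (cvg_norm (cU w))).
    by apply: nearW => k; exact: le_trans (bU k w) leM.
  apply: (cvgr_to_le (cvg_norm (cV w))).
  by apply: nearW => k; exact: le_trans (bV k w) leM.
Qed.

Lemma trig_closure_measurable U V : trig_closure U V ->
  measurable_fun setT U /\ measurable_fun setT V.
Proof.
have mlin (Z : 'I_n -> Omega -> R) (a : 'I_n -> R) (b : R) :
    (forall i, measurable_fun setT (Z i)) ->
    measurable_fun setT (fun w => cos (\sum_i a i * Z i w + b)).
  move=> mZ; apply: measurableT_comp.
    by apply: continuous_measurable_fun; exact: continuous_cos.
  apply: measurable_funD => //; apply: measurable_sum => i.
  exact: measurable_funM.
elim=> [a b|c {}U {}V U' V' _ [mU mV] _ [mU' mV']|U_ V_ {}U {}V M _ mUV bU bV cU cV].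
- by split; exact: mlin.
- by split; apply: measurable_funD => //; exact: measurable_funM.
- split; [apply: (@measurable_fun_cvg _ _ _ _ U_)|apply: (@measurable_fun_cvg _ _ _ _ V_)] => //.
  + by move=> k; have [] := mUV k.
  + by move=> k; have [] := mUV k.
Qed.

Lemma integrable_bounded (U : Omega -> R) (M : R) : measurable_fun setT U ->
  (forall w, `|U w| <= M) -> P.-integrable setT (EFin \o U).
Proof.
move=> mU bU; apply: measurable_bounded_integrable => //.
  by rewrite /= probability_setT ltry.
exists M; split; first exact: num_real.
by move=> x Mx w _; exact: le_trans (bU w) (ltW Mx).
Qed.

(** Induction on the closure; the limit constructor is dominated convergence with the constant [M],
    which is integrable for a probability. *)
Lemma trig_closure_integral U V : trig_closure U V ->
  (\int[P]_w (U w)%:E = \int[P]_w (V w)%:E)%E.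
Proof.
elim=> [a b|c {}U {}V U' V' UV IH UV' IH'|U_ V_ {}U {}V M UV IH bU bV cU cV].
- exact: cosXY.
- have [M _ bM] := trig_closure_bounded _ _ UV.
  have [M' _ bM'] := trig_closure_bounded _ _ UV'.
  have [mU mV] := trig_closure_measurable _ _ UV.
  have [mU' mV'] := trig_closure_measurable _ _ UV'.
  have iU := integrable_bounded _ _ mU (fun w => (bM w).1).
  have iV := integrable_bounded _ _ mV (fun w => (bM w).2).
  have iU' := integrable_bounded _ _ mU' (fun w => (bM' w).1).
  have iV' := integrable_bounded _ _ mV' (fun w => (bM' w).2).
  under eq_integral do rewrite EFinD EFinM.
  under [RHS]eq_integral do rewrite EFinD EFinM.
  by rewrite !integralD//; [|exact: integrableZl..]; rewrite !integralZl// IH IH'.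
- have mUV k := trig_closure_measurable _ _ (UV k).
  have mU : measurable_fun setT U.
    by apply: (@measurable_fun_cvg _ _ _ _ U_) => // k; have [] := mUV k.
  have mV : measurable_fun setT V.
    by apply: (@measurable_fun_cvg _ _ _ _ V_) => // k; have [] := mUV k.
  have dct (Z_ : nat -> Omega -> R) (Z : Omega -> R) : (forall k, measurable_fun setT (Z_ k)) ->
      measurable_fun setT Z -> (forall k w, `|Z_ k w| <= M) ->
      (forall w, Z_ ^~ w @ \oo --> Z w) ->
      (\int[P]_w (Z_ k w)%:E)%E @[k --> \oo] --> (\int[P]_w (Z w)%:E)%E.
    move=> mZ_ mZ bZ cZ.
    have [] := @dominated_convergence _ _ _ P setT measurableT
      (fun k w => (Z_ k w)%:E) (fun w => (Z w)%:E) (cst M%:E) => //.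
    + by move=> k; exact/measurable_EFinP.
    + exact/measurable_EFinP.
    + by apply: aeW => w _; apply: cvg_EFin; [exact: nearW|exact: cZ].
    + exact: finite_measure_integrable_cst.
    + by apply: aeW => w k _; rewrite lee_fin.
  have cU' := dct U_ U (fun k => (mUV k).1) mU bU cU.
  have cV' := dct V_ V (fun k => (mUV k).2) mV bV cV.
  apply/(cvg_unique _ cU') => //=.
  by under eq_fun do rewrite IH.
Qed.

Lemma trig_closure_cst (c : R) : trig_closure (cst c) (cst c).
Proof.
have one : trig_closure (cst 1) (cst 1).
  have := TrigCos (fun=> 0) 0; congr trig_closure; apply/funext => w;
  by rewrite big1 ?addr0 ?cos0// => i _; rewrite mul0r.
have zero : trig_closure (cst 0) (cst 0).
  have := TrigLin (-1) _ _ _ _ one one; congr trig_closure; apply/funext => w;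
  by rewrite /= mulr1 addNr.
have := TrigLin c _ _ _ _ one zero; congr trig_closure; apply/funext => w;
by rewrite /= mulr1 addr0.
Qed.

Lemma trig_closureZ c U V : trig_closure U V ->
  trig_closure (fun w => c * U w) (fun w => c * V w).
Proof.
move=> UV; have := TrigLin c _ _ _ _ UV (trig_closure_cst 0).
by congr trig_closure; apply/funext => w; rewrite /= addr0.
Qed.

Lemma trig_closureBl c U V : trig_closure U V ->
  trig_closure (fun w => c - U w) (fun w => c - V w).
Proof.
move=> UV; have := TrigLin (-1) _ _ _ _ UV (trig_closure_cst c).
by congr trig_closure; apply/funext => w; rewrite /= mulN1r addrC.
Qed.

(** A product of two cosines is half the sum of the cosines of the sum and of the difference of
    their arguments, again linear in the variables. Two nested inductions carry this to the whole
    closure. *)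
Lemma trig_closureM U V U' V' : trig_closure U V -> trig_closure U' V' ->
  trig_closure (fun w => U w * U' w) (fun w => V w * V' w).
Proof.
have cos_prod (z : 'I_n -> R) a b a' b' :
    2^-1 * cos (\sum_i (a i + a' i) * z i + (b + b')) +
    2^-1 * cos (\sum_i (a i - a' i) * z i + (b - b')) =
    cos (\sum_i a i * z i + b) * cos (\sum_i a' i * z i + b').
  under eq_bigr do rewrite mulrDl.
  under [in X in _ + X]eq_bigr do rewrite mulrBl.
  rewrite big_split sumrB/=; set s := \sum_i _; set s' := \sum_i _.
  rewrite (_ : s + s' + (b + b') = (s + b) + (s' + b')); last by ring.
  rewrite (_ : s - s' + (b - b') = (s + b) - (s' + b')); last by ring.
  by rewrite cosB cosD; field.
(* Multiplication by a fixed bounded pair commutes with bounded limits; it serves once for each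
   factor. *)
have limM F G (U_ V_ : nat -> Omega -> R) U0 V0 M :
    (exists2 M : R, 0 <= M & forall w, `|F w| <= M /\ `|G w| <= M) ->
    (forall k, trig_closure (fun w => F w * U_ k w) (fun w => G w * V_ k w)) ->
    (forall k w, `|U_ k w| <= M) -> (forall k w, `|V_ k w| <= M) ->
    (forall w, U_ ^~ w @ \oo --> U0 w) -> (forall w, V_ ^~ w @ \oo --> V0 w) ->
    trig_closure (fun w => F w * U0 w) (fun w => G w * V0 w).
  move=> [M' M'0 bFG] FGUV bU bV cU cV.
  apply: (TrigLim (fun k w => F w * U_ k w) (fun k w => G w * V_ k w) _ _ (M' * M)) => //.
  - by move=> k w; rewrite normrM ler_pM//; have [] := bFG w.
  - by move=> k w; rewrite normrM ler_pM//; have [] := bFG w.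
  - by move=> w; apply: cvgMr; exact: cU.
  - by move=> w; apply: cvgMr; exact: cV.
move=> UV UV'; have bUV' := trig_closure_bounded _ _ UV'.
elim: UV => [a b|c {}U {}V U2 V2 UV IH UV2 IH2|U_ V_ {}U {}V M UV IH bU bV cU cV].
- have bcos : exists2 M : R, 0 <= M & forall w,
      `|cos (\sum_i a i * X i w + b)| <= M /\ `|cos (\sum_i a i * Y i w + b)| <= M.
    exact: trig_closure_bounded (TrigCos a b).
  elim: UV' {bUV'} => [a' b'|c {}U' {}V' U2 V2 UV IH UV2 IH2|U_ V_ {}U' {}V' M UV IH bU bV cU cV].
  + have := TrigLin 2^-1 _ _ _ _ (TrigCos (fun i => a i + a' i) (b + b'))
      (trig_closureZ 2^-1 _ _ (TrigCos (fun i => a i - a' i) (b - b'))).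
    congr trig_closure; apply/funext => w;
    by rewrite cos_prod.
  + have := TrigLin c _ _ _ _ IH IH2; congr trig_closure; apply/funext => w;
    by rewrite mulrDr mulrCA.
  + exact: limM bcos IH bU bV cU cV.
- have := TrigLin c _ _ _ _ IH IH2; congr trig_closure; apply/funext => w;
  by rewrite mulrDl mulrA.
- under eq_fun do rewrite mulrC.
  under [X in trig_closure _ X]eq_fun do rewrite mulrC.
  apply: (limM _ _ U_ V_ _ _ M bUV') => // k.
  under eq_fun do rewrite mulrC.
  by under [X in trig_closure _ X]eq_fun do rewrite mulrC.
Qed.

Lemma trig_closureX k U V : trig_closure U V ->
  trig_closure (fun w => U w ^+ k) (fun w => V w ^+ k).
Proof.
move=> UV; elim: k => [|k IHk]; first exact: trig_closure_cst.
have := trig_closureM _ _ _ _ UV IHk.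
by congr trig_closure; apply/funext => w; rewrite exprS.
Qed.

(** The function $(1-\sin((X_i-c)/(k+1)))/2$ lies in $[0,1]$ and is below $1/2$ exactly when the
    sine is positive. Thresholding it by [cvg_threshold] and then letting [k] grow gives the
    half-line. *)
Lemma trig_closure_ray i c :
  trig_closure (fun w => (c < X i w)%R%:R) (fun w => (c < Y i w)%R%:R).
Proof.
(* The sine is a cosine shifted by $\pi/2$, and the coefficients select the coordinate [i]. *)
have sinE (Z : 'I_n -> Omega -> R) k w :
    2^-1 * (1 - cos (\sum_j (if j == i then k.+1%:R^-1 else 0) * Z j w +
      (- (c / k.+1%:R) - pi / 2))) = (1 - sin ((Z i w - c) / k.+1%:R)) / 2.
  rewrite mulrC (bigD1 i)//= eqxx big1 ?addr0; last by move=> j /negbTE ->; rewrite mul0r.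
  by rewrite addrA cosBpihalf [(Z i w - c) * _]mulrBl [Z i w * _]mulrC.
have sinXY k : trig_closure (fun w => (1 - sin ((X i w - c) / k.+1%:R)) / 2)
                            (fun w => (1 - sin ((Y i w - c) / k.+1%:R)) / 2).
  have := trig_closureZ 2^-1 _ _ (trig_closureBl 1 _ _
    (TrigCos (fun j => if j == i then k.+1%:R^-1 else 0) (- (c / k.+1%:R) - pi / 2))).
  by congr trig_closure; apply/funext => w; rewrite sinE.
have b01 (x : R) : 0 <= (1 - sin x) / 2 <= 1.
  have := sin_le1 x; have := sin_geN1 x; lra.
have bbool (b : bool) : `|b%:R : R| <= 1 by rewrite ger0_norm// lern1 leq_b1.
have sgnXY k : trig_closure (fun w => (0 < sin ((X i w - c) / k.+1%:R))%R%:R)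
                            (fun w => (0 < sin ((Y i w - c) / k.+1%:R))%R%:R).
  have half (x : R) : ((1 - x) / 2 < 2^-1) = (0 < x) by apply/idP/idP; lra.
  apply: (TrigLim _ _ _ _ 1 (fun m => trig_closureX (m * 2 ^ m) _ _
    (trig_closureBl 1 _ _ (trig_closureX m _ _ (sinXY k))))).
  - move=> m w; have /andP[y0 y1] := b01 ((X i w - c) / k.+1%:R).
    by rewrite ger0_norm ?exprn_ge0 ?exprn_ile1 ?subr_ge0 ?exprn_ile1// gerBl exprn_ge0.
  - move=> m w; have /andP[y0 y1] := b01 ((Y i w - c) / k.+1%:R).
    by rewrite ger0_norm ?exprn_ge0 ?exprn_ile1 ?subr_ge0 ?exprn_ile1// gerBl exprn_ge0.
  - by move=> w; rewrite -half; exact: cvg_threshold.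
  - by move=> w; rewrite -half; exact: cvg_threshold.
apply: (TrigLim _ _ _ _ 1 sgnXY).
- by move=> m w.
- by move=> m w.
- by move=> w; rewrite -subr_gt0; exact: cvg_sin_gt0.
- by move=> w; rewrite -subr_gt0; exact: cvg_sin_gt0.
Qed.

Lemma trig_closure_exists_gt (c : 'I_n -> R) :
  trig_closure (fun w => [exists i, c i < X i w]%R%:R) (fun w => [exists i, c i < Y i w]%R%:R).
Proof.
have prodE (Z : 'I_n -> Omega -> R) w :
    ([exists i, c i < Z i w]%R%:R = 1 - \prod_(i <- enum 'I_n) (1 - (c i < Z i w)%R%:R) :> R).
  case: existsP => [[i ci]|nex].
    rewrite (big_rem i) ?mem_enum//= ci subrr mul0r subr0//.
  rewrite big1 ?subrr// => i _; case: ltP => [ci|_]; last by rewrite subr0.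
  by exfalso; apply: nex; exists i.
under eq_fun do rewrite prodE.
under [X in trig_closure _ X]eq_fun do rewrite prodE.
apply: trig_closureBl; elim: (enum 'I_n) => [|i s IHs].
  under eq_fun do rewrite big_nil.
  under [X in trig_closure _ X]eq_fun do rewrite big_nil.
  exact: trig_closure_cst.
under eq_fun do rewrite big_cons.
under [X in trig_closure _ X]eq_fun do rewrite big_cons.
by apply: trig_closureM => //; apply: trig_closureBl; exact: trig_closure_ray.
Qed.

(** Unions of half-spaces are the events wanted here: the maximum of finitely many variables, each
    with its own offset, exceeds a level. *)
Lemma cramer_wold (c : 'I_n -> R) :
  P [set w | exists i, c i < X i w] = P [set w | exists i, c i < Y i w].
Proof.
have PE (Z : 'I_n -> Omega -> R) : (forall i, measurable_fun setT (Z i)) ->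
    (P [set w | exists i, (c i < Z i w)%R] = \int[P]_w ([exists i, (c i < Z i w)%R]%:R)%:E)%E.
  move=> mZ; rewrite -[X in P X]setIT -integral_indic//; last first.
    rewrite [X in measurable X](_ : _ = \bigcup_i [set w | c i < Z i w]).
      apply: fin_bigcup_measurable => // i _.
      by rewrite -[X in measurable X]setTI; exact: measurable_fun_ltr.
    by apply/seteqP; split => w /= [i]; [exists i|move=> _ ?; exists i].
  apply: eq_integral => w _; rewrite indicE; congr (_%:R)%:E; congr nat_of_bool.
  by apply/idP/existsP; rewrite inE.
by rewrite !PE//; exact: trig_closure_integral (trig_closure_exists_gt c).
Qed.

End cramer_wold.

Section second_moments.
Context {d} {Omega : measurableType d} {R : realType} (P : probability Omega R).

Lemma integrable_mul (X Y : Omega -> R) :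
  measurable_fun setT X -> measurable_fun setT Y ->
  (\int[P]_w (X w ^+ 2)%:E < +oo)%E -> (\int[P]_w (Y w ^+ 2)%:E < +oo)%E ->
  P.-integrable setT (fun w => (X w * Y w)%:E).
Proof.
move=> mX mY X2 Y2.
have isq (Z : Omega -> R) : measurable_fun setT Z -> (\int[P]_w (Z w ^+ 2)%:E < +oo)%E ->
    P.-integrable setT (fun w => (Z w ^+ 2)%:E).
  move=> mZ Z2; apply/integrableP; split; first exact/measurable_EFinP/measurable_funX.
  by under eq_integral do rewrite gee0_abs ?lee_fin ?sqr_ge0//.
apply: (le_integrable _ _ _ (integrableD _ (isq X mX X2) (isq Y mY Y2))) => //.
  exact/measurable_EFinP/measurable_funM.
move=> w _ /=; rewrite lee_fin [leRHS]ger0_norm ?addr_ge0 ?sqr_ge0//.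
rewrite normrM -[X w ^+ 2]ger0_norm ?sqr_ge0// -[Y w ^+ 2]ger0_norm ?sqr_ge0// !normrX.
have := sqr_ge0 (`|X w| - `|Y w|); have := normr_ge0 (X w); have := normr_ge0 (Y w).
by nra.
Qed.

Lemma integrable_sqr (X : Omega -> R) : measurable_fun setT X ->
  (\int[P]_w (X w ^+ 2)%:E < +oo)%E -> P.-integrable setT (EFin \o X).
Proof.
move=> mX X2; rewrite (_ : EFin \o X = (fun w => (X w * cst 1 w)%:E)); last first.
  by apply/funext => w; rewrite /= mulr1.
apply: integrable_mul => //.
by under eq_integral do rewrite expr1n; rewrite probability_integral_cst ltry.
Qed.

Lemma integral_sqr_sum n (X : 'I_n -> Omega -> R) (K : 'I_n -> 'I_n -> R) (a : 'I_n -> R) :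
  (forall i, measurable_fun setT (X i)) ->
  (forall i j, (\int[P]_w (X i w * X j w)%:E = (K i j)%:E)%E) ->
  (\int[P]_w ((\sum_i a i * X i w) ^+ 2)%:E = (\sum_i \sum_j a i * a j * K i j)%:E)%E.
Proof.
move=> mX XK.
have X2 i : (\int[P]_w (X i w ^+ 2)%:E < +oo)%E.
  by under eq_integral do rewrite expr2; rewrite XK ltry.
have iX i j : P.-integrable setT (fun w => (a i * a j * (X i w * X j w))%:E).
  under eq_fun do rewrite EFinM.
  by apply: integrableZl => //; exact: integrable_mul.
under eq_integral => w _.
  rewrite expr2 mulr_suml -sumEFin.
  under eq_bigr => i _.
    rewrite mulr_sumr -sumEFin.
    under eq_bigr do rewrite mulrACA.
    over.
  over.
rewrite integral_sum//; last by move=> i; exact: integrable_sum.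
rewrite -sumEFin; apply: eq_bigr => i _.
rewrite integral_sum// -sumEFin; apply: eq_bigr => j _.
under eq_integral do rewrite EFinM.
by rewrite integralZl//; [rewrite XK|exact: integrable_mul].
Qed.

End second_moments.

(** * Increments of fractional Brownian motion *)

Section fbm_law.
Context {d} {Omega : measurableType d} {R : realType} (P : probability Omega R).
Context {H : R} (H_gt0 : 0 < H) (W : fractional_brownian_motion P H).

Definition fbm_cov (s t : R) : R :=
  2^-1 * (t `^ (2 * H) + s `^ (2 * H) - `|t - s| `^ (2 * H)).

Lemma fbm_integral t : 0 <= t -> (\int[P]_w (W t w)%:E = 0)%E.
Proof. by move=> t0; have := fbm_mean W t0; rewrite expectation_def. Qed.

Lemma fbm_integralM s t : 0 <= s -> 0 <= t ->
  (\int[P]_w (W s w * W t w)%:E = (fbm_cov s t)%:E)%E.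
Proof.
move=> s0 t0; rewrite -(fbm_covariance W s0 t0) covariance.unlock !fbm_mean//.
rewrite expectation.unlock; apply: eq_integral => w _.
by rewrite /= fctE /= !subr0.
Qed.

Lemma fbm_covE t : 0 <= t -> fbm_cov t t = t `^ (2 * H).
Proof.
move=> t0; rewrite /fbm_cov subrr normr0 powR0 ?mulf_neq0 ?gt_eqF//.
by rewrite subr0; field.
Qed.

Lemma fbm_sqr_lty t : 0 <= t -> (\int[P]_w (W t w ^+ 2)%:E < +oo)%E.
Proof. by move=> t0; under eq_integral do rewrite expr2; rewrite fbm_integralM// ltry. Qed.

Lemma fbm_integrable t : 0 <= t -> P.-integrable setT (EFin \o W t).
Proof. by move=> t0; apply: integrable_sqr => //; exact: fbm_sqr_lty. Qed.

Lemma fbm_lin_integral n (a t : 'I_n -> R) : (forall i, 0 <= t i) ->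
  (\int[P]_w (\sum_i a i * W (t i) w)%:E = 0)%E.
Proof.
move=> t0; have iW i : P.-integrable setT (fun w => (a i * W (t i) w)%:E).
  by under eq_fun do rewrite EFinM; apply: integrableZl => //; exact: fbm_integrable.
under eq_integral do rewrite -sumEFin.
rewrite integral_sum// big1// => i _; under eq_integral do rewrite EFinM.
by rewrite integralZl//; [rewrite fbm_integral// mule0|exact: fbm_integrable].
Qed.

Lemma gaussian_cos_eq (X Y : Omega -> R) (v b : R) : gaussian_rv P X -> gaussian_rv P Y ->
  (\int[P]_w (X w)%:E = 0)%E -> (\int[P]_w (Y w)%:E = 0)%E ->
  (\int[P]_w (X w ^+ 2)%:E = v%:E)%E -> (\int[P]_w (Y w ^+ 2)%:E = v%:E)%E ->
  (\int[P]_w (cos (X w + b))%:E = \int[P]_w (cos (Y w + b))%:E)%E.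
Proof.
(* Adding 1 makes the cosine a nonnegative test function; the 1 is cancelled at the end. *)
move=> gX gY EX EY X2 Y2; pose g (x : R) := 1 + cos (x + b).
have g0 x : 0 <= g x by rewrite /g -lerBlDl sub0r cos_geN1.
have ccos : continuous (fun x : R => cos (x + b)).
  by move=> x; apply: continuous_comp; [apply: cvgD; [exact: cvg_id|exact: cvg_cst]|exact: continuous_cos].
have cg : continuous g by move=> x; apply: cvgD; [exact: cvg_cst|exact: ccos].
have := centered_gaussian_law_var _ _ _ gX EX X2 g g0 cg.
rewrite -(centered_gaussian_law_var _ _ _ gY EY Y2 g g0 cg) /g.
have icos (Z : Omega -> R) : gaussian_rv P Z -> P.-integrable setT (fun w => (cos (Z w + b))%:E).
  move=> [mZ _]; apply: (integrable_bounded P _ 1).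
    apply: (measurableT_comp (f := fun x : R => cos (x + b))) => //.
    exact: continuous_measurable_fun.
  by move=> w; rewrite ler_norml cos_le1 cos_geN1.
under eq_integral do rewrite EFinD.
under [X in _ = X -> _]eq_integral do rewrite EFinD.
rewrite !integralD//; [|exact: finite_measure_integrable_cst|exact: icos
  |exact: finite_measure_integrable_cst|exact: icos].
rewrite probability_integral_cst !(addeC 1%E).
by move/(congr1 (fun z => z - 1%:E)%E); rewrite !addeK.
Qed.

Lemma gaussian_increments n (a s : 'I_n -> R) (t : R) :
  (forall i, 0 <= s i <= t) -> 0 <= t ->
  gaussian_rv P (fun w => \sum_i a i * (W t w - W (t - s i) w)) /\
  (\int[P]_w (\sum_i a i * (W t w - W (t - s i) w))%:E = 0)%E.
Proof.
move=> st t0.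
(* Index 0 carries the common time [t] with the total weight; the others carry [t - s j] with weight
   [- a j]. *)
pose a' (i : 'I_n.+1) := if unlift ord0 i is Some j then - a j else \sum_j a j.
pose t' (i : 'I_n.+1) := if unlift ord0 i is Some j then t - s j else t.
have t'0 i : 0 <= t' i.
  by rewrite /t'; case: unlift => // j; rewrite subr_ge0; have /andP[] := st j.
have E : (fun w => \sum_i a i * (W t w - W (t - s i) w)) =
         (fun w => \sum_i a' i * W (t' i) w).
  apply/funext => w; rewrite big_ord_recl /a' /t' unlift_none mulr_suml -big_split/=.
  by apply: eq_bigr => i _; rewrite liftK mulrBr mulNr.
split; first by rewrite E; exact: fbm_gaussian.
by under eq_integral do rewrite (congr1 (@^~ _) E); exact: fbm_lin_integral.
Qed.

(** The process seen backwards from [t] has the covariance of [W]: in the expansion of the product,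
    the powers of [t], [t - s] and [t - s'] cancel, and those of [s], [s'] and of their distance
    remain. *)
Lemma increment_integralM s s' t : 0 <= s <= t -> 0 <= s' <= t ->
  (\int[P]_w ((W t w - W (t - s) w) * (W t w - W (t - s') w))%:E = (fbm_cov s s')%:E)%E.
Proof.
move=> /andP[s0 st] /andP[s'0 s't].
have t0 : 0 <= t := le_trans s0 st.
have u0 : 0 <= t - s by rewrite subr_ge0.
have v0 : 0 <= t - s' by rewrite subr_ge0.
have iM x y : 0 <= x -> 0 <= y -> P.-integrable setT (fun w => (W x w * W y w)%:E).
  by move=> x0 y0; apply: integrable_mul => //; exact: fbm_sqr_lty.
under eq_integral => w _.
  rewrite (_ : _ * _ = (W t w * W t w + W (t - s) w * W (t - s') w) -
    (W t w * W (t - s') w + W (t - s) w * W t w)); last by ring.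
  rewrite EFinB 2!EFinD.
  over.
rewrite integralB//; [|by apply: integrableD => //; exact: iM..].
rewrite !integralD//; [|exact: iM..].
rewrite !fbm_integralM// -!EFinD; congr EFin.
rewrite fbm_covE// /fbm_cov.
rewrite (_ : t - s' - t = - s'); last by ring.
rewrite (_ : t - (t - s) = s); last by ring.
rewrite (_ : t - s' - (t - s) = s - s'); last by ring.
rewrite normrN !(ger0_norm s0) !(ger0_norm s'0) (distrC s s').
by field.
Qed.

Lemma increments_cos_eq n (a s : 'I_n -> R) (t b : R) : (forall i, 0 <= s i <= t) -> 0 <= t ->
  (\int[P]_w (cos (\sum_i a i * (W t w - W (t - s i) w) + b))%:E =
   \int[P]_w (cos (\sum_i a i * W (s i) w + b))%:E)%E.
Proof.
move=> st t0; have [gX EX] := gaussian_increments n a s t st t0.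
have s0 i : 0 <= s i by have /andP[] := st i.
apply: (gaussian_cos_eq _ _ (\sum_i \sum_j a i * a j * fbm_cov (s i) (s j))) => //.
- exact: fbm_gaussian.
- exact: fbm_lin_integral.
- apply: integral_sqr_sum => [i|i j].
    by apply: measurable_funB.
  exact: increment_integralM.
- by apply: integral_sqr_sum => // i j; exact: fbm_integralM.
Qed.

(** Finite-dimensional stationarity in time-reversed form: both vectors are centred Gaussian with
    the same covariance. *)
Lemma fbm_stationary_orthant n (s c : 'I_n -> R) (t : R) : (forall i, 0 <= s i <= t) -> 0 <= t ->
  P [set w | exists i, c i < W t w - W (t - s i) w] = P [set w | exists i, c i < W (s i) w].
Proof.
move=> st t0.
apply: (cramer_wold P (fun i w => W t w - W (t - s i) w) (fun i w => W (s i) w)) => //.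
  by move=> i; exact: measurable_funB.
by move=> a b; exact: increments_cos_eq.
Qed.

Lemma fbm_increment_moment (s t : R) (k : nat) : 0 <= s <= t ->
  (\int[P]_w ((W t w - W s w) ^+ (2 * k))%:E =
   (((t - s) `^ (2 * H) / normal_moment 1) ^+ k * normal_moment k)%:E)%E.
Proof.
move=> /andP[s0 st].
have ts : 0 <= t - s <= t by rewrite subr_ge0 st/= lerBlDr lerDl.
have t0 : 0 <= t := le_trans s0 st.
have [] := gaussian_increments 1 (fun=> 1) (fun=> t - s) t (fun=> ts) t0.
have E : (fun w => \sum_(i < 1) 1 * (W t w - W (t - (t - s)) w)) = (fun w => W t w - W s w).
  by apply/funext => w; rewrite big_ord1 mul1r (_ : t - (t - s) = s)//; ring.
rewrite E => gX; under eq_integral do rewrite (congr1 (@^~ _) E); move=> EX.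
apply: centered_gaussian_moment => //; first exact: powR_ge0.
have /andP[ts0 _] := ts.
have := increment_integralM _ _ _ ts ts; rewrite fbm_covE// => <-.
by apply: eq_integral => w _; rewrite (_ : t - (t - s) = s) ?expr2//; ring.
Qed.

End fbm_law.

(** * Reflected paths *)

Section dyadic.
Context {R : realType}.

Definition dyadic (t : R) (n i : nat) : R := t * (i%:R / 2 ^+ n).

Lemma dyadic_range t n i : 0 <= t -> (i <= 2 ^ n)%N -> 0 <= dyadic t n i <= t.
Proof.
move=> t0 ni; rewrite /dyadic mulr_ge0 ?divr_ge0 ?exprn_ge0//=.
by rewrite ler_piMr// ler_pdivrMr ?exprn_gt0// mul1r -natrX ler_nat.
Qed.

Lemma dyadicS t n i : dyadic t n.+1 i.*2 = dyadic t n i.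
Proof. by rewrite /dyadic -muln2 natrM exprS; congr (_ * _); field; rewrite expf_neq0. Qed.

Lemma dyadic_rev t n i : (i <= 2 ^ n)%N -> dyadic t n (2 ^ n - i) = t - dyadic t n i.
Proof. by move=> ni; rewrite /dyadic natrB// natrX; field; rewrite expf_neq0. Qed.

Lemma dyadic_dense (f : R -> R) (t s c : R) : {within `[0, t], continuous f} ->
  0 <= s <= t -> c < f s -> exists n, exists2 i : nat, (i <= 2 ^ n)%N & c < f (dyadic t n i).
Proof.
move=> /subspace_continuousP cf /andP[s0 st] cfs.
have [t0|t0] := leP t 0.
  exists 0%N, 0%N => //.
  have -> // : dyadic t 0 0 = s.
  by rewrite /dyadic mul0r mulr0; apply/eqP; rewrite eq_le s0 (le_trans st).
have /cvgrPdist_lt /(_ (f s - c)) : f x @[x --> within `[0, t] (nbhs s)] --> f s.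
  by apply: cf; rewrite /= in_itv/= s0.
rewrite subr_gt0 => /(_ cfs) [/= e e0 ef].
(* The mesh [t / 2 ^+ n] becomes smaller than the radius [e] of continuity at [s]. *)
have [n nP] : exists n : nat, t / e < 2 ^+ n.
  have := nbhs_infty_gtr (t / e) => -[N _ /(_ _ (leqnn N))] tN.
  exists N; apply: lt_trans tN _; rewrite -natrX ltr_nat; exact: ltn_expl.
(* The grid point is [s] rounded down, so it stays in the interval and lies within one mesh of
   [s]. *)
set y := s / t * 2 ^+ n.
have y0 : 0 <= y by rewrite mulr_ge0 ?divr_ge0 ?exprn_ge0// ltW.
have yE : s = t * (y / 2 ^+ n).
  by rewrite /y; field; rewrite expf_neq0//= gt_eqF.
have /andP[iy yi] := truncn_itv y0.
exists n, (Num.truncn y).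
  rewrite -(ler_nat R) natrX (le_trans iy)// /y ler_piMl ?exprn_ge0//.
  by rewrite ler_pdivrMr// mul1r.
have := ef (dyadic t n (Num.truncn y)); rewrite /=.
have dleq : dyadic t n (Num.truncn y) <= s.
  by rewrite [leRHS]yE /dyadic ler_wpM2l ?ler_wpM2r ?invr_ge0 ?exprn_ge0// ltW.
have d0 : 0 <= dyadic t n (Num.truncn y) by rewrite /dyadic mulr_ge0 ?divr_ge0 ?exprn_ge0// ltW.
have dle : s - dyadic t n (Num.truncn y) < e.
  rewrite {1}yE /dyadic -mulrBr -mulrBl.
  apply: (@le_lt_trans _ _ (t * (1 / 2 ^+ n))).
    by rewrite ler_wpM2l ?ler_wpM2r ?invr_ge0 ?exprn_ge0 ?(ltW t0)// lerBlDl natr1 ltW.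
  by rewrite mul1r ltr_pdivrMr ?exprn_gt0// mulrC -ltr_pdivrMr.
rewrite /ball/= ger0_norm ?subr_ge0// => /(_ dle).
rewrite /= in_itv/= d0 (le_trans dleq st) => /(_ isT).
by rewrite ltr_norml => /andP[_]; rewrite ltrD2l ltrN2.
Qed.

Lemma dyadic_existsP (f : R -> R) (t c : R) : 0 <= t -> {within `[0, t], continuous f} ->
  (exists2 s, 0 <= s <= t & c < f s) <->
  exists n, exists i : 'I_(2 ^ n).+1, c < f (dyadic t n i).
Proof.
move=> t0 cf; split=> [[s st cfs]|[n [i ci]]].
  have [n [i ni ci]] := dyadic_dense f t s c cf st cfs.
  by exists n, (Ordinal (ni : i < (2 ^ n).+1)%N).
by exists (dyadic t n i) => //; apply: dyadic_range => //; rewrite -ltnS.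
Qed.

End dyadic.

Section dyadic_events.
Context {d} {Omega : measurableType d} {R : realType} (P : probability Omega R).
Variable (t : R).
Hypothesis t0 : 0 <= t.
Implicit Types F G : R -> Omega -> R.

Definition dyadic_event F c n := [set w | exists i : 'I_(2 ^ n).+1, c < F (dyadic t n i) w].

Let mF (F : R -> Omega -> R) := forall s, 0 <= s <= t -> measurable_fun setT (F s).
Let cF (F : R -> Omega -> R) := forall w, {within `[0, t], continuous (F ^~ w)}.

Lemma dyadic_eventE F c : cF F ->
  [set w | exists2 s, 0 <= s <= t & c < F s w] = \bigcup_n dyadic_event F c n.
Proof.
move=> cfF; apply/seteqP; split => w /=.
  by move/(dyadic_existsP (F ^~ w) t c t0 (cfF w)) => [n [i ci]]; exists n => //; exists i.
by move=> [n _ [i ci]]; apply/(dyadic_existsP (F ^~ w) t c t0 (cfF w)); exists n, i.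
Qed.

Lemma measurable_dyadic_event F c n : mF F -> measurable (dyadic_event F c n).
Proof.
move=> mfF; rewrite (_ : dyadic_event F c n = \bigcup_(i : 'I_(2 ^ n).+1) [set w | c < F (dyadic t n i) w]).
  apply: fin_bigcup_measurable => // i _.
  rewrite -[X in measurable X]setTI; apply: measurable_fun_ltr => //.
  by apply: mfF; apply: dyadic_range => //; rewrite -ltnS.
by apply/seteqP; split => w /= [i]; [exists i|move=> _ ?; exists i].
Qed.

Lemma measurable_exists_gt F c : mF F -> cF F ->
  measurable [set w | exists2 s, 0 <= s <= t & c < F s w].
Proof.
move=> mfF cfF; rewrite dyadic_eventE//; apply: bigcupT_measurable => n.
exact: measurable_dyadic_event.
Qed.

Lemma dyadic_event_nondecreasing F c : nondecreasing_seq (dyadic_event F c).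
Proof.
apply/nondecreasing_seqP => n; apply/subsetPset => w /= [i ci].
have i2 : (i.*2 < (2 ^ n.+1).+1)%N by rewrite ltnS expnS mul2n leq_double -ltnS.
by exists (Ordinal i2); rewrite /= dyadicS.
Qed.

(** The grids are nested, so the event for a continuous path is an increasing union of grid events
    and continuity of the measure from below applies. *)
Lemma probability_exists_gt F G c : mF F -> cF F -> mF G -> cF G ->
  (forall n, P (dyadic_event F c n) = P (dyadic_event G c n)) ->
  P [set w | exists2 s, 0 <= s <= t & c < F s w] =
  P [set w | exists2 s, 0 <= s <= t & c < G s w].
Proof.
move=> mfF cfF mfG cfG FG; rewrite !dyadic_eventE//.
have cvgE (Z : R -> Omega -> R) : mF Z -> cF Z ->
    P (dyadic_event Z c n) @[n --> \oo] --> P (\bigcup_n dyadic_event Z c n).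
  move=> mZ cZ; apply: nondecreasing_cvg_mu.
  - by move=> n; exact: measurable_dyadic_event.
  - by apply: bigcupT_measurable => n; exact: measurable_dyadic_event.
  - exact: dyadic_event_nondecreasing.
have := cvgE F mfF cfF; under eq_fun do rewrite FG.
by move/(cvg_unique _); apply => //; exact: cvgE.
Qed.

End dyadic_events.

Section paths.
Context {d} {Omega : measurableType d} {R : realType} (P : probability Omega R).
Context {H : R} (W : fractional_brownian_motion P H).
Implicit Types (u x t c : R) (w : Omega).

Lemma regulator_max u x w t : 0 <= t -> exists2 s, 0 <= s <= t &
  (forall r, 0 <= r <= t -> free_path W u x w s <= free_path W u x w r) /\
  regulator W u x w t = Num.max 0 (- free_path W u x w s).
Proof.
move=> t0; have [s st [smin E]] := free_path_min W u x w t0.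
exists s; first by move: st; rewrite in_itv.
split; first by move=> r rt; apply: smin; rewrite in_itv.
by rewrite /regulator E oppr_min oppr0.
Qed.

Lemma regulator_ge0 u x w t : 0 <= regulator W u x w t.
Proof. by rewrite /regulator oppr_ge0 ge_min lexx. Qed.

Lemma regulator_at0 u x w : 0 <= x -> regulator W u x w 0 = 0.
Proof.
move=> x0; have [s /andP[s0 s0'] [_ ->]] := regulator_max u x w 0 (lexx _).
have -> : s = 0 by apply/eqP; rewrite eq_le s0 s0'.
by apply/max_idPl; rewrite /free_path mulr0 subr0 fbm_start addr0 oppr_le0.
Qed.

Lemma regulator_neg u x w t : t < 0 -> regulator W u x w t = 0.
Proof.
move=> t0; rewrite /regulator set_itv_ge ?bnd_simp -?ltNge//.
by rewrite image_set0 inf0 minxx oppr0.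
Qed.

Lemma regulator_gtP u x w t c : 0 <= t ->
  (c < regulator W u x w t) <-> c < 0 \/ exists2 s, 0 <= s <= t & c < - free_path W u x w s.
Proof.
move=> t0; have [s st [smin ->]] := regulator_max u x w t t0.
rewrite lt_max; split => [/orP[->|cs]|[->//|[r rt cr]]]; [by left|by right; exists s|].
by apply/orP; right; rewrite (lt_le_trans cr)// lerN2 smin.
Qed.

Lemma workload_ge0 u x w t : 0 <= t -> 0 <= workload W u x w t.
Proof.
move=> t0; have [s st [smin E]] := regulator_max u x w t t0.
have tt : 0 <= t <= t by rewrite t0 lexx.
by rewrite /workload E addr_maxr addr0 le_max subr_ge0 smin// orbT.
Qed.

Lemma workload_ge_free u x w t : free_path W u x w t <= workload W u x w t.
Proof. by rewrite /workload lerDl regulator_ge0. Qed.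

Lemma workload_ge_increment u x w t s : 0 <= s <= t ->
  W t w - W s w - u * (t - s) <= workload W u x w t.
Proof.
move=> /andP[s0 st]; have t0 := le_trans s0 st.
have [r rt [rmin E]] := regulator_max u x w t t0.
rewrite /workload E addr_maxr le_max; apply/orP; right.
have := rmin s; rewrite s0 st => /(_ isT); rewrite /free_path; lra.
Qed.

(** Let [s] minimise the free path on $[0,t]$. The regulator is either 0 or minus the free path at
    [s]; in the second case the starting point [x] cancels. *)
Lemma workload_dichotomy u x w t : 0 <= t ->
  workload W u x w t = free_path W u x w t \/
  exists2 s, 0 <= s <= t & workload W u x w t = W t w - W s w - u * (t - s).
Proof.
move=> t0; have [s st [smin E]] := regulator_max u x w t t0.
rewrite /workload E; case: (leP 0 (- free_path W u x w s)) => _.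
  by right; exists s => //; rewrite /free_path; ring.
by left; rewrite addr0.
Qed.

(** For a start at 0 the unregulated case is the increment from [s = 0], since [W] starts at 0. *)
Lemma workload0_dichotomy u w t : 0 <= t ->
  exists2 s, 0 <= s <= t & workload W u 0 w t = W t w - W s w - u * (t - s).
Proof.
move=> t0; case: (workload_dichotomy u 0 w t t0) => // ->; exists 0; first by rewrite lexx t0.
by rewrite /free_path fbm_start; ring.
Qed.

(** Each term of which the workload is the maximum decreases with the rate, as the elapsed times [t]
    and [t - s] are nonnegative. *)
Lemma workload_nonincreasing u v x w t : 0 <= t -> u <= v ->
  workload W v x w t <= workload W u x w t.
Proof.
move=> t0 uv; case: (workload_dichotomy v x w t t0) => [->|[s st ->]].
  by apply: le_trans (workload_ge_free u x w t); rewrite /free_path lerD2r lerD2l lerN2 ler_wpM2r.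
apply: le_trans (workload_ge_increment u x w t s st).
by rewrite lerD2l lerN2 ler_wpM2r// subr_ge0; have /andP[] := st.
Qed.

Lemma workload0_le u x w t : 0 <= t -> workload W u 0 w t <= workload W u x w t.
Proof.
move=> t0; have [s st ->] := workload0_dichotomy u w t t0.
exact: workload_ge_increment.
Qed.

Lemma workload_le_max u x w t : 0 <= t ->
  workload W u x w t <= Num.max (free_path W u x w t) (workload W u 0 w t).
Proof.
move=> t0; rewrite le_max; case: (workload_dichotomy u x w t t0) => [->|[s st ->]].
  by rewrite lexx.
by rewrite workload_ge_increment// orbT.
Qed.

Lemma workload0_gtP u w t c : 0 <= t ->
  (c < workload W u 0 w t) <-> exists2 s, 0 <= s <= t & c < W t w - W s w - u * (t - s).
Proof.
move=> t0; split => [|[s st cs]]; last exact: lt_le_trans (workload_ge_increment u 0 w t s st).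
by have [s st ->] := workload0_dichotomy u w t t0; exists s.
Qed.

Lemma fbm_within_continuous w t : {within `[0, t], continuous (fun s => W s w)}.
Proof.
apply: (continuous_subspaceW _ (@fbm_continuous _ _ _ _ _ W w)).
by move=> s /=; rewrite !in_itv/= => /andP[->].
Qed.

Lemma fbm_lin_continuous w t (f : R -> R) (a b c : R) : (forall s, f s = a * W s w + (b + c * s)) ->
  {within `[0, t], continuous f}.
Proof.
move=> fE; have -> : f = (fun s => a * W s w + (b + c * s)) by exact/funext.
have lin : {within `[0, t], continuous (fun s : R => b + c * s)}.
  apply: continuous_subspaceT => s.
  by apply: cvgD; [exact: cvg_cst|exact: mulrl_continuous].
move=> s; apply: cvgD; last exact: lin.
by apply: cvgMr; exact: fbm_within_continuous.
Qed.

Lemma measurable_regulator u x t : measurable_fun setT (fun w => regulator W u x w t).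
Proof.
have [t0|t0] := leP 0 t; last first.
  by rewrite (_ : (fun w => _) = cst 0)//; apply/funext => w; rewrite regulator_neg.
apply: (measurability _ (RGenOInfty.measurableE R)) => // _ [_ [c ->] <-].
have [c0|c0] := ltP c 0.
  rewrite (_ : _ @^-1` _ = setT); first exact: measurableI.
  apply/seteqP; split => // w _ /=; rewrite in_itv/= andbT.
  exact: lt_le_trans c0 (regulator_ge0 _ _ _ _).
rewrite setTI (_ : _ @^-1` _ = [set w | exists2 s, 0 <= s <= t & c < - free_path W u x w s]).
  apply: (measurable_exists_gt t t0 (fun s w => - free_path W u x w s)).
    move=> s _; apply: measurable_funN; apply: measurable_funD => //.
  by move=> w; apply: (fbm_lin_continuous w t _ (-1) (- x) u) => s; rewrite /free_path; ring.
apply/seteqP; split => w /=; rewrite in_itv/= andbT.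
  by move/(regulator_gtP u x w t c t0) => [|//]; rewrite ltNge c0.
by move=> cs; apply/(regulator_gtP u x w t c t0); right.
Qed.

Lemma measurable_workload u x t : measurable_fun setT (fun w => workload W u x w t).
Proof.
apply: measurable_funD; last exact: measurable_regulator.
exact: measurable_funD.
Qed.

(** On paths the workload is a maximum of increments ending at [t]; under the change of time
    $s\mapsto t-s$ these have the joint law of the drifted process started at 0, first on grids,
    then by continuity. *)
Lemma workload0_law (u t c : R) : 0 < H -> 0 <= t ->
  P [set w | c < workload W u 0 w t] =
  P [set w | exists2 s, 0 <= s <= t & c < W s w - u * s].
Proof.
move=> H0 t0.
have -> : [set w | c < workload W u 0 w t] =
    [set w | exists2 s, 0 <= s <= t & c < W t w - W s w - u * (t - s)].
  by apply/seteqP; split => w /= /(workload0_gtP u w t c t0).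
apply: (probability_exists_gt P t t0
  (fun s w => W t w - W s w - u * (t - s)) (fun s w => W s w - u * s)).
- by move=> s _; apply: measurable_funB => //; exact: measurable_funB.
- by move=> w; apply: (fbm_lin_continuous w t _ (-1) (W t w - u * t) u) => s; ring.
- by move=> s _; exact: measurable_funB.
- by move=> w; apply: (fbm_lin_continuous w t _ 1 0 (- u)) => s; ring.
(* Durations of the increments. The dyadic grid is symmetric, so they are grid points again, listed
   in reverse order; hence [rev_ord] in the second event. *)
move=> n; pose s (i : 'I_(2 ^ n).+1) : R := t - dyadic t n i.
have st i : 0 <= s i <= t.
  have /andP[d0 dt] : 0 <= dyadic t n i <= t by apply: dyadic_range => //; rewrite -ltnS.
  by rewrite subr_ge0 dt gerBl.
have tsE i : t - s i = dyadic t n i by rewrite /s; ring.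
have revE (i : 'I_(2 ^ n).+1) : dyadic t n (rev_ord i) = t - dyadic t n i.
  have iN : (i <= 2 ^ n)%N by rewrite -ltnS.
  by rewrite -(dyadic_rev _ _ _ iN).
have := fbm_stationary_orthant P H0 W _ s (fun i => c + u * s i) t st t0.
congr (P _ = P _); apply/seteqP; split => w /= [i ci].
- by exists i; move: ci; rewrite /= tsE /s; lra.
- by exists i; move: ci; rewrite /= tsE /s; lra.
- by exists (rev_ord i); rewrite revE; move: ci; rewrite /s; lra.
- by exists (rev_ord i); rewrite /s revE -/(s i) tsE; move: ci => /=; lra.
Qed.

End paths.

(** * Joint measurability in time and outcome *)

Section joint_measurability.
Context {d} {Omega : measurableType d} {R : realType}.

Lemma right_continuous_joint_measurable (phi : R -> Omega -> R) :
  (forall t, 0 <= t -> measurable_fun setT (phi t)) ->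
  (forall w t, 0 <= t -> phi s w @[s --> t^'+] --> phi t w) ->
  measurable_fun setT (fun p : R * Omega => phi (Num.max p.1 0) p.2).
Proof.
move=> mphi rphi.
pose grid n (k : nat) : R := k.+1%:R / n.+1%:R.
pose idx n (t : R) := Num.truncn (Num.max t 0 * n.+1%:R).
have max0 (t : R) : 0 <= Num.max t 0 by rewrite le_max lexx orbT.
have idxP n t : (idx n t)%:R <= Num.max t 0 * n.+1%:R < (idx n t).+1%:R.
  by apply: truncn_itv; rewrite mulr_ge0.
apply: (@measurable_fun_cvg _ _ _ _ (fun n p => phi (grid n (idx n p.1)) p.2)) => [n _ B mB|[t w] _].
  rewrite setTI (_ : _ @^-1` _ = \bigcup_k ([set t | idx n t = k] `*` (phi (grid n k) @^-1` B))).
    apply: bigcupT_measurable => k; apply: measurableX.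
      rewrite (_ : [set t | idx n t = k] = [set t | k%:R <= Num.max t 0 * n.+1%:R] `&`
          [set t | Num.max t 0 * n.+1%:R < k.+1%:R]).
        have mm : measurable_fun setT (fun t : R => Num.max t 0 * n.+1%:R).
          by apply: measurable_funM => //; exact: measurable_maxr.
        apply: measurableI; rewrite -[X in measurable X]setTI.
          exact: measurable_fun_ler.
        exact: measurable_fun_ltr.
      apply/seteqP; split => t /=; first by move=> <-; have /andP[] := idxP n t.
      by move=> [kt tk]; apply: truncn_def; rewrite kt tk.
    rewrite -[X in measurable X]setTI; apply: mphi => //.
    by rewrite divr_ge0.
  apply/seteqP; split => [[t w] /= Bt|[t w] [k _ [/= <-]]//].
  by exists (idx n t).
have /cvg_at_rightP := rphi w (Num.max t 0) (max0 t); apply; split => [n|].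
  rewrite /grid ltr_pdivlMr//; have /andP[_] := idxP n t; exact.
apply: (@squeeze_cvgr _ _ _ _ (cst (Num.max t 0)) (fun n => Num.max t 0 + n.+1%:R^-1)).
- near=> n; have /andP[le1 lt1] := idxP n t; rewrite /grid /= ler_pdivlMr// (ltW lt1)/=.
  by rewrite ler_pdivrMr// mulrDl mulVf// -natr1 lerD2r.
- exact: cvg_cst.
- rewrite -[X in _ --> X]addr0; apply: cvgD; [exact: cvg_cst|exact: cvg_harmonic].
Unshelve. all: end_near. Qed.

End joint_measurability.

Section cost_function.
Context {R : realType} (C : R -> R).
Hypothesis C_cont : {within `[0, +oo[, continuous C}.

(** [C] is constrained on $[0,\infty)$ only; composing with [Num.max] yields a function on the line
    that is continuous everywhere and agrees with [C] on nonnegative values. *)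
Lemma continuous_extend0 : continuous (fun y : R => C (Num.max y 0)).
Proof.
move=> y; have max0 (t : R) : 0 <= Num.max t 0 by rewrite le_max lexx orbT.
have /subspace_continuousP/(_ (Num.max y 0)) := C_cont.
rewrite /= in_itv/= max0 => /(_ isT) cC.
apply/cvgrPdist_lt => eps eps0; move/cvgrPdist_lt : cC => /(_ eps eps0) [e /= e0 eA].
have : continuous (fun y : R => Num.max y 0).
  by move=> z; apply: continuous_max => //; exact: cvg_cst.
move=> /(_ y) /cvgrPdist_lt /(_ e e0) [e' e'0 e'A]; exists e' => // z yz /=.
by apply: eA; [exact: e'A|rewrite /= in_itv/= max0].
Qed.

Lemma measurable_extend0 : measurable_fun setT (fun y : R => C (Num.max y 0)).
Proof. exact: continuous_measurable_fun continuous_extend0. Qed.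

End cost_function.

Section joint_paths.
Context {d} {Omega : measurableType d} {R : realType} (P : probability Omega R).
Context {H : R} (W : fractional_brownian_motion P H).
Variables (u x : R).

Lemma free_path_right_continuous w t : 0 <= t ->
  free_path W u x w s @[s --> t^'+] --> free_path W u x w t.
Proof.
move=> t0; have := @free_path_continuous _ _ _ _ _ W u x w.
rewrite continuous_within_itvcyP => -[cf f0].
move: t0; rewrite le_eqVlt => /predU1P[<-//|t0].
by apply: cvg_at_right_filter; apply: cf; rewrite in_itv/= t0.
Qed.

Lemma workload_right_continuous w t : 0 <= t ->
  workload W u x w s @[s --> t^'+] --> workload W u x w t.
Proof.
move=> t0; apply: cvgD; first exact: free_path_right_continuous.
exact: (@regulator_right_continuous _ _ _ _ _ W u x w t).
Qed.

Lemma joint_measurable_regulator :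
  measurable_fun setT (fun p : R * Omega => regulator W u x p.2 (Num.max p.1 0)).
Proof.
apply: (right_continuous_joint_measurable (fun t w => regulator W u x w t)).
  by move=> t _; exact: measurable_regulator.
by move=> w t _; exact: regulator_right_continuous.
Qed.

Lemma joint_measurable_cost (C : R -> R) : {within `[0, +oo[, continuous C} ->
  measurable_fun setT (fun p : R * Omega => C (workload W u x p.2 (Num.max p.1 0))).
Proof.
move=> cC; have -> : (fun p : R * Omega => C (workload W u x p.2 (Num.max p.1 0))) =
    (fun y : R => C (Num.max y 0)) \o (fun p : R * Omega => workload W u x p.2 (Num.max p.1 0)).
  by apply/funext => p /=; rewrite [Num.max (workload _ _ _ _ _) _]max_l// workload_ge0// le_max lexx orbT.
apply: measurableT_comp; first exact: measurable_extend0.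
apply: (right_continuous_joint_measurable (fun t w => workload W u x w t)).
  by move=> t _; exact: measurable_workload.
by move=> w t; exact: workload_right_continuous.
Qed.

Lemma measurable_cost (C : R -> R) t : {within `[0, +oo[, continuous C} -> 0 <= t ->
  measurable_fun setT (fun w => C (workload W u x w t)).
Proof.
move=> cC t0; have -> : (fun w => C (workload W u x w t)) =
    (fun y : R => C (Num.max y 0)) \o (fun w => workload W u x w t).
  by apply/funext => p /=; rewrite max_l// workload_ge0.
by apply: measurableT_comp; [exact: measurable_extend0|exact: measurable_workload].
Qed.

End joint_paths.

(** * Comparison of laws through tails *)

Section stochastic_order.
Context {d} {Omega : measurableType d} {R : realType} (P : probability Omega R).

(** Layer cake: the expectation of a nonnegative variable is the integral of its tail over
    $[0,\infty)$. *)
Lemma le_integral_tail (X Y : Omega -> R) : measurable_fun setT X -> measurable_fun setT Y ->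
  (forall w, 0 <= X w) -> (forall w, 0 <= Y w) ->
  (forall r, 0 <= r -> (P [set w | (r < X w)%R] <= P [set w | (r < Y w)%R])%E) ->
  (\int[P]_w (X w)%:E <= \int[P]_w (Y w)%:E)%E.
Proof.
move=> mX mY X0 Y0 XY.
pose X' : {RV P >-> R} := mfun_Sub (mem_set mX).
pose Y' : {RV P >-> R} := mfun_Sub (mem_set mY).
rewrite -(expectation_def X') -(expectation_def Y') !ge0_expectation_ccdf//.
have ccdfE (Z : {RV P >-> R}) r : ccdf Z r = P [set w | r < Z w].
  by rewrite /ccdf /distribution /= /pushforward; congr (P _); apply/seteqP; split => w /=; rewrite in_itv/= andbT.
apply: ge0_le_integral => //.
- by apply: measurable_funTS; exact: ccdf_measurable.
- by apply: measurable_funTS; exact: ccdf_measurable.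
- by move=> r; rewrite /= in_itv/= andbT => r0; rewrite !ccdfE; exact: XY.
Qed.

(** Translates the event that the cost exceeds [r] into the event that the workload exceeds some
    [c], whose probability [workload0_law] describes. *)
Lemma superlevel_ray (C : R -> R) (r : R) : {within `[0, +oo[, continuous C} ->
  (forall y z, 0 <= y -> y <= z -> C y <= C z) ->
  [\/ forall y, 0 <= y -> r < C y, forall y, 0 <= y -> C y <= r |
      exists c, forall y, 0 <= y -> (r < C y) = (c < y)].
Proof.
move=> cC mC; pose A := [set y : R | 0 <= y /\ C y <= r].
have [C0|C0] := ltP r (C 0); first by apply: Or31 => y y0; exact: lt_le_trans C0 (mC _ _ (lexx _) y0).
have A0 : A 0 by split.
have [[M AM]|nub] := pselect (has_ubound A); last first.
  apply: Or32 => y y0; rewrite leNgt; apply/negP => ry; apply: nub; exists y => z [z0 zr].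
  rewrite leNgt; apply/negP => yz.
  by have := lt_le_trans ry (mC _ _ y0 (ltW yz)); rewrite ltNge zr.
have hA : has_sup A by split; [exists 0|exists M].
have s0 : 0 <= sup A by apply: ub_le_sup => //; exists M.
apply: Or33; exists (sup A) => y y0; apply/idP/idP => [ry|Ay]; last first.
  rewrite ltNge; apply/negP => yr; move: Ay; rewrite ltNge => /negP; apply.
  by apply: ub_le_sup; [exists M|split].
rewrite ltNge; apply/negP => yA.
(* Continuity puts the supremum itself in the sublevel set, so the superlevel set is the open ray
   beyond it. *)
have Csup : C (sup A) <= r.
  have cC' := continuous_extend0 _ cC (sup A).
  rewrite leNgt; apply/negP => rC.
  have /cvgrPdist_lt /(_ (C (Num.max (sup A) 0) - r)) := cC'.
  rewrite max_l// subr_gt0 => /(_ rC) [e /= e0 eA].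
  have [z [z0 zr] zA] := sup_adherent e0 hA.
  have zsup : z <= sup A by apply: ub_le_sup => //; exists M.
  have /eA : `|sup A - z| < e by rewrite ger0_norm ?subr_ge0// ltrBlDl -ltrBlDr.
  rewrite max_l// => /(le_lt_trans (ler_norm _)); rewrite ltrD2l ltrN2 ltNge zr//.
by have := lt_le_trans ry (mC _ _ y0 yA); rewrite ltNge Csup.
Qed.

Context {H : R} (W : fractional_brownian_motion P H).

(** Not a pathwise comparison, since the workload itself goes up and down. The tails are compared,
    through maxima over $[0,s]\subseteq[0,t]$. *)
Lemma expected_cost0_nondecreasing (C : R -> R) (u s t : R) : 0 < H ->
  {within `[0, +oo[, continuous C} -> (forall y, 0 <= y -> 0 <= C y) ->
  (forall y z, 0 <= y -> y <= z -> C y <= C z) -> 0 <= s <= t ->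
  (\int[P]_w (C (workload W u 0 w s))%:E <= \int[P]_w (C (workload W u 0 w t))%:E)%E.
Proof.
move=> H0 cC C0 mC /andP[s0 st]; have t0 := le_trans s0 st.
have wl0 v w : 0 <= v -> 0 <= workload W u 0 w v by exact: workload_ge0.
apply: le_integral_tail => [||w|w|r r0].
- exact: measurable_cost.
- exact: measurable_cost.
- by apply: C0; exact: wl0.
- by apply: C0; exact: wl0.
have [Cr|Cr|[c cr]] := superlevel_ray C r cC mC.
- rewrite (_ : [set w | (r < C (workload W u 0 w t))%R] = setT) ?probability_setT ?probability_le1//.
  + rewrite -[X in measurable X]setTI; apply: measurable_fun_ltr => //.
    exact: measurable_cost.
  + by apply/seteqP; split => // w _ /=; apply: Cr; exact: wl0.
- rewrite (_ : [set w | _] = set0) ?measure0//.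
  by apply/seteqP; split => // w /=; rewrite ltNge Cr//; exact: wl0.
have E v : 0 <= v -> [set w | r < C (workload W u 0 w v)] = [set w | c < workload W u 0 w v].
  by move=> v0; apply/seteqP; split => w /=; rewrite cr//; exact: wl0.
rewrite !E// !workload0_law//.
have mE v : 0 <= v -> measurable [set w | exists2 s', 0 <= s' <= v & c < W s' w - u * s'].
  move=> v0; apply: (measurable_exists_gt v v0 (fun s w => W s w - u * s)).
    by move=> s' _; exact: measurable_funB.
  by move=> w; apply: (fbm_lin_continuous P W w v _ 1 0 (- u)) => s'; ring.
apply: le_measure; rewrite ?inE; [exact: mE|exact: mE|].
by move=> w /= [s' /andP[s'0 s's] cs']; exists s' => //; rewrite s'0 (le_trans s's).
Qed.

End stochastic_order.

(** * Chaining and the growth of the regulator *)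

Section chaining.
Context {d} {Omega : measurableType d} {R : realType} (P : probability Omega R).
Context {H : R} (H_ge : 2^-1 <= H) (W : fractional_brownian_motion P H).
Context {T : R} (T0 : 0 < T).

Let H0 : 0 < H. Proof. by apply: lt_le_trans H_ge; rewrite invr_gt0. Qed.

Definition dyadic_increment n i w := W (dyadic T n i.+1) w - W (dyadic T n i) w.

Let tau : R := T `^ H.
(* Any ratio [r < 1] with [r ^ 4 >= 1 / 2] makes the expected levels summable. *)
Let r : R := 9 / 10.
Let lambda n : R := tau * r ^+ n.

Let tau0 : 0 < tau. Proof. exact: powR_gt0. Qed.
Let r0 : 0 < r. Proof. by rewrite /r; lra. Qed.
Let lambda0 n : 0 < lambda n. Proof. by rewrite mulr_gt0// exprn_gt0. Qed.

(* A smooth bound of the largest increment at scale [n]: [y <= l + y ^ 4 / l ^ 3]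
   for all [y, l > 0]. *)
Definition chain_level n w : R :=
  lambda n + (\sum_(i < 2 ^ n) dyadic_increment n i w ^+ 4) / lambda n ^+ 3.

Lemma measurable_chain_level n : measurable_fun setT (chain_level n).
Proof.
apply: measurable_funD => //; apply: measurable_funM => //.
apply: measurable_sum => i; apply: measurable_funX.
exact: measurable_funB.
Qed.

Lemma chain_level_ge0 n w : 0 <= chain_level n w.
Proof.
apply: addr_ge0; first exact: ltW.
apply: mulr_ge0; last by rewrite invr_ge0 exprn_ge0// ltW.
by apply: sumr_ge0 => i _; rewrite -[4%N]/(2 * 2)%N exprM exprn_ge0// sqr_ge0.
Qed.

Lemma dyadic_increment_le n i w : (i < 2 ^ n)%N -> `|dyadic_increment n i w| <= chain_level n w.
Proof.
move=> i2n; set y := `|_|; have y0 : 0 <= y by exact: normr_ge0.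
have y4 : y ^+ 4 <= \sum_(j < 2 ^ n) dyadic_increment n j w ^+ 4.
  rewrite (bigD1 (Ordinal i2n))//= -[leLHS]addr0 lerD//.
    by rewrite /y -normrX ger0_norm ?exprn_even_ge0.
  by apply: sumr_ge0 => j _; rewrite exprn_even_ge0.
rewrite /chain_level; apply: (@le_trans _ _ (lambda n + y ^+ 4 / lambda n ^+ 3)); last first.
  by rewrite lerD2l ler_wpM2r// invr_ge0 exprn_ge0// ltW.
have [yl|/ltW ly] := leP y (lambda n).
  by rewrite (le_trans yl)// lerDl divr_ge0// exprn_ge0// ltW.
apply: (@le_trans _ _ (y ^+ 4 / lambda n ^+ 3)); last by rewrite lerDr ltW.
rewrite ler_pdivlMr ?exprn_gt0// [leRHS]exprS ler_wpM2l//.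
by apply: lerXn2r; rewrite ?nnegrE// ltW.
Qed.

(** An even point of the grid of level [n.+1] lies on the coarser grid; an odd one is a coarser
    point plus a single increment of level [n.+1]. *)
Lemma dyadic_chain n i w : (i <= 2 ^ n)%N ->
  `|W (dyadic T n i) w| <= \sum_(l < n.+1) chain_level l w.
Proof.
elim: n i => [|n IHn] i.
  rewrite big_ord1; case: i => [|[|//]] _.
    by rewrite /dyadic mul0r mulr0 fbm_start normr0 chain_level_ge0.
  have := dyadic_increment_le 0 0 w isT; rewrite /dyadic_increment.
  by rewrite {2}/dyadic mul0r mulr0 fbm_start subr0.
rewrite expnS mul2n => i2; rewrite big_ord_recr/=.
move: i2; rewrite -(odd_double_half i); move: (odd i) (i./2) => b j; case: b => /= i2; last first.
  rewrite add0n dyadicS; apply: le_trans (IHn _ _) _; last by rewrite lerDl chain_level_ge0.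
  by rewrite -leq_double.
have i2n : (j < 2 ^ n)%N by rewrite -ltn_double.
rewrite add1n -[W _ w](subrKC (W (dyadic T n j) w)).
apply: le_trans (ler_normD _ _) _; apply: lerD; first by apply: IHn; exact: ltnW.
rewrite -[dyadic T n j]dyadicS; apply: dyadic_increment_le.
by rewrite expnS mul2n ltn_double.
Qed.

(** A violation would be strict, hence by continuity would also occur at a dyadic point, against
    [dyadic_chain]. *)
Lemma chain_sup w s : 0 <= s <= T -> (`|W s w|%:E <= \sum_(n <oo) (chain_level n w)%:E)%E.
Proof.
move=> sT; set S := (\sum_(n <oo) _)%E.
have part n : ((\sum_(l < n) chain_level l w)%:E <= S)%E.
  rewrite -sumEFin /S -(big_mkord xpredT (fun l => (chain_level l w)%:E)); apply: nneseries_lim_ge => l _ _.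
  by rewrite lee_fin chain_level_ge0.
rewrite leNgt; apply/negP => SW.
have S0 : (0 <= S)%E by have := part 0%N; rewrite big_ord0.
have Sfin : S \is a fin_num by rewrite ge0_fin_numE// (lt_trans SW)// ltry.
have cW : {within `[0, T], continuous (fun s => `|W s w|)}.
  by move=> z; apply: cvg_norm; exact: fbm_within_continuous.
have fSW : fine S < `|W s w| by rewrite -lte_fin fineK.
have [n [i i2n]] := dyadic_dense _ _ _ _ cW sT fSW.
rewrite ltNge => /negP; apply.
rewrite -lee_fin fineK//; apply: le_trans (part n.+1); rewrite lee_fin.
exact: dyadic_chain.
Qed.

Lemma regulator_le_chain u x w : 0 <= u -> 0 <= x ->
  ((regulator W u x w T)%:E <= (u * T)%:E + \sum_(n <oo) (chain_level n w)%:E)%E.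
Proof.
move=> u0 x0; have [s sT [smin ->]] := regulator_max P W u x w T (ltW T0).
have /andP[s0 s_le] := sT.
apply: (@le_trans _ _ ((u * T)%:E + `|W s w|%:E)%E); last first.
  by rewrite leeD2l// chain_sup.
rewrite -EFinD lee_fin ge_max addr_ge0 ?mulr_ge0 ?(ltW T0)//=.
have : u * s <= u * T by rewrite ler_wpM2l.
have := ler_norm (- W s w); rewrite normrN /free_path; lra.
Qed.

(** Kurtosis of the normal law: a centred Gaussian variable of variance $v$ has fourth moment [c4]
    times $v^2$. *)
Let c4 : R := normal_moment 2 / normal_moment 1 ^+ 2.

(** As $2H\ge 1$, each of the $2^n$ fourth moments is at most $c_4\tau^4 4^{-n}$. Their sum over
    $\lambda_n^3$ is at most $\tau c_4(r^{-3}/2)^n$, and $r^{-3}/2\le r$ by the choice of [r]. *)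
Lemma expected_chain_level n :
  (\int[P]_w (chain_level n w)%:E <= (tau * (1 + c4) * r ^+ n)%:E)%E.
Proof.
have c40 : 0 <= c4 by rewrite divr_ge0 ?exprn_ge0 ?normal_moment_ge0.
have inc_ge0 i w : 0 <= dyadic_increment n i w ^+ 4 by rewrite exprn_even_ge0.
have minc i : measurable_fun setT (fun w => dyadic_increment n i w ^+ 4).
  by apply: measurable_funX; exact: measurable_funB.
have l3 : 0 <= (lambda n ^+ 3)^-1 by rewrite invr_ge0 exprn_ge0// ltW.
have mom (i : 'I_(2 ^ n)) :
    (\int[P]_w (dyadic_increment n i w ^+ 4)%:E <= (c4 * tau ^+ 4 / 4 ^+ n)%:E)%E.
  have iT : 0 <= dyadic T n i <= dyadic T n i.+1.
    have /andP[-> _] /= := dyadic_range T n i (ltW T0) (ltnW (ltn_ord i)).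
    rewrite /dyadic ler_wpM2l ?(ltW T0)// ler_wpM2r ?invr_ge0 ?exprn_ge0//.
    by rewrite ler_nat.
  rewrite (fbm_increment_moment P H0 W _ _ 2 iT) lee_fin.
  have -> : dyadic T n i.+1 - dyadic T n i = T * (2 ^+ n)^-1.
    by rewrite /dyadic -natr1; field; rewrite expf_neq0.
  have n2 : 0 < (2 ^+ n : R)^-1 <= 1.
    by rewrite invr_gt0 exprn_gt0//= invf_le1 ?exprn_gt0// exprn_ege1// ler1n.
  have /andP[n20 n21] := n2.
  rewrite powRM ?(ltW T0) ?(ltW n20)//.
  have pw : (2 ^+ n)^-1 `^ (2 * H) <= (2 ^+ n)^-1.
    rewrite -[leRHS]powRr1 ?(ltW n20)//; apply: ger_powR => //.
    by move: H_ge; lra.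
  have tauE : T `^ (2 * H) = tau ^+ 2 by rewrite mulrC powRrM powR_mulrn// powR_ge0.
  rewrite tauE exprMn [leLHS](_ : _ = c4 * (tau ^+ 2 * (2 ^+ n)^-1 `^ (2 * H)) ^+ 2); last first.
    by rewrite /c4 exprVn; ring.
  rewrite -mulrA ler_wpM2l// exprMn -exprM ler_wpM2l ?exprn_ge0 ?(ltW tau0)//.
  have -> : (4 ^+ n)^-1 = ((2 ^+ n)^-1) ^+ 2 :> R.
    by rewrite exprVn -exprM mulnC exprM; congr (_ ^+ _)^-1; ring.
  by apply: lerXn2r; rewrite ?nnegrE ?powR_ge0 ?(ltW n20).
under eq_integral do rewrite EFinD.
rewrite ge0_integralD//; last 3 first.
- by move=> w _; rewrite lee_fin ltW.
- by move=> w _; rewrite lee_fin mulr_ge0// sumr_ge0.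
- by apply/measurable_EFinP/measurable_funM => //; exact: measurable_sum.
rewrite probability_integral_cst.
under eq_integral do rewrite EFinM muleC.
rewrite ge0_integralZl//; last 2 first.
- by apply/measurable_EFinP; exact: measurable_sum.
- by move=> w _; rewrite lee_fin sumr_ge0.
under eq_integral do rewrite -sumEFin.
rewrite ge0_integral_sum//; last 2 first.
- by move=> i; exact/measurable_EFinP.
- by move=> i w _; rewrite lee_fin.
apply: (@le_trans _ _ ((lambda n)%:E + ((lambda n ^+ 3)^-1)%:E *
    \sum_(i < 2 ^ n) (c4 * tau ^+ 4 / 4 ^+ n)%:E)%E).
  by rewrite leeD2l// lee_wpmul2l ?lee_fin// lee_sum.
rewrite sumEFin -EFinM -EFinD lee_fin sumr_const card_ord -[_ *+ (2 ^ n)%N]mulr_natl natrX.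
rewrite /lambda.
have -> : (tau * r ^+ n) ^- 3 * (2 ^+ n * (c4 * tau ^+ 4 / 4 ^+ n)) =
    tau * c4 * ((r ^+ 3)^-1 * (2 / 4)) ^+ n.
  have e4 : 4 ^+ n = (2 ^+ n) ^+ 2 :> R.
    by rewrite -exprM mulnC exprM; congr (_ ^+ _); ring.
  have e2 (a : R) : ((a ^+ 3)^-1 * (2 / 4)) ^+ n = ((a ^+ n) ^+ 3)^-1 * (2 ^+ n / (2 ^+ n) ^+ 2).
    by rewrite exprMn exprVn expr_div_n e4; congr (_^-1 * _); rewrite -!exprM mulnC.
  rewrite e2 e4; move: (exprn_gt0 n r0) (exprn_gt0 n (@ltr0Sn R 1)).
  move: (r ^+ n) (2 ^+ n) c4 => x y c x0 y0; field.
  by rewrite !gt_eqF.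
have tc0 : 0 <= tau * c4 by apply: mulr_ge0 => //; exact: ltW.
rewrite mulrDr mulr1 [leRHS]mulrDl lerD2l; apply: ler_wpM2l => //.
apply: lerXn2r; rewrite ?nnegrE ?mulr_ge0 ?invr_ge0 ?exprn_ge0 ?(ltW r0)//.
by rewrite /r; lra.
Qed.

(** The factor 10 is $1/(1-r)$, the sum of the geometric series of ratio $9/10$. *)
Lemma expected_regulator_chain u x : 0 <= u -> 0 <= x ->
  (\int[P]_w (regulator W u x w T)%:E <= (u * T + 10 * (1 + c4) * T `^ H)%:E)%E.
Proof.
move=> u0 x0.
have c40 : 0 <= c4 by rewrite divr_ge0 ?exprn_ge0 ?normal_moment_ge0.
have ch0 n w : (0 <= (chain_level n w)%:E)%E by rewrite lee_fin chain_level_ge0.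
have mch n : measurable_fun setT (fun w => (chain_level n w)%:E).
  by apply/measurable_EFinP; exact: measurable_chain_level.
apply: (@le_trans _ _ (\int[P]_w ((u * T)%:E + \sum_(n <oo) (chain_level n w)%:E))%E).
  apply: ge0_le_integral => //.
  - by move=> w _; rewrite lee_fin regulator_ge0.
  - by apply/measurable_EFinP; exact: measurable_regulator.
  - apply: emeasurable_funD => //; apply: ge0_emeasurable_sum => //.
  - by move=> w _; exact: regulator_le_chain.
rewrite ge0_integralD//; last 3 first.
- by move=> w _; rewrite lee_fin mulr_ge0// ltW.
- by move=> w _; exact: nneseries_ge0.
- exact: ge0_emeasurable_sum.
rewrite probability_integral_cst EFinD leeD2l// integral_nneseries//.
apply: lime_le.
  by apply: is_cvg_nneseries => n _ _; exact: integral_ge0.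
apply: nearW => n.
apply: (@le_trans _ _ (\sum_(0 <= i < n) (tau * (1 + c4) * r ^+ i)%:E)%E).
  by apply: lee_sum => i _; exact: expected_chain_level.
rewrite sumEFin lee_fin -mulr_sumr.
rewrite [leRHS](_ : _ = tau * (1 + c4) * 10); last by rewrite -/tau; ring.
rewrite ler_wpM2l ?mulr_ge0 ?addr_ge0 ?(ltW tau0)//.
rewrite big_mkord; have := subrX1 r n => E.
have rn : 0 <= r ^+ n by rewrite exprn_ge0// ltW.
have : (1 - r) * \sum_(i < n) r ^+ i <= 1.
  by rewrite -opprB mulNr -E opprB gerBl.
by rewrite /r; set q := \sum_(_ < _) _; lra.
Qed.

End chaining.

(** * Linear growth of the expected regulator *)

Section regulator_growth.
Context {d} {Omega : measurableType d} {R : realType} (P : probability Omega R).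
Context {H : R} (hH : 1 / 2 <= H < 1) (W : fractional_brownian_motion P H).

Let H_ge : 2^-1 <= H. Proof. by move: hH; rewrite div1r => /andP[]. Qed.
Let H1 : H < 1. Proof. by move: hH => /andP[]. Qed.
Let H0 : 0 < H. Proof. by apply: lt_le_trans H_ge; rewrite invr_gt0. Qed.

Lemma sublinear_powR (eps : R) : 0 < eps -> exists2 M : R, 0 <= M &
  forall t, 0 <= t -> t `^ H <= eps * t + M.
Proof.
(* This [s] solves $s^{1-H}=1/\epsilon$: beyond it $\epsilon t$ alone dominates $t^H$, before it the
   constant $s^H$ does. *)
move=> e0; pose s : R := eps^-1 `^ (1 - H)^-1; exists (s `^ H); first exact: powR_ge0.
move=> t t0; have s0 : 0 <= s by exact: powR_ge0.
have [ts|/ltW st] := leP t s.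
  apply: le_trans (_ : s `^ H <= _); last by rewrite lerDr mulr_ge0// ltW.
  by apply: ge0_ler_powR; rewrite ?nnegrE// ltW.
have H1' : 1 - H != 0 by rewrite subr_eq0 gt_eqF.
have H1p : 0 <= 1 - H by rewrite subr_ge0 ltW.
have se : s `^ (1 - H) = eps^-1 by rewrite /s -powRrM mulVf// powRr1// invr_ge0 ltW.
have te : eps^-1 <= t `^ (1 - H) by rewrite -se; apply: ge0_ler_powR; rewrite ?nnegrE.
have tp : 0 < t.
  rewrite (lt_le_trans _ st)// /s powR_gt0// invr_gt0//.
have -> : eps * t = eps * t `^ (1 - H) * t `^ H.
  rewrite -mulrA -powRD; last by rewrite (gt_eqF tp) implybT.
  by rewrite subrK powRr1.
apply: (@le_trans _ _ (eps * t `^ (1 - H) * t `^ H)); last by rewrite lerDl powR_ge0.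
rewrite ler_peMl ?powR_ge0// -[leLHS](@mulfV _ eps) ?gt_eqF//.
by rewrite ler_wpM2l// ltW.
Qed.

Lemma expected_regulator_le (eps : R) : 0 < eps -> exists2 D : R, 0 <= D &
  forall u x t, 0 <= u -> 0 <= x -> 0 <= t ->
  (\int[P]_w (regulator W u x w t)%:E <= ((u + eps) * t + D)%:E)%E.
Proof.
move=> e0; set c := 10 * (1 + normal_moment 2 / normal_moment 1 ^+ 2) : R.
have c0 : 0 < c.
  by rewrite /c mulr_gt0// ltr_pwDl// divr_ge0 ?exprn_ge0 ?normal_moment_ge0.
have [M M0 bM] := sublinear_powR (eps / c) (divr_gt0 e0 c0).
exists (c * M); first by rewrite mulr_ge0// ltW.
move=> u x t u0 x0; rewrite le_eqVlt => /predU1P[<-|t0].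
  under eq_integral do rewrite regulator_at0//.
  by rewrite integral0 mulr0 add0r lee_fin mulr_ge0// ltW.
apply: (le_trans (expected_regulator_chain P H_ge W t0 u x u0 x0)).
rewrite lee_fin -/c [leRHS](_ : _ = u * t + (eps * t + c * M)); last by ring.
rewrite lerD2l.
apply: (@le_trans _ _ (c * (eps / c * t + M))); first by rewrite ler_wpM2l ?bM// ltW.
by rewrite le_eqVlt; apply/orP; left; apply/eqP; field; rewrite gt_eqF.
Qed.

(** Nonnegativity of the workload reads $L(t)\ge ut-x-W(t)$, and [W t] has mean zero. *)
Lemma expected_regulator_ge u x t : 0 <= u -> 0 <= x -> 0 <= t ->
  ((u * t - x)%:E <= \int[P]_w (regulator W u x w t)%:E)%E.
Proof.
move=> u0 x0 t0; have [D D0 bD] := expected_regulator_le 1 ltr01.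
have iL : P.-integrable setT (fun w => (regulator W u x w t)%:E).
  apply/integrableP; split; first by apply/measurable_EFinP; exact: measurable_regulator.
  under eq_integral do rewrite gee0_abs ?lee_fin ?regulator_ge0//.
  by apply: le_lt_trans (bD u x t u0 x0 t0) _; rewrite ltry.
have iW := fbm_integrable P W t t0.
have -> : ((u * t - x)%:E = \int[P]_w ((u * t - x)%:E - (W t w)%:E))%E.
  rewrite integralB//; last exact: finite_measure_integrable_cst.
  by rewrite probability_integral_cst fbm_integral// sube0.
apply: le_integral => //.
  by apply: integrableB => //; exact: finite_measure_integrable_cst.
move=> w _; rewrite -EFinB lee_fin.
have := workload_ge0 P W u x w t t0; rewrite /workload /free_path; lra.
Qed.

End regulator_growth.

(** * Influence of the starting point on the expected cost *)

Section excess_cost.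
Context {d} {Omega : measurableType d} {R : realType} (P : probability Omega R).
Context {H : R} (hH : 1 / 2 <= H < 1) (W : fractional_brownian_motion P H).
Variable C : R -> R.
Hypothesis C_ge0 : forall y, 0 <= y -> 0 <= C y.
Hypothesis C_cont : {within `[0, +oo[, continuous C}.
Hypothesis C_mono : forall y z, 0 <= y -> y <= z -> C y <= C z.

Let H1 : H < 1. Proof. by move: hH => /andP[]. Qed.
Let H0 : 0 < H. Proof. by move: hH; rewrite div1r => /andP[+ _]; apply: lt_le_trans; rewrite invr_gt0. Qed.

Definition expected_cost (u x t : R) : \bar R := (\int[P]_w (C (workload W u x w t))%:E)%E.

(** Moment of order [2 * k] of a centred Gaussian variable of unit variance. *)
Definition moment_ratio (k : nat) : R := normal_moment k / normal_moment 1 ^+ k.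

Lemma moment_ratio_ge0 k : 0 <= moment_ratio k.
Proof. by rewrite divr_ge0 ?exprn_ge0 ?normal_moment_ge0. Qed.

Lemma fbm_moment (k : nat) (t : R) : 0 <= t ->
  (\int[P]_w (W t w ^+ (2 * k))%:E = (moment_ratio k * (t `^ (2 * H)) ^+ k)%:E)%E.
Proof.
move=> t0; have := @fbm_increment_moment _ _ _ P H H0 W 0 t k.
rewrite lexx t0 => /(_ isT); under eq_integral do rewrite fbm_start subr0.
move=> ->; rewrite subr0 /moment_ratio; congr EFin.
by rewrite expr_div_n; ring.
Qed.

Lemma exprn2_ge0 (a : R) (k : nat) : 0 <= a ^+ (2 * k).
Proof. by rewrite exprM exprn_ge0// sqr_ge0. Qed.

(** By [workload_le_max] the start at [x] matters only while the free path is positive. *)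
Lemma cost_le_excess (K : R) (m : nat) u x w t : 0 <= K ->
  (forall y, 0 <= y -> C y <= K * (1 + y ^+ (2 * m))) -> 0 <= t ->
  C (workload W u x w t) <= C (workload W u 0 w t) +
    (if 0 < free_path W u x w t then K * (1 + free_path W u x w t ^+ (2 * m)) else 0).
Proof.
move=> K0 CK t0; have := workload_le_max P W u x w t t0.
have X0 := workload_ge0 P W u x w t t0; have X00 := workload_ge0 P W u 0 w t t0.
case: ltP => [a0|a0]; rewrite le_max => /orP[le|le].
- apply: le_trans (C_mono _ _ X0 le) _; rewrite -[leLHS]add0r lerD ?C_ge0//.
  exact/CK/ltW.
- apply: le_trans (C_mono _ _ X0 le) _; rewrite lerDl mulr_ge0// addr_ge0// exprn2_ge0//.
- by rewrite addr0; apply: C_mono => //; rewrite (le_trans le)// (le_trans a0).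
- by rewrite addr0; exact: C_mono.
Qed.

(** The additive form remains meaningful when the expected costs are infinite. *)
Lemma expected_cost_add (Z : Omega -> R) (b : R) u x t : 0 <= t ->
  measurable_fun setT Z -> (forall w, 0 <= Z w) ->
  (forall w, C (workload W u x w t) <= C (workload W u 0 w t) + Z w) ->
  (\int[P]_w (Z w)%:E <= b%:E)%E -> (expected_cost u x t <= expected_cost u 0 t + b%:E)%E.
Proof.
move=> t0 mZ Z0 CZ Zb.
have C0 v w : (0 <= (C (workload W u v w t))%:E)%E by rewrite lee_fin C_ge0// workload_ge0.
have mC v : measurable_fun setT (fun w => (C (workload W u v w t))%:E).
  by apply/measurable_EFinP; exact: measurable_cost.
apply: (@le_trans _ _ (\int[P]_w ((C (workload W u 0 w t))%:E + (Z w)%:E))%E).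
  apply: ge0_le_integral => //.
    by apply: emeasurable_funD => //; exact/measurable_EFinP.
  by move=> w _; rewrite -EFinD lee_fin.
rewrite ge0_integralD//; [|by move=> w _; rewrite lee_fin|exact/measurable_EFinP].
by rewrite leeD2l.
Qed.

(** An even integer exponent above [gamma] gives access to the Gaussian moments; the factor 2 covers
    $y\le 1$, where $y^\gamma\le 1$. *)
Lemma polynomial_growth (K gamma : R) : 0 < K -> 0 < gamma ->
  (forall y, 0 <= y -> C y <= K * (1 + y `^ gamma)) ->
  exists m : nat, forall y, 0 <= y -> C y <= 2 * K * (1 + y ^+ (2 * m)).
Proof.
move=> K0 g0 CK; exists (Num.truncn gamma).+1 => y y0; apply: le_trans (CK y y0) _.
rewrite [2 * K]mulrC -mulrA ler_pM2l//.
set m := (Num.truncn gamma).+1.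
have gm : gamma <= (2 * m)%:R.
  have /andP[_ /ltW gm] := truncn_itv (ltW g0).
  by apply: le_trans gm _; rewrite ler_nat leq_pmull.
have m0 := exprn2_ge0 y m.
have [y1|y1] := leP y 1.
  have : y `^ gamma <= 1.
    have -> : 1 = 1 `^ gamma :> R by rewrite powR1.
    by apply: ge0_ler_powR; rewrite ?nnegrE// ltW.
  lra.
have : y `^ gamma <= y ^+ (2 * m) by rewrite -powR_mulrn// ler_powR// ltW.
lra.
Qed.

Lemma excess_cost_bounded (K : R) (m : nat) u x (s : R) : 0 <= K -> 0 <= u -> 0 <= x ->
  (forall y, 0 <= y -> C y <= K * (1 + y ^+ (2 * m))) ->
  exists2 D : R, 0 <= D & forall t, 0 <= t <= s ->
    (expected_cost u x t <= expected_cost u 0 t + D%:E)%E.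
Proof.
move=> K0 u0 x0 CK.
pose D := K * (1 + 2 ^+ (2 * m) * (x ^+ (2 * m) + moment_ratio m * (s `^ (2 * H)) ^+ m)).
have D0 : 0 <= D.
  by rewrite mulr_ge0// addr_ge0// mulr_ge0 ?exprn_ge0// addr_ge0 ?exprn_ge0//
    mulr_ge0 ?moment_ratio_ge0// exprn_ge0// powR_ge0.
exists D => // t /andP[t0 ts].
apply: (expected_cost_add (fun w => K * (1 + 2 ^+ (2 * m) * (x ^+ (2 * m) + W t w ^+ (2 * m))))) => //.
- apply: measurable_funM => //; apply: measurable_funD => //; apply: measurable_funM => //.
  by apply: measurable_funD => //; exact: measurable_funX.
- by move=> w; rewrite mulr_ge0// addr_ge0// mulr_ge0 ?addr_ge0 ?exprn2_ge0.
- move=> w; apply: le_trans (cost_le_excess K m u x w t K0 CK t0) _; rewrite lerD2l.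
  have W2 := exprn2_ge0 (W t w) m.
  case: ifPn => [a0|_]; last first.
    by rewrite mulr_ge0// addr_ge0// mulr_ge0 ?addr_ge0 ?exprn2_ge0.
  rewrite ler_wpM2l// lerD2l.
  have aW : free_path W u x w t <= x + `|W t w|.
    rewrite /free_path; have := ler_norm (W t w); have : 0 <= u * t by rewrite mulr_ge0.
    lra.
  have -> : W t w ^+ (2 * m) = `|W t w| ^+ (2 * m) by rewrite -normrX ger0_norm.
  set b := `|W t w| in aW *; have b0 : 0 <= b by exact: normr_ge0.
  have [xb|/ltW bx] := leP x b.
    apply: (@le_trans _ _ ((2 * b) ^+ (2 * m))).
      by apply: lerXn2r; rewrite ?nnegrE ?mulr_ge0 ?(ltW a0)//; lra.
    by rewrite exprMn ler_wpM2l ?exprn_ge0// lerDr exprn_ge0.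
  apply: (@le_trans _ _ ((2 * x) ^+ (2 * m))).
    by apply: lerXn2r; rewrite ?nnegrE ?mulr_ge0 ?(ltW a0)//; lra.
  by rewrite exprMn ler_wpM2l ?exprn_ge0// lerDl exprn_ge0.
under eq_integral => w _.
  rewrite (_ : K * _ = K * 2 ^+ (2 * m) * W t w ^+ (2 * m) +
    K * (1 + 2 ^+ (2 * m) * x ^+ (2 * m))); last by ring.
  rewrite EFinD EFinM.
  over.
have K2 : 0 <= K * 2 ^+ (2 * m) by rewrite mulr_ge0// exprn_ge0.
have mW : measurable_fun setT (fun w => (W t w ^+ (2 * m))%:E).
  by apply/measurable_EFinP/measurable_funX.
rewrite ge0_integralD//; last 3 first.
- by move=> w _; rewrite mule_ge0// lee_fin// exprn2_ge0.
- exact: measurable_funeM.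
- by move=> w _; rewrite lee_fin mulr_ge0// addr_ge0// mulr_ge0// exprn_ge0.
rewrite ge0_integralZl//; last by move=> w _; rewrite lee_fin exprn2_ge0.
rewrite fbm_moment// probability_integral_cst -EFinM -EFinD lee_fin.
rewrite [leRHS](_ : _ = K * 2 ^+ (2 * m) * (moment_ratio m * (s `^ (2 * H)) ^+ m) +
  K * (1 + 2 ^+ (2 * m) * x ^+ (2 * m))); last by rewrite /D; ring.
rewrite lerD2r ler_wpM2l// ler_wpM2l ?moment_ratio_ge0//.
apply: lerXn2r; rewrite ?nnegrE ?powR_ge0//.
apply: ge0_ler_powR; rewrite ?nnegrE//; first by rewrite mulr_ge0// ltW.
exact: le_trans t0 ts.
Qed.

(** A Markov-type estimate. Once $ut\ge 2x$, a positive free path forces $W(t)\ge ut/2$; the excess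
    may then be multiplied by $(2W(t)/(ut))^{2k}\ge 1$, for any [k]. *)
Lemma excess_cost_decay (K : R) (m : nat) u x t (k : nat) : 0 <= K -> 0 < u -> 0 < t ->
  2 * x <= u * t -> 0 <= x ->
  (forall y, 0 <= y -> C y <= K * (1 + y ^+ (2 * m))) ->
  (expected_cost u x t <= expected_cost u 0 t +
    (K * (2 / (u * t)) ^+ (2 * k) * (moment_ratio k * (t `^ (2 * H)) ^+ k +
       moment_ratio (m + k) * (t `^ (2 * H)) ^+ (m + k)))%:E)%E.
Proof.
move=> K0 u0 t0 xut x0 CK; have ut0 : 0 < u * t by rewrite mulr_gt0.
set q := 2 / (u * t); have q0 : 0 < q by rewrite divr_gt0.
have Kq0 : 0 <= K * q ^+ (2 * k) by rewrite mulr_ge0// exprn_ge0// ltW.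
apply: (expected_cost_add (fun w => K * q ^+ (2 * k) * (W t w ^+ (2 * k) + W t w ^+ (2 * (m + k))))).
- exact: ltW.
- by apply: measurable_funM => //; apply: measurable_funD; exact: measurable_funX.
- by move=> w; rewrite mulr_ge0// addr_ge0// exprn2_ge0.
- move=> w; apply: le_trans (cost_le_excess K m u x w t K0 CK (ltW t0)) _; rewrite lerD2l.
  case: ifPn => [a0|_]; last by rewrite mulr_ge0// addr_ge0// exprn2_ge0.
  rewrite -mulrA ler_wpM2l//.
  move: a0; rewrite /free_path => a0; set a := x - u * t + W t w in a0 *.
  have Wut : u * t / 2 <= W t w by move: a0; rewrite /a; lra.
  have aW : a <= W t w by rewrite /a; lra.
  have W0 : 0 < W t w by rewrite (lt_le_trans _ Wut)// divr_gt0.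
  have qW : 1 <= q * W t w.
    by rewrite mulrC -ler_pdivrMr// div1r /q invf_div.
  rewrite mulnDr exprD -[X in _ * (X + _)]mul1r -mulrDl mulrCA mulrA -mulrA -exprMn.
  apply: (@le_trans _ _ (1 + W t w ^+ (2 * m))).
    by rewrite lerD2l; apply: lerXn2r; rewrite ?nnegrE ?(ltW a0) ?(ltW W0).
  by rewrite ler_peMr ?addr_ge0 ?exprn2_ge0// exprn_ege1.
have mW j : measurable_fun setT (fun w => (W t w ^+ (2 * j))%:E).
  by apply/measurable_EFinP/measurable_funX.
under eq_integral do rewrite EFinM EFinD.
rewrite ge0_integralZl//; last 2 first.
- exact: emeasurable_funD.
- by move=> w _; rewrite adde_ge0// lee_fin exprn2_ge0.
rewrite ge0_integralD//; last 2 first.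
- by move=> w _; rewrite lee_fin exprn2_ge0.
- by move=> w _; rewrite lee_fin exprn2_ge0.
by rewrite !fbm_moment ?(ltW t0)// -EFinD -EFinM.
Qed.

Lemma excess_cost (K gamma : R) u x (eps : R) : 0 < K -> 0 < gamma ->
  (forall y, 0 <= y -> C y <= K * (1 + y `^ gamma)) -> 0 < u -> 0 <= x -> 0 < eps ->
  exists s D : R, [/\ 0 <= s, 0 <= D & forall t, 0 <= t ->
    (expected_cost u x t <= expected_cost u 0 t + (eps + if t <= s then D else 0)%:E)%E].
Proof.
move=> K0 g0 CKg u0 x0 e0.
have [m CK] := polynomial_growth K gamma K0 g0 CKg.
have K20 : 0 <= 2 * K by rewrite mulr_ge0// ltW.
have H1p : 0 < 1 - H by rewrite subr_gt0.
(* The estimate behaves like $t^{2H(m+k)-2k}$; a [k] beyond $mH/(1-H)$ makes this exponent, which is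
   [- delta], negative. *)
pose k := (Num.truncn ((m%:R * H) / (1 - H))).+1.
pose delta : R := 2 * k%:R - 2 * H * (m + k)%:R.
have delta0 : 0 < delta.
  have mk0 : 0 <= (m%:R * H) / (1 - H) by rewrite divr_ge0 ?mulr_ge0 ?(ltW H0)// ltW.
  have /andP[_] := truncn_itv mk0.
  by rewrite -/k ltr_pdivrMr// /delta natrD; lra.
pose Q := 2 * K * (2 / u) ^+ (2 * k) * (moment_ratio k + moment_ratio (m + k)).
have Q0 : 0 <= Q.
  rewrite mulr_ge0// ?addr_ge0 ?moment_ratio_ge0// mulr_ge0//.
  by rewrite exprn_ge0// divr_ge0// ltW.
have decay t : 1 <= t -> 2 * x <= u * t ->
    (expected_cost u x t <= expected_cost u 0 t + (Q * t `^ (- delta))%:E)%E.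
  move=> t1 xut; have t0 : 0 < t by rewrite (lt_le_trans _ t1).
  apply: le_trans (excess_cost_decay (2 * K) m u x t k K20 u0 t0 xut x0 CK) _.
  rewrite leeD2l// lee_fin.
  have r1 : 1 <= t `^ (2 * H) by rewrite -[leLHS](powRr0 t) ler_powR// mulr_ge0// ltW.
  have rr : (t `^ (2 * H)) ^+ k <= (t `^ (2 * H)) ^+ (m + k).
    by apply: ler_weXn2l => //; exact: leq_addl.
  have -> : t `^ (- delta) = (t ^+ (2 * k))^-1 * (t `^ (2 * H)) ^+ (m + k).
    rewrite -powR_mulrn ?powR_ge0// -powRrM -powR_mulrn ?(ltW t0)// -powRN -powRD.
      by congr powR; rewrite /delta natrM; ring.
    by rewrite (gt_eqF t0) implybT.
  have -> : 2 / (u * t) = (2 / u) * t^-1 by field; rewrite !gt_eqF.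
  rewrite /Q exprMn exprVn.
  set A := 2 * K * _; set rho := (t `^ (2 * H)) ^+ (m + k) in rr *.
  have A0 : 0 <= 2 * K * ((2 / u) ^+ (2 * k) / t ^+ (2 * k)).
    by rewrite mulr_ge0// divr_ge0// exprn_ge0// ?divr_ge0 ?(ltW u0) ?(ltW t0).
  rewrite [leRHS](_ : _ = 2 * K * ((2 / u) ^+ (2 * k) / t ^+ (2 * k)) *
    (moment_ratio k * rho + moment_ratio (m + k) * rho)); last by rewrite /A; ring.
  by rewrite ler_wpM2l// lerD2r ler_wpM2l// moment_ratio_ge0.
(* Three thresholds: $t\ge 1$ to compare powers of [t], $ut\ge 2x$ for the decay estimate, and
   $Qt^{-\delta}\le\epsilon$. *)
pose s := Num.max (Num.max 1 (2 * x / u)) ((Q / eps) `^ delta^-1).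
have s0 : 0 <= s by rewrite !le_max ler01.
have [D D0 bD] := excess_cost_bounded (2 * K) m u x s K20 (ltW u0) x0 CK.
exists s, D; split => // t t0; case: (leP t s) => [ts|/ltW st].
  apply: le_trans (bD t _) _; first by rewrite t0.
  by rewrite leeD2l// lee_fin lerDr ltW.
move: st; rewrite /s !ge_max => /andP[/andP[t1 xt] tQ].
rewrite ler_pdivrMr// in xt.
apply: le_trans (decay t t1 _) _; first by rewrite [u * t]mulrC.
rewrite leeD2l// lee_fin addr0 powRN ler_pdivrMr ?powR_gt0 ?(lt_le_trans ltr01)//.
rewrite mulrC -ler_pdivrMr//.
apply: (@le_trans _ _ (((Q / eps) `^ delta^-1) `^ delta)).
  by rewrite -powRrM mulVf ?gt_eqF// powRr1// divr_ge0// ltW.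
by apply: ge0_ler_powR; rewrite ?nnegrE ?powR_ge0// ltW.
Qed.

End excess_cost.

(** * Averaging kernels and extended-real limits *)

Section ereal_limits.
Context {R : realType}.
Implicit Types (F : set_system R) (f : R -> \bar R) (l : \bar R).

Lemma ereal_le_real l l' : (forall r : R, (l < r%:E)%E -> (l' <= r%:E)%E) -> (l' <= l)%E.
Proof.
case: l => [l| |] H; last 2 first.
- exact: leey.
- case: l' H => [r| |] H.
  + have rN : (-oo < (r - 1)%:E)%E by rewrite ltNyr.
    by have := H _ rN; rewrite lee_fin lerBrDl gerDr ler10.
  + have rN : (-oo < (0 : R)%:E)%E by rewrite ltNyr.
    by have := H _ rN.
  + exact: leNye.
- apply/lee_addgt0Pr => e e0; rewrite -EFinD; apply: H.
  by rewrite lte_fin ltrDl.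
Qed.

Lemma ereal_ge_real l l' : (forall r : R, (r%:E < l)%E -> (r%:E <= l')%E) -> (l <= l')%E.
Proof.
move=> H; rewrite -leeN2; apply: ereal_le_real => r lr.
by rewrite leeNl -EFinN; apply: H; rewrite EFinN lteNl.
Qed.

(** One criterion for finite and infinite limits: only real levels strictly on either side of [l]
    are tested. *)
Lemma cvge_bracket F f l : Filter F ->
  (forall r : R, (r%:E < l)%E -> \forall x \near F, (r%:E <= f x)%E) ->
  (forall r : R, (l < r%:E)%E -> \forall x \near F, (f x <= r%:E)%E) ->
  f x @[x --> F] --> l.
Proof.
move=> FF; case: l => [l| |] lo up.
- apply/fine_cvgP; split.
    have l1 : (l%:E < (l + 1)%:E)%E by rewrite lte_fin ltrDl.
    have l2 : ((l - 1)%:E < l%:E)%E by rewrite lte_fin gtrBl.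
    apply: filterS2 (up _ l1) (lo _ l2) => x fx1 fx2.
    by rewrite fin_numElt (lt_le_trans _ fx2) ?ltNyr// (le_lt_trans fx1) ?ltry.
  apply/cvgrPdist_le => e e0.
  have l1 : (l%:E < (l + e)%:E)%E by rewrite lte_fin ltrDl.
  have l2 : ((l - e)%:E < l%:E)%E by rewrite lte_fin gtrBl.
  apply: filterS2 (up _ l1) (lo _ l2) => x; rewrite /=.
  case: (f x) => [r| |] //=; rewrite !lee_fin => h1 h2.
  by rewrite ler_norml; apply/andP; split; lra.
- by apply/cvgeyPge => A; apply: lo; rewrite ltry.
- by apply/cvgeNyPle => A; apply: up; rewrite ltNyr.
Qed.

Lemma limf_esup_bracket F f l : ProperFilter F ->
  (forall r : R, (r%:E < l)%E -> \forall x \near F, (r%:E <= f x)%E) ->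
  (forall r : R, (l < r%:E)%E -> \forall x \near F, (f x <= r%:E)%E) ->
  limf_esup f F = l.
Proof.
move=> FF lo up; apply/eqP; rewrite eq_le limf_esupE; apply/andP; split.
  apply: ereal_le_real => r lr; apply: ereal_inf_le.
  exists (ereal_sup (f @` [set x | (f x <= r%:E)%E])); last first.
    by apply: ub_ereal_sup => _ [x fx <-].
  by exists [set x | (f x <= r%:E)%E] => //; exact: up.
apply: ereal_ge_real => r rl; apply: le_ereal_inf_tmp => _ [V FV <-].
have [x [Vx fx]] := filter_ex (filterI FV (lo r rl)).
by apply: le_trans fx _; apply: ereal_sup_ubound; exists x.
Qed.

End ereal_limits.

(** * Averages against kernels whose mass escapes to infinity *)

Section averaging.
Context {R : realType} (F : set_system R) {FF : ProperFilter F}.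
Variable kern : R -> R -> R.
Local Notation mu := (@lebesgue_measure R).
Local Notation D := (`[0%R, +oo[%classic : set R).
Local Open Scope ereal_scope.

Hypothesis kern_prob : \forall a \near F, [/\ (forall t, 0 <= kern a t)%R,
  measurable_fun setT (kern a) & \int[mu]_(t in D) (kern a t)%:E = 1].
Hypothesis kern_escape : forall s e : R, (0 <= s)%R -> (0 < e)%R ->
  \forall a \near F, \int[mu]_(t in `[0%R, s]) (kern a t)%:E <= e%:E.

(** Common form of Cesaro and Abel means; all that is asked of the kernel is to be a probability
    density whose mass on each bounded interval vanishes in the limit. *)
Definition average (f : R -> \bar R) (a : R) := \int[mu]_(t in D) ((kern a t)%:E * f t).

Let D_ge0 t : D t -> (0 <= t)%R. Proof. by rewrite /= in_itv/= andbT. Qed.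

Let int_step a (s c : R) : (0 <= s)%R -> (0 <= c)%R -> (forall t, 0 <= kern a t)%R ->
  measurable_fun setT (kern a) ->
  \int[mu]_(t in D) ((kern a t)%:E * (if (t <= s)%R then c else 0%R)%:E) =
  c%:E * \int[mu]_(t in `[0%R, s]) (kern a t)%:E.
Proof.
move=> s0 c0 k0 mk.
have -> : `[0%R, s]%classic = D `&` `[0%R, s]%classic.
  apply/seteqP; split => t /=; rewrite !in_itv/= andbT; last by case.
  by move=> /andP[-> ->].
rewrite integral_mkcondr -ge0_integralZl//; last 2 first.
- apply/measurable_restrict => //.
  by apply/measurable_EFinP; exact: measurable_funTS.
- by move=> t _; apply: erestrict_ge0 => r _; rewrite lee_fin.
apply: eq_integral => t; rewrite inE => /D_ge0 t0.
rewrite patchE mem_setE /= in_itv/= t0/=; case: ifPn => ts; first by rewrite muleC.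
by rewrite !mule0.
Qed.

Lemma average_ge f (v s r : R) : measurable_fun D f -> (forall t, (0 <= t)%R -> 0 <= f t) ->
  (0 <= s)%R -> (forall t, (s <= t)%R -> v%:E <= f t) -> (r < v)%R ->
  \forall a \near F, r%:E <= average f a.
Proof.
move=> mf f0 s0 fv rv.
have [v0|v0] := leP v 0%R.
  apply: filterS kern_prob => a [k0 _ _].
  apply: (@le_trans _ _ 0); first by rewrite lee_fin (le_trans (ltW rv)).
  by apply: integral_ge0 => t /D_ge0 t0; rewrite mule_ge0 ?f0 ?lee_fin.
(* Averaging $v\le f+v1_{[0,s]}$ loses [v] times the mass on $[0,s]$; this choice keeps the loss
   below [v - r]. *)
have e0 : (0 < (v - r) / v)%R by rewrite divr_gt0// subr_gt0.
apply: filterS2 kern_prob (kern_escape _ _ s0 e0) => a [k0 mk k1] ke.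
have mkE : measurable_fun D (EFin \o kern a).
  by apply/measurable_EFinP; exact: measurable_funTS.
have mstep : measurable_fun setT (fun t : R => (if (t <= s)%R then v else 0%R)%:E).
  apply/measurable_EFinP; apply: measurable_fun_ifT => //.
  exact: measurable_fun_ler.
have : v%:E <= average f a + v%:E * \int[mu]_(t in `[0%R, s]) (kern a t)%:E.
  rewrite -(int_step a s v s0 (ltW v0) k0 mk) /average -ge0_integralD//; last 4 first.
  - by move=> t /D_ge0 t0; rewrite mule_ge0 ?f0 ?lee_fin.
  - exact: emeasurable_funM.
  - by move=> t _; rewrite mule_ge0 ?lee_fin//; case: ifP => // _; exact: ltW.
  - by apply: emeasurable_funM => //; exact: measurable_funTS.
  rewrite -[leLHS]mul1e -k1 -ge0_integralZr//; last 2 first.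
  - by move=> t _; rewrite lee_fin.
  - by rewrite lee_fin ltW.
  apply: ge0_le_integral => //.
  - by move=> t _; rewrite mule_ge0 ?lee_fin// ltW.
  - by apply: emeasurable_funM.
  - apply: emeasurable_funD; apply: emeasurable_funM => //.
    exact: measurable_funTS.
  move=> t /D_ge0 t0; rewrite -ge0_muleDr; last 2 first.
  - exact: f0.
  - by rewrite lee_fin; case: ifP => // _; exact: ltW.
  apply: lee_wpmul2l; first by rewrite lee_fin.
  case: (leP t s) => [ts|st]; first by rewrite leeDr// f0.
  by rewrite adde0 fv// ltW.
move=> h; rewrite -(@leeD2rE _ (v - r)%:E)// -EFinD addrC subrK.
apply: le_trans h _; rewrite leeD2l//.
apply: (@le_trans _ _ (v%:E * ((v - r) / v)%:E)); first by rewrite lee_wpmul2l// lee_fin ltW.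
by rewrite -EFinM mulrC divfK ?gt_eqF.
Qed.

Lemma average_le f (v c s r : R) : measurable_fun D f -> (forall t, (0 <= t)%R -> 0 <= f t) ->
  (0 <= s)%R -> (0 <= c)%R -> (0 <= v)%R ->
  (forall t, (0 <= t)%R -> f t <= (v + if (t <= s)%R then c else 0%R)%:E) -> (v < r)%R ->
  \forall a \near F, average f a <= r%:E.
Proof.
move=> mf f0 s0 c0 v0 fv vr.
(* The step of height [c] may contribute at most [r - v]; the [+ 1] covers [c = 0]. *)
have e0 : (0 < (r - v) / (c + 1))%R by rewrite divr_gt0 ?subr_gt0// ltr_wpDl.
apply: filterS2 kern_prob (kern_escape _ _ s0 e0) => a [k0 mk k1] ke.
have mkE : measurable_fun D (EFin \o kern a).
  by apply/measurable_EFinP; exact: measurable_funTS.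
have mstep : measurable_fun D (fun t : R => (if (t <= s)%R then c else 0%R)%:E).
  apply: measurable_funTS; apply/measurable_EFinP; apply: measurable_fun_ifT => //.
  exact: measurable_fun_ler.
have step0 t : 0 <= (if (t <= s)%R then c else 0%R)%:E :> \bar R by rewrite lee_fin; case: ifP.
apply: (@le_trans _ _ (\int[mu]_(t in D) ((kern a t)%:E * v%:E +
    (kern a t)%:E * (if (t <= s)%R then c else 0%R)%:E))).
  apply: ge0_le_integral => //.
  - by move=> t /D_ge0 t0; rewrite mule_ge0 ?f0 ?lee_fin.
  - exact: emeasurable_funM.
  - by apply: emeasurable_funD; apply: emeasurable_funM.
  move=> t /D_ge0 t0; rewrite -ge0_muleDr//.
  by apply: lee_wpmul2l; rewrite ?lee_fin// -EFinD fv.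
rewrite ge0_integralD//; last 4 first.
- by move=> t _; rewrite mule_ge0 ?lee_fin.
- exact: emeasurable_funM.
- by move=> t _; apply: mule_ge0; [rewrite lee_fin|exact: step0].
- exact: emeasurable_funM.
rewrite ge0_integralZr//; last first.
  by move=> t _; rewrite lee_fin.
rewrite k1 mul1e int_step//.
apply: (@le_trans _ _ (v%:E + c%:E * ((r - v) / (c + 1))%:E)).
  by rewrite leeD2l// lee_wpmul2l// lee_fin.
rewrite -EFinM -EFinD lee_fin.
have c10 : (0 < c + 1)%R by rewrite ltr_wpDl.
rewrite -lerBrDl mulrA ler_pdivrMr// [(c * _)%R]mulrC ler_wpM2l ?lerDl//.
by rewrite subr_ge0 ltW.
Qed.

End averaging.

(** * Cesaro and Abel kernels; Laplace transform of a Stieltjes measure *)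

Section kernels.
Context {R : realType}.
Local Notation mu := (@lebesgue_measure R).
Local Notation D := (`[0%R, +oo[%classic : set R).

Definition cesaro_kernel (T t : R) : R := if 0 <= t <= T then T^-1 else 0.
Definition abel_kernel (a t : R) : R := a * expR (- (a * t)).

Lemma measurable_abel_kernel a : measurable_fun setT (abel_kernel a).
Proof.
apply: continuous_measurable_fun => t; apply: cvgMr.
apply: continuous_comp; last exact: continuous_expR.
by apply: continuousN; exact: mulrl_continuous.
Qed.

Lemma measurable_cesaro_kernel T : measurable_fun setT (cesaro_kernel T).
Proof.
apply: measurable_fun_ifT => //; apply: measurable_and; exact: measurable_fun_ler.
Qed.

Lemma integral_cesaro (f : R -> \bar R) (T : R) : 0 < T -> measurable_fun D f ->
  (forall t, 0 <= t -> (0 <= f t)%E) ->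
  average cesaro_kernel f T = (T^-1%:E * \int[mu]_(t in `[0%R, T]) f t)%E.
Proof.
move=> T0 mf f0; rewrite /average.
have TD : `[0%R, T]%classic = D `&` `[0%R, T]%classic.
  apply/seteqP; split => t /=; rewrite !in_itv/= andbT; last by case.
  by move=> /andP[-> ->].
have sub : `[0%R, T]%classic `<=` D by rewrite TD; exact: subIsetl.
rewrite -ge0_integralZl//; last 3 first.
- exact: measurable_funS mf.
- by move=> t /sub; rewrite /= in_itv/= andbT => /f0.
- by rewrite lee_fin invr_ge0 ltW.
rewrite [in RHS]TD integral_mkcondr; apply: eq_integral => t.
rewrite inE /= in_itv/= andbT => t0.
rewrite patchE mem_setE /cesaro_kernel in_itv; case: ifP => //= _.
by rewrite mul0e.
Qed.

Lemma cesaro_kernel_prob T : 0 < T -> (\int[mu]_(t in D) (cesaro_kernel T t)%:E = 1)%E.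
Proof.
move=> T0; have := @integral_cesaro (cst 1%E) T T0 (measurable_cst _).
rewrite /average; under eq_integral do rewrite mule1.
move=> ->; last by move=> t _; rewrite lee01.
rewrite integral_cst//= mul1e lebesgue_measure_itv/= lte_fin T0 sube0 -EFinM.
by rewrite mulVf ?gt_eqF.
Qed.

Lemma cesaro_kernel_escape s e : 0 <= s -> 0 < e ->
  \forall T \near +oo, (\int[mu]_(t in `[0%R, s]) (cesaro_kernel T t)%:E <= e%:E)%E.
Proof.
move=> s0 e0; near=> T.
have T0 : 0 < T by near: T; exact: nbhs_pinfty_gt.
apply: (@le_trans _ _ (\int[mu]_(t in `[0%R, s]) (T^-1)%:E)%E).
  apply: ge0_le_integral => //.
  - by move=> t _; rewrite lee_fin /cesaro_kernel; case: ifP => // _; rewrite invr_ge0 ltW.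
  - apply: measurable_funTS; apply/measurable_EFinP; exact: measurable_cesaro_kernel.
  - move=> t _; rewrite lee_fin /cesaro_kernel; case: ifP => // _.
    by rewrite invr_ge0 ltW.
rewrite integral_cst//= lebesgue_measure_itv/= lte_fin.
case: ltP => s0'; last by rewrite mule0 lee_fin ltW.
rewrite sube0 -EFinM lee_fin mulrC ler_pdivrMr// mulrC -ler_pdivrMr//.
Unshelve. all: end_near. Qed.

Lemma abel_kernel_ge0 a t : 0 <= a -> 0 <= abel_kernel a t.
Proof. by move=> a0; rewrite mulr_ge0// expR_ge0. Qed.

Lemma integral_abel_tail a t : 0 < a -> 0 <= t ->
  (\int[mu]_(r in `[t, +oo[) (abel_kernel a r)%:E = (expR (- (a * t)))%:E)%E.
Proof.
move=> a0 t0; have cexp : continuous (fun z : R^o => expR (- (a * z))).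
  move=> z; apply: continuous_comp; last exact: continuous_expR.
  by apply: continuousN; exact: mulrl_continuous.
rewrite (@ge0_continuous_FTC2y _ _ (fun x => - expR (- (a * x))) _ 0)//.
- by rewrite sub0e EFinN oppeK.
- by move=> x _; rewrite abel_kernel_ge0// ltW.
- by apply: continuous_subspaceT => z; apply: cvgMr; exact: cexp.
- rewrite -oppr0; apply: cvgN.
  apply: (@cvg_comp _ _ _ (fun z => a * z) (fun z => expR (- z)) _ (pinfty_nbhs R)); last exact: cvgr_expR.
  exact: gt0_cvgMry.
- by apply: cvgN; apply/cvg_at_right_filter; exact: cexp.
- move=> z; rewrite in_itv/= andbT => tz; have z0 := le_lt_trans t0 tz.
  have zin : z \in `]0, +oo[ by rewrite in_itv/= z0.
  have fE : (fun x : R => - expR (- (a * x))) = (fun x : R => - expR (- a * x)).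
    by apply/funext => x; rewrite mulNr.
  rewrite fE (@derive1_exponential_pdf R a z zin) (@exponential_pdfE R a z (ltW z0)).
  by rewrite /abel_kernel -mulNr.
Qed.

Lemma abel_kernel_prob a : 0 < a -> (\int[mu]_(r in D) (abel_kernel a r)%:E = 1)%E.
Proof. by move=> a0; rewrite integral_abel_tail// mulr0 oppr0 expR0. Qed.

Lemma abel_kernel_escape s e : 0 <= s -> 0 < e ->
  \forall a \near 0^'+, (\int[mu]_(t in `[0%R, s]) (abel_kernel a t)%:E <= e%:E)%E.
Proof.
move=> s0 e0; have es0 : 0 < e / (s + 1) by rewrite divr_gt0// ltr_wpDl.
near=> a.
have a0 : 0 < a by near: a; exact: nbhs_right_gt.
have ae : a < e / (s + 1) by near: a; exact: nbhs_right_lt.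
apply: (@le_trans _ _ (\int[mu]_(t in `[0%R, s]) a%:E)%E).
  apply: ge0_le_integral => //.
  - by move=> t _; rewrite lee_fin abel_kernel_ge0// ltW.
  - apply: measurable_funTS; apply/measurable_EFinP; exact: measurable_abel_kernel.
  - move=> t; rewrite /= in_itv/= => /andP[t0 _]; rewrite lee_fin /abel_kernel.
    by rewrite ler_piMr ?(ltW a0)// -[leRHS]expR0 ler_expR oppr_le0 mulr_ge0// ltW.
rewrite integral_cst//= lebesgue_measure_itv/= lte_fin.
case: ltP => s0'; last by rewrite mule0 lee_fin ltW.
rewrite sube0 -EFinM lee_fin.
have : a * (s + 1) < e by rewrite -ltr_pdivlMr// ltr_wpDl.
lra.
Unshelve. all: end_near. Qed.

Lemma integral_abel (f : R -> \bar R) (a : R) : 0 < a -> measurable_fun D f ->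
  (forall t, 0 <= t -> (0 <= f t)%E) ->
  average abel_kernel f a = (a%:E * \int[mu]_(t in D) ((expR (- (a * t)))%:E * f t))%E.
Proof.
move=> a0 mf f0; rewrite /average -ge0_integralZl//; last 3 first.
- apply: emeasurable_funM => //; apply: measurable_funTS; apply/measurable_EFinP.
  apply: continuous_measurable_fun => t.
  apply: continuous_comp; last exact: continuous_expR.
  by apply: continuousN; exact: mulrl_continuous.
- move=> t; rewrite /= in_itv/= andbT => t0.
  by rewrite mule_ge0 ?f0// lee_fin expR_ge0.
- by rewrite lee_fin ltW.
by apply: eq_integral => t _; rewrite muleA -EFinM.
Qed.

Lemma lebesgue_stieltjes_measure_ocitv (L : cumulative R R) (a b : R) : a <= b ->
  lebesgue_stieltjes_measure L `]a, b]%classic = (L b - L a)%:E.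
Proof.
move=> ab; rewrite /lebesgue_stieltjes_measure /measure_extension/=.
by rewrite measurable_mu_extE/=; [rewrite wlength_itv_bnd|exact: is_ocitv].
Qed.

(** The measure is given on left-open intervals, so one starts from the negative point -1; since [L]
    vanishes up to 0, the part before 0 has no mass. *)
Lemma lebesgue_stieltjes_measure_0c (L : cumulative R R) (r : R) : 0 <= r ->
  (forall t, t <= 0 -> L t = 0) -> lebesgue_stieltjes_measure L `[0, r]%classic = (L r)%:E.
Proof.
move=> r0 L0; have L1 : L (-1) = 0 by rewrite L0// lerN10.
have m1 : lebesgue_stieltjes_measure L `]-1, 0[%classic = 0%E.
  apply/eqP; rewrite -measure_le0.
  apply: (@le_trans _ _ (lebesgue_stieltjes_measure L `]-1, 0]%classic)).
    apply: le_measure; rewrite ?inE//.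
    by move=> t /=; rewrite !in_itv/= => /andP[-> /ltW].
  by rewrite lebesgue_stieltjes_measure_ocitv ?lerN10// L1 L0// subr0.
have r1 : -1 <= r by rewrite (le_trans _ r0)// lerN10.
have : lebesgue_stieltjes_measure L `]-1, r]%classic = (L r)%:E.
  by rewrite lebesgue_stieltjes_measure_ocitv// L1 subr0.
rewrite (_ : `]-1, r]%classic = `]-1, 0[%classic `|` `[0, r]%classic); last first.
  apply/seteqP; split => t /=; rewrite !in_itv/=.
    by move=> /andP[t1 tr]; case: (ltP t 0) => t0; [left; rewrite t1|right; rewrite tr].
  case=> /andP[t1 t2]; first by rewrite t1 (le_trans (ltW t2)).
  by rewrite t2 (lt_le_trans _ t1)// ltrN10.
rewrite measureU//; last first.
  by apply/seteqP; split => // t /=; rewrite !in_itv/= => -[/andP[_ t0] /andP[]]; rewrite leNgt t0.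
by rewrite [X in (X + _)%E = _](_ : _ = 0%E) ?add0e//; exact: m1.
Qed.

(* Tonelli on [exp(-at) = \int_t^oo a exp(-ar) dr]. *)
Lemma laplace_tonelli (nu : {sigma_finite_measure set (measurableTypeR R) -> \bar R}) (a : R) :
  0 < a ->
  (\int[nu]_(t in `[0%R, +oo[) (expR (- (a * t)))%:E =
   \int[mu]_(r in D) ((abel_kernel a r)%:E * nu `[0%R, r]%classic))%E.
Proof.
move=> a0; pose phi (p : measurableTypeR R * R) : \bar R :=
  ((abel_kernel a p.2)%:E * (if (0 <= p.1) && (p.1 <= p.2) then 1 else 0)%:E)%E.
have phi0 p : (0 <= phi p)%E.
  by rewrite mule_ge0// lee_fin; [rewrite abel_kernel_ge0// ltW|case: ifP].
have mphi : measurable_fun setT phi.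
  apply: emeasurable_funM.
    apply/measurable_EFinP; apply: measurableT_comp => //.
    exact: measurable_abel_kernel.
  apply/measurable_EFinP; apply: measurable_fun_ifT => //.
  by apply: measurable_and; apply: measurable_fun_ler.
have := @fubini_tonelli _ _ _ _ _ nu mu phi mphi phi0.
rewrite (_ : (fun t => _) = ((fun t => (expR (- (a * t)))%:E) \_ D)); last first.
  apply/funext => t; rewrite patchE mem_setE in_itv/= andbT /phi/=.
  case: ifPn => t0; last first.
    by apply: integral0_eq => r _; rewrite mule0.
  rewrite -integral_abel_tail// [RHS]integral_mkcond; apply: eq_integral => r _.
  rewrite patchE mem_setE in_itv/= andbT; case: ifPn => _; first by rewrite mule1.
  by rewrite mule0.
rewrite -integral_mkcond => ->.
rewrite [RHS]integral_mkcond; apply: eq_integral => r _.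
rewrite patchE mem_setE in_itv/= andbT /phi/=.
case: ifPn => r0; last first.
  apply: integral0_eq => t _; case: ifP; last by rewrite mule0.
  by move=> /andP[t0 tr]; move: r0; rewrite (le_trans t0 tr).
rewrite ge0_integralZl//; last 3 first.
- apply/measurable_EFinP; apply: measurable_fun_ifT => //.
  by apply: measurable_and; apply: measurable_fun_ler.
- by move=> t _; rewrite lee_fin; case: ifP.
- by rewrite lee_fin abel_kernel_ge0// ltW.
congr (_ * _)%E; rewrite -[X in _ = _ X]setIT.
rewrite -integral_indic//; apply: eq_integral => t _.
by rewrite indicE mem_setE in_itv/=; case: ifP.
Qed.

Lemma stieltjes_laplace (L : cumulative R R) (a : R) : 0 < a ->
  (forall t, t <= 0 -> L t = 0) ->
  (\int[lebesgue_stieltjes_measure L]_(t in `[0%R, +oo[) (expR (- (a * t)))%:E =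
   \int[mu]_(r in D) ((abel_kernel a r)%:E * (L r)%:E))%E.
Proof.
move=> a0 L0; rewrite laplace_tonelli//; apply: eq_integral => r.
by rewrite inE/= in_itv/= andbT => r0; rewrite lebesgue_stieltjes_measure_0c.
Qed.

Lemma integral_expRN (a : R) : 0 < a -> (\int[mu]_(t in D) (expR (- (a * t)))%:E = (a^-1)%:E)%E.
Proof.
move=> a0; have := abel_kernel_prob a a0; rewrite /abel_kernel.
under eq_integral do rewrite EFinM.
rewrite ge0_integralZl//; last 2 first.
- apply/measurable_EFinP; apply: measurable_funTS; apply: continuous_measurable_fun => t.
  apply: continuous_comp; last exact: continuous_expR.
  by apply: continuousN; exact: mulrl_continuous.
- by rewrite lee_fin ltW.
move=> /(congr1 (fun z => (a^-1)%:E * z)%E).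
by rewrite mule1 muleA -EFinM mulVf ?gt_eqF// mul1e.
Qed.

(** Mean of the exponential law, by [laplace_tonelli] applied to Lebesgue measure, for which $[0,r]$
    has mass [r]. *)
Lemma abel_kernel_mean (a : R) : 0 < a ->
  (\int[mu]_(r in D) ((abel_kernel a r)%:E * r%:E) = (a^-1)%:E)%E.
Proof.
move=> a0; rewrite -integral_expRN// (laplace_tonelli mu)//.
apply: eq_integral => r; rewrite inE/= in_itv/= andbT => r0; congr (_ * _)%E.
rewrite lebesgue_measure_itv/= lte_fin; case: ltP => r0'; first by rewrite sube0.
by congr EFin; apply/eqP; rewrite eq_le r0' r0.
Qed.

End kernels.

(** * Exchange of limit and infimum over the rates *)

Section value_limit.
Context {R : realType} (F : set_system R) {FF : ProperFilter F}.
Variables (h : R -> R) (p : R) (G : R -> \bar R) (avg lam : R -> R -> \bar R).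
Hypothesis p0 : 0 <= p.
Hypothesis h_cont : {within `[0, +oo[, continuous h}.
Hypothesis h_lim : h u @[u --> +oo] --> +oo.
Hypothesis avg_ge0 : \forall a \near F, forall u, 0 < u -> (0 <= avg a u)%E.
Hypothesis avg_mono : \forall a \near F, forall u v, 0 < u -> u <= v -> (avg a v <= avg a u)%E.
Hypothesis avg_ge : forall u r, 0 < u -> (r%:E < G u)%E -> \forall a \near F, (r%:E <= avg a u)%E.
Hypothesis avg_le : forall u r, 0 < u -> (G u < r%:E)%E -> \forall a \near F, (avg a u <= r%:E)%E.
Hypothesis lam_ge : forall e, 0 < e -> \forall a \near F, forall u, 0 < u -> ((u - e)%:E <= lam a u)%E.
Hypothesis lam_le : forall u e, 0 < u -> 0 < e -> \forall a \near F, (lam a u <= (u + e)%:E)%E.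

Lemma real_between (r : R) (y : \bar R) : (r%:E < y)%E -> exists2 v : R, r < v & (v%:E < y)%E.
Proof.
case: y => [y| |]; last by rewrite ltNge leNye.
- by rewrite lte_fin => ry; exists ((r + y) / 2); rewrite ?lte_fin; lra.
- by move=> _; exists (r + 1); rewrite ?ltry// ltrDl.
Qed.

Lemma lam_scale_ge e : 0 < e ->
  \forall a \near F, forall u, 0 < u -> ((p * u - e)%:E <= p%:E * lam a u)%E.
Proof.
(* Dividing by [p + 1] rather than [p] also covers [p = 0]. *)
move=> e0; have e1 : 0 < e / (p + 1) by rewrite divr_gt0// ltr_wpDl.
apply: filterS (lam_ge _ e1) => a la u u0.
apply: (@le_trans _ _ (p%:E * (u - e / (p + 1))%:E)%E); last by rewrite lee_wpmul2l ?la.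
rewrite -EFinM lee_fin mulrBr lerD2l lerN2 mulrA ler_pdivrMr ?ltr_wpDl//.
by rewrite mulrC ler_wpM2l ?lerDl// ltW.
Qed.

Lemma lam_scale_le u e : 0 < u -> 0 < e ->
  \forall a \near F, (p%:E * lam a u <= (p * u + e)%:E)%E.
Proof.
move=> u0 e0; have e1 : 0 < e / (p + 1) by rewrite divr_gt0// ltr_wpDl.
apply: filterS (lam_le _ _ u0 e1) => a la.
apply: (@le_trans _ _ (p%:E * (u + e / (p + 1))%:E)%E); first by rewrite lee_wpmul2l ?la.
rewrite -EFinM lee_fin mulrDr lerD2l mulrA ler_pdivrMr ?ltr_wpDl//.
by rewrite mulrC ler_wpM2l ?lerDl// ltW.
Qed.

(** The part of the cost that depends on the averaging parameter; [h] is kept apart, as it alone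
    controls large rates. *)
Definition inner_cost a u := (p%:E * lam a u + avg a u)%E.

Lemma inner_cost_ge u r : 0 < u -> (r%:E < (p * u)%:E + G u)%E ->
  \forall a \near F, (r%:E <= inner_cost a u)%E.
Proof.
move=> u0 /real_between[v rv]; rewrite -lteBlDl// -EFinB => vG.
have e0 : 0 < v - r by rewrite subr_gt0.
apply: filterS2 (lam_scale_ge _ e0) (avg_ge _ _ u0 vG) => a la av.
apply: (@le_trans _ _ ((p * u - (v - r))%:E + (v - p * u)%:E)%E).
  by rewrite -EFinD lee_fin; lra.
by apply: leeD => //; exact: la.
Qed.

Lemma inner_cost_le u r : 0 < u -> ((p * u)%:E + G u < r%:E)%E ->
  \forall a \near F, (inner_cost a u <= r%:E)%E.
Proof.
move=> u0; rewrite addeC -lteBrDr// -EFinB => Gr.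
have : (- (r - p * u)%:E < - G u)%E by rewrite lteN2.
rewrite -EFinN => /real_between[v rv]; rewrite lteNr -EFinN => Gv.
have e0 : 0 < v + (r - p * u) by lra.
apply: filterS2 (lam_scale_le _ _ u0 e0) (avg_le _ _ u0 Gv) => a la av.
apply: le_trans (leeD la av) _; rewrite -EFinD lee_fin; lra.
Qed.

Lemma value_limit :
  ereal_inf [set ((h u)%:E + inner_cost a u)%E | u in `]0, +oo[] @[a --> F] -->
  ereal_inf [set ((h u)%:E + ((p * u)%:E + G u))%E | u in `]0, +oo[].
Proof.
pose phi (y : R) := h (Num.max y 0) + p * Num.max y 0.
have phiE u : 0 <= u -> phi u = h u + p * u by move=> u0; rewrite /phi max_l.
have cphi : continuous phi.
  move=> y; apply: cvgD; first exact: continuous_extend0.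
  by apply: cvgMr; apply: continuous_max => //; exact: cvg_cst.
apply: cvge_bracket => [m mV|r].
  have [m' mm' m'V] := real_between _ _ mV.
  (* One [e] pays for the regulator term and two for the oscillation of [phi] around a point. *)
  pose e := (m' - m) / 3; have e0 : 0 < e by rewrite divr_gt0// subr_gt0.
  have m'G u : 0 < u -> ((m' - phi u)%:E < G u)%E.
    move=> u0; rewrite EFinB lteBlDl// phiE ?(ltW u0)// EFinD -addeA.
    apply: lt_le_trans m'V _; apply: ereal_inf_lbound; exists u => //.
    by rewrite /= in_itv/= u0.
  have costge : \forall a \near F, forall u, 0 < u ->
      ((phi u - e)%:E + avg a u <= (h u)%:E + inner_cost a u)%E.
    apply: filterS (lam_scale_ge _ e0) => a la u u0.
    rewrite phiE ?(ltW u0)// -addrA EFinD -addeA leeD2l// leeD2r//.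
    exact: la.
  (* Beyond [B] the cost [h] alone suffices, with a margin [e] for the regulator term. *)
  have [B [Br hB]] : exists B, B \is Num.real /\ forall u, B < u -> m + e <= h u.
    by move/cvgryPge : h_lim => /(_ (m + e)) [B [Br hB]]; exists B.
  (* The premise [0 < u] lets the compact segment contain its endpoint 0, which is not an admissible
     rate. *)
  have cov : \forall a \near F, `[0, Num.max B 0 + 1] `<=`
      (fun u => 0 < u -> (m%:E <= (h u)%:E + inner_cost a u)%E).
    have /compact_near_coveringP := @segment_compact R 0 (Num.max B 0 + 1).
    apply => u0 _.
    have /cvgrPdist_lt /(_ e e0) [del /= del0 hdel] := cphi u0.
    case: (leP 0 u0) => [u00|u00]; last first.
      exists ([set u | u < 0], setT) => /=; first by split; [exact: lt_nbhsl|exact: filterT].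
      by move=> [u a] /= [u1 _] u2; have := lt_trans u1 u2; rewrite ltxx.
    (* Rates close to [u0] lie to the left of [u1], so monotonicity bounds all their averages from
       below by the single one at [u1], while [phi] changes little between them. As [u1] is positive
       this works at [u0 = 0] too. *)
    pose u1 := u0 + del / 2; have u10 : 0 < u1 by rewrite /u1 ltr_wpDl// divr_gt0.
    have phiu1 : phi u1 < phi u0 + e.
      have : ball u0 del u1.
        by rewrite /ball/= distrC /u1 addrC addKr gtr0_norm ?divr_gt0//; lra.
      by move/hdel; rewrite distrC => /(le_lt_trans (ler_norm _)); rewrite ltrBlDl.
    have near_a : \forall a \near F, forall u, 0 < u -> u < u1 -> phi u0 - e < phi u ->
        (m%:E <= (h u)%:E + inner_cost a u)%E.
      apply: filterS3 costge avg_mono (avg_ge _ _ u10 (m'G u1 u10)) => a cg am ag u up uu1 pu.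
      apply: le_trans (cg u up).
      apply: (@le_trans _ _ ((phi u - e)%:E + (m' - phi u1)%:E)%E).
        by rewrite -EFinD lee_fin; move: phiu1 pu; rewrite /e; lra.
      by rewrite leeD2l// (le_trans ag)// am// ltW.
    exists (ball u0 (del / 2), [set a | forall u, 0 < u -> u < u1 -> phi u0 - e < phi u ->
        (m%:E <= (h u)%:E + inner_cost a u)%E]).
      by split => //=; apply: nbhsx_ballx; rewrite divr_gt0.
    move=> [u a] /= [bu ha] up; apply: ha => //.
      by move: bu; rewrite /ball/= distrC => /(le_lt_trans (ler_norm _)); rewrite ltrBlDl.
    have : ball u0 del u by apply: le_ball bu; lra.
    by move/hdel => /(le_lt_trans (ler_norm _)); lra.
  apply: filterS3 cov costge avg_ge0 => a cov cg ag0.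
  apply: le_ereal_inf_tmp => _ [u /= + <-]; rewrite in_itv/= andbT => u0.
  have [uB|Bu] := leP u (Num.max B 0 + 1).
    by apply: cov => //=; rewrite in_itv/= uB ltW.
  apply: le_trans (cg u u0).
  apply: (@le_trans _ _ ((phi u - e)%:E + 0)%E); last by rewrite leeD2l// ag0.
  rewrite adde0 lee_fin phiE ?(ltW u0)//.
  have : m + e <= h u.
    by apply: hB; apply: le_lt_trans Bu; rewrite (@le_trans _ _ (Num.max B 0))// ?lerDl// le_max lexx.
  have : 0 <= p * u by rewrite mulr_ge0// ltW.
  lra.
(* Upper half: a single rate with limit cost below [r] is enough. *)
move=> /ereal_inf_lt[_ [u /= + <-]]; rewrite in_itv/= andbT => u0.
rewrite addeC -lteBrDr// -EFinB => /(inner_cost_le u _ u0); apply: filterS => a ca.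
apply: (@le_trans _ _ ((h u)%:E + inner_cost a u)%E).
  by apply: ereal_inf_lbound; exists u => //; rewrite /= in_itv/= u0.
by rewrite addeC -leeBrDr// -EFinB.
Qed.

End value_limit.

(** * Cost identities and the limits *)

Section tonelli_half_line.
Context {d} {Omega : measurableType d} {R : realType} (P : probability Omega R).
Local Notation mu := (@lebesgue_measure R).
Local Notation D := (`[0%R, +oo[%classic : set R).
Variable phi : R -> Omega -> R.
Hypothesis phi_ge0 : forall t w, 0 <= t -> 0 <= phi t w.
Hypothesis phi_joint : measurable_fun setT (fun p : R * Omega => phi (Num.max p.1 0) p.2).

Let max0 (t : R) : 0 <= Num.max t 0. Proof. by rewrite le_max lexx orbT. Qed.

Let phiE (t : R) w : 0 <= t -> phi (Num.max t 0) w = phi t w.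
Proof. by move=> t0; rewrite max_l. Qed.

Lemma measurable_expected : measurable_fun D (fun t => \int[P]_w (phi t w)%:E)%E.
Proof.
have := @measurable_fun_fubini_tonelli_F _ _ (measurableTypeR R) Omega R P
  (fun p => (phi (Num.max p.1 0) p.2)%:E).
have m : measurable_fun setT (fun p : measurableTypeR R * Omega => (phi (Num.max p.1 0) p.2)%:E).
  by apply/measurable_EFinP; exact: phi_joint.
move=> /(_ m) mF.
have {}mF : measurable_fun D (fun t : R => \int[P]_w (phi (Num.max t 0) w)%:E)%E.
  apply: measurable_funTS; apply: mF => p; rewrite lee_fin; exact: phi_ge0.
apply: eq_measurable_fun mF => t; rewrite inE /= in_itv/= andbT => t0.
by under eq_integral do rewrite phiE//.
Qed.

Variables (A : set R) (g : R -> R).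
Hypothesis mA : measurable A.
Hypothesis AD : A `<=` D.
Hypothesis g_ge0 : forall t, 0 <= t -> 0 <= g t.
Hypothesis mg : measurable_fun setT g.

Let AD0 t : A t -> 0 <= t.
Proof. by move=> /AD; rewrite /= in_itv/= andbT. Qed.

(** Extension by zero outside [A] to a nonnegative function on the whole product, as Tonelli
    requires. *)
Let Phi (p : measurableTypeR R * Omega) : \bar R :=
  (g p.1 * phi (Num.max p.1 0) p.2 * \1_A p.1)%:E.

Let Phi0 p : (0 <= Phi p)%E.
Proof.
rewrite lee_fin indicE; case: (boolP (p.1 \in A)) => pA; last by rewrite mulr0.
by rewrite mulr1 mulr_ge0 ?phi_ge0// g_ge0// AD0//; rewrite inE in pA.
Qed.

Let mPhi : measurable_fun setT Phi.
Proof.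
apply/measurable_EFinP; apply: measurable_funM.
  apply: measurable_funM; first by apply: measurableT_comp.
  exact: phi_joint.
have mI : measurable_fun setT (\1_A : measurableTypeR R -> R) by exact: measurable_indic.
exact: (measurableT_comp mI measurable_fst).
Qed.

Let PhiE w t : Phi (t, w) = ((fun t => (g t * phi t w)%:E) \_ A) t.
Proof.
rewrite /Phi patchE /= indicE; case: (boolP (t \in A)) => tA; last by rewrite mulr0.
by rewrite mulr1 phiE// AD0//; rewrite inE in tA.
Qed.

Lemma measurable_path_integral :
  measurable_fun setT (fun w => \int[mu]_(t in A) (g t * phi t w)%:E)%E.
Proof.
have := @measurable_fun_fubini_tonelli_G _ _ (measurableTypeR R) Omega R mu Phi mPhi Phi0.
congr measurable_fun; apply/funext => w; rewrite [RHS]integral_mkcond.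
by apply: eq_integral => t _; rewrite PhiE.
Qed.

Lemma expected_path_integral :
  (\int[P]_w \int[mu]_(t in A) (g t * phi t w)%:E =
   \int[mu]_(t in A) ((g t)%:E * \int[P]_w (phi t w)%:E))%E.
Proof.
have := @fubini_tonelli _ _ (measurableTypeR R) Omega R mu P Phi mPhi Phi0.
rewrite [X in _ = X](_ : _ = \int[P]_w \int[mu]_(t in A) (g t * phi t w)%:E)%E; last first.
  apply: eq_integral => w _; rewrite [RHS]integral_mkcond.
  by apply: eq_integral => t _; rewrite PhiE.
move=> <-; rewrite [RHS]integral_mkcond; apply: eq_integral => t _.
under eq_integral do rewrite PhiE.
rewrite patchE; case: ifPn => tA; last first.
  by apply: integral0_eq => w _; rewrite patchE (negbTE tA).
have t0 : 0 <= t by rewrite inE in tA; exact: AD0.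
under eq_integral do rewrite patchE tA EFinM.
rewrite ge0_integralZl//; last 3 first.
- apply/measurable_EFinP; apply: eq_measurable_fun (measurableT_comp phi_joint (pair1_measurable t)) => w _.
  by rewrite /= phiE.
- by move=> w _; rewrite lee_fin phi_ge0.
- by rewrite lee_fin g_ge0.
Qed.

End tonelli_half_line.

Section costs.
Context {d} {Omega : measurableType d} {R : realType} (P : probability Omega R).
Context {H : R} (hH : 1 / 2 <= H < 1) (W : fractional_brownian_motion P H).
Variables (C : R -> R) (x : R).
Hypothesis C_ge0 : forall y, 0 <= y -> 0 <= C y.
Hypothesis C_cont : {within `[0, +oo[, continuous C}.
Hypothesis C_mono : forall y z, 0 <= y -> y <= z -> C y <= C z.
Hypothesis hx : 0 <= x.
Local Notation mu := (@lebesgue_measure R).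
Local Notation D := (`[0%R, +oo[%classic : set R).

Let H0 : 0 < H. Proof. by move: hH; rewrite div1r => /andP[+ _]; apply: lt_le_trans; rewrite invr_gt0. Qed.

(** The $G(u)$ of the overview; by monotonicity in time the supremum is the limit, possibly
    infinite. *)
Definition limit_cost (u : R) : \bar R := ereal_sup [set expected_cost P W C u 0 t | t in D].
Definition expected_regulator (u t : R) : \bar R := (\int[P]_w (regulator W u x w t)%:E)%E.
Definition cost_average (kern : R -> R -> R) (a u : R) : \bar R :=
  average kern (expected_cost P W C u x) a.

Let cost_ge0 u t w : 0 <= t -> 0 <= C (workload W u x w t).
Proof. by move=> t0; rewrite C_ge0// workload_ge0. Qed.

Let cost_joint u : measurable_fun setT (fun q : R * Omega => C (workload W u x q.2 (Num.max q.1 0))).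
Proof. exact: joint_measurable_cost. Qed.

Let regulator_joint u : measurable_fun setT (fun q : R * Omega => regulator W u x q.2 (Num.max q.1 0)).
Proof. exact: joint_measurable_regulator. Qed.

Lemma expected_cost_ge0 u y t : 0 <= t -> (0 <= expected_cost P W C u y t)%E.
Proof. by move=> t0; apply: integral_ge0 => w _; rewrite lee_fin C_ge0// workload_ge0. Qed.

Lemma measurable_expected_cost u : measurable_fun D (expected_cost P W C u x).
Proof.
apply: (measurable_expected P (fun t w => C (workload W u x w t))) => //.
by move=> t w; exact: cost_ge0.
Qed.

Lemma measurable_expected_regulator u : measurable_fun D (expected_regulator u).
Proof.
apply: (measurable_expected P (fun t w => regulator W u x w t)) => //.
by move=> t w _; exact: regulator_ge0.
Qed.

Lemma expected_cost_le u v y z t : 0 <= t ->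
  (forall w, workload W u y w t <= workload W v z w t) ->
  (expected_cost P W C u y t <= expected_cost P W C v z t)%E.
Proof.
move=> t0 le; apply: ge0_le_integral => //.
- by move=> w _; rewrite lee_fin C_ge0// workload_ge0.
- by apply/measurable_EFinP; exact: measurable_cost.
- by apply/measurable_EFinP; exact: measurable_cost.
- by move=> w _; rewrite lee_fin C_mono// workload_ge0.
Qed.

Section kernel.
Context (F : set_system R) {FF : ProperFilter F} (kern : R -> R -> R).
Hypothesis kern_prob : \forall a \near F, [/\ (forall t, 0 <= kern a t)%R,
  measurable_fun setT (kern a) & (\int[mu]_(t in D) (kern a t)%:E = 1)%E].
Hypothesis kern_escape : forall s e : R, (0 <= s)%R -> (0 < e)%R ->
  \forall a \near F, (\int[mu]_(t in `[0%R, s]) (kern a t)%:E <= e%:E)%E.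

Lemma cost_average_ge0 : \forall a \near F, forall u, 0 < u -> (0 <= cost_average kern a u)%E.
Proof.
apply: filterS kern_prob => a [k0 _ _] u _; apply: integral_ge0 => t.
by rewrite /= in_itv/= andbT => t0; rewrite mule_ge0 ?lee_fin// expected_cost_ge0.
Qed.

Lemma cost_average_mono : \forall a \near F, forall u v, 0 < u -> u <= v ->
  (cost_average kern a v <= cost_average kern a u)%E.
Proof.
apply: filterS kern_prob => a [k0 mk _] u v u0 uv.
have mkE : measurable_fun D (EFin \o kern a).
  by apply/measurable_EFinP; exact: measurable_funTS.
apply: ge0_le_integral => //.
- move=> t; rewrite /= in_itv/= andbT => t0.
  by rewrite mule_ge0 ?lee_fin// expected_cost_ge0.
- by apply: emeasurable_funM => //; exact: measurable_expected_cost.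
- by apply: emeasurable_funM => //; exact: measurable_expected_cost.
- move=> t; rewrite /= in_itv/= andbT => t0; apply: lee_wpmul2l; first by rewrite lee_fin.
  by apply: expected_cost_le => // w; exact: workload_nonincreasing.
Qed.

(** Some time [s] has expected cost above [r] from the start 0; monotonicity in time keeps it there
    afterwards, and a start at [x] only costs more. *)
Lemma cost_average_ge u r : 0 < u -> (r%:E < limit_cost u)%E ->
  \forall a \near F, (r%:E <= cost_average kern a u)%E.
Proof.
move=> u0 /real_between[v rv]; rewrite /limit_cost => /ereal_sup_gt[_ [s /= + <-]].
rewrite in_itv/= andbT => s0 vs.
apply: (average_ge F kern kern_prob kern_escape (expected_cost P W C u x) v s r) => //.
- exact: measurable_expected_cost.
- by move=> t t0; exact: expected_cost_ge0.
move=> t st; have t0 := le_trans s0 st.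
apply: (le_trans (ltW vs)); apply: le_trans (_ : expected_cost P W C u 0 t <= _)%E.
  by apply: expected_cost0_nondecreasing => //; rewrite s0.
by apply: expected_cost_le => // w; exact: workload0_le.
Qed.

Hypothesis C_growth : exists K gamma : R, [/\ 0 < K, 0 < gamma &
  forall y, 0 <= y -> C y <= K * (1 + y `^ gamma)].

Lemma cost_average_le u r : 0 < u -> (limit_cost u < r%:E)%E ->
  \forall a \near F, (cost_average kern a u <= r%:E)%E.
Proof.
move=> u0 Gr; have [K [gamma [K0 g0 CK]]] := C_growth.
have G0 : (0 <= limit_cost u)%E.
  apply: le_trans (expected_cost_ge0 u 0 0 (lexx _)) _.
  by apply: ereal_sup_ubound; exists 0 => //=; rewrite in_itv/= lexx.
have Gfin : limit_cost u \is a fin_num by rewrite ge0_fin_numE// (lt_trans Gr)// ltry.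
pose g := fine (limit_cost u).
have g_ge0 : 0 <= g by rewrite fine_ge0.
have gr : g < r by rewrite -lte_fin /g fineK.
pose e := (r - g) / 2; have e0 : 0 < e by rewrite divr_gt0// subr_gt0.
have [s [D0 [s0 D00 sD]]] := excess_cost P hH W C C_ge0 C_cont C_mono K gamma u x e K0 g0 CK u0 hx e0.
apply: (average_le F kern kern_prob kern_escape (expected_cost P W C u x) (g + e) D0 s r) => //.
- exact: measurable_expected_cost.
- by move=> t t0; exact: expected_cost_ge0.
- by rewrite addr_ge0// ltW.
- move=> t t0; apply: le_trans (sD t t0) _.
  have -> : (g + e + (if t <= s then D0 else 0))%:E = (limit_cost u + (e + (if t <= s then D0 else 0))%:E)%E.
    by rewrite -(fineK Gfin) -EFinD addrA.
  rewrite leeD2r//.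
  by apply: ereal_sup_ubound; exists t => //=; rewrite in_itv/= t0.
- by rewrite /e; lra.
Qed.

End kernel.

Definition cesaro_regulator (T u : R) : \bar R := (T^-1%:E * expected_regulator u T)%E.
(** Two factors [a]: the one inside the kernel comes from rewriting the [dL] integral, the outer one
    from the rescaling of the discounted value. *)
Definition abel_regulator (a u : R) : \bar R :=
  (a%:E * average abel_kernel (expected_regulator u) a)%E.

(** The error is [x / T] for every rate, which gives the uniformity in [u] demanded by
    [value_limit]. *)
Lemma cesaro_regulator_ge e : 0 < e ->
  \forall T \near +oo, forall u, 0 < u -> ((u - e)%:E <= cesaro_regulator T u)%E.
Proof.
move=> e0; near=> T => u u0.
have T0 : 0 < T by near: T; exact: nbhs_pinfty_gt.
have xT : x / e <= T by near: T; apply: nbhs_pinfty_ge; rewrite num_real.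
apply: (@le_trans _ _ (T^-1%:E * (u * T - x)%:E)%E); last first.
  rewrite lee_wpmul2l ?lee_fin ?invr_ge0 ?(ltW T0)//.
  by apply: (expected_regulator_ge P hH W u x T) => //; exact: ltW.
rewrite -EFinM lee_fin mulrC ler_pdivlMr// mulrBl lerD2l lerN2 mulrC.
by rewrite -ler_pdivrMr.
Unshelve. all: end_near. Qed.

Lemma cesaro_regulator_le u e : 0 < u -> 0 < e ->
  \forall T \near +oo, (cesaro_regulator T u <= (u + e)%:E)%E.
Proof.
move=> u0 e0; have e20 : 0 < e / 2 by rewrite divr_gt0.
have [K K0 bK] := expected_regulator_le P hH W (e / 2) e20.
near=> T.
have T0 : 0 < T by near: T; exact: nbhs_pinfty_gt.
have KT : K / (e / 2) <= T by near: T; apply: nbhs_pinfty_ge; rewrite num_real.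
apply: (@le_trans _ _ (T^-1%:E * ((u + e / 2) * T + K)%:E)%E).
  rewrite lee_wpmul2l ?lee_fin ?invr_ge0 ?(ltW T0)//.
  by apply: bK => //; exact: ltW.
rewrite -EFinM lee_fin mulrC ler_pdivrMr//.
by move: KT; rewrite ler_pdivrMr//; lra.
Unshelve. all: end_near. Qed.

Let mabel a : measurable_fun D (fun t => (abel_kernel a t)%:E).
Proof. by apply/measurable_EFinP; apply: measurable_funTS; exact: measurable_abel_kernel. Qed.

Let maffine (b c : R) : measurable_fun D (fun t : R => (b * t + c)%:E).
Proof.
by apply/measurable_EFinP; apply: measurable_funD => //; exact: measurable_funM.
Qed.

Let mreg u : measurable_fun D (expected_regulator u) := measurable_expected_regulator u.

Let reg_ge0 u t : (0 <= expected_regulator u t)%E.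
Proof. by apply: integral_ge0 => w _; rewrite lee_fin regulator_ge0. Qed.

Let integral_abel_affine a b c : 0 < a -> 0 <= b -> 0 <= c ->
  (\int[mu]_(t in D) ((abel_kernel a t)%:E * (b * t + c)%:E) = (b / a + c)%:E)%E.
Proof.
move=> a0 b0 c0.
have D0 t : D t -> 0 <= t by rewrite /= in_itv/= andbT.
under eq_integral => t _.
  rewrite EFinD (EFinM b t) muleDr// muleCA [((abel_kernel a t)%:E * c%:E)%E]muleC.
  over.
have mt : measurable_fun D (fun t : R => ((abel_kernel a t)%:E * t%:E)%E).
  apply: emeasurable_funM; first exact: mabel.
  by apply/measurable_EFinP; exact: measurable_id.
rewrite ge0_integralD//; last 4 first.
- by move=> t /D0 t0; rewrite !mule_ge0// lee_fin// abel_kernel_ge0// ltW.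
- exact: measurable_funeM.
- by move=> t /D0 t0; rewrite mule_ge0// lee_fin// abel_kernel_ge0// ltW.
- by apply: measurable_funeM; exact: mabel.
rewrite [X in (X + _)%E]ge0_integralZl//; last first.
  by move=> t /D0 t0; rewrite mule_ge0// lee_fin// abel_kernel_ge0// ltW.
rewrite [X in (_ + X)%E]ge0_integralZl//; last 2 first.
- exact: mabel.
- by move=> t /D0 t0; rewrite lee_fin abel_kernel_ge0// ltW.
by rewrite abel_kernel_mean// abel_kernel_prob// mule1 -EFinM -EFinD.
Qed.

Lemma abel_regulator_ge e : 0 < e ->
  \forall a \near 0^'+, forall u, 0 < u -> ((u - e)%:E <= abel_regulator a u)%E.
Proof.
move=> e0; have ex0 : 0 < e / (x + 1) by rewrite divr_gt0// ltr_wpDl.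
near=> a => u u0.
have a0 : 0 < a by near: a; exact: nbhs_right_gt.
have ae : a < e / (x + 1) by near: a; exact: nbhs_right_lt.
have aex : a * x <= e.
  have : a * (x + 1) < e by rewrite -ltr_pdivlMr// ltr_wpDl.
  by lra.
(* The Abel mean of $ut\le E\,L(t)+x$; with [x] on the right, all integrands stay nonnegative. *)
have : ((u / a)%:E <= average abel_kernel (expected_regulator u) a + x%:E)%E.
  have xE : (x%:E = \int[mu]_(t in D) ((abel_kernel a t)%:E * (0 * t + x)%:E))%E.
    by rewrite integral_abel_affine// mul0r add0r.
  rewrite xE /average -ge0_integralD//; last 4 first.
  - by move=> t _; rewrite mule_ge0// lee_fin abel_kernel_ge0// ltW.
  - by apply: emeasurable_funM; [exact: mabel|exact: mreg].
  - by move=> t _; rewrite mul0r add0r mule_ge0// lee_fin// abel_kernel_ge0// ltW.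
  - by apply: emeasurable_funM; [exact: mabel|exact: maffine].
  rewrite -[u / a]addr0 -(integral_abel_affine a u 0)// ?(ltW u0)//.
  apply: ge0_le_integral => //.
  - move=> t; rewrite /= in_itv/= andbT => t0.
    by rewrite mule_ge0// lee_fin ?addr0 ?mulr_ge0 ?(ltW u0)// abel_kernel_ge0// ltW.
  - by apply: emeasurable_funM; [exact: mabel|exact: maffine].
  - apply: emeasurable_funD; first by apply: emeasurable_funM; [exact: mabel|exact: mreg].
    by apply: emeasurable_funM; [exact: mabel|exact: maffine].
  move=> t; rewrite /= in_itv/= andbT => t0.
  rewrite -ge0_muleDr//; last by rewrite lee_fin mul0r add0r.
  rewrite lee_wpmul2l ?lee_fin ?abel_kernel_ge0 ?(ltW a0)//.
  rewrite mul0r add0r addr0 -leeBlDr// -EFinB.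
  by apply: (expected_regulator_ge P hH W u x t) => //; exact: ltW.
rewrite -leeBlDr// -EFinB => le1.
apply: (@le_trans _ _ (a%:E * (u / a - x)%:E)%E); last by rewrite lee_wpmul2l ?lee_fin ?(ltW a0).
rewrite -EFinM lee_fin mulrBr mulrC divfK ?gt_eqF// lerD2l lerN2//.
Unshelve. all: end_near. Qed.

Lemma abel_regulator_le u e : 0 < u -> 0 < e ->
  \forall a \near 0^'+, (abel_regulator a u <= (u + e)%:E)%E.
Proof.
move=> u0 e0; have e20 : 0 < e / 2 by rewrite divr_gt0.
have [K K0 bK] := expected_regulator_le P hH W (e / 2) e20.
have eK0 : 0 < e / 2 / (K + 1) by rewrite divr_gt0// ltr_wpDl.
near=> a.
have a0 : 0 < a by near: a; exact: nbhs_right_gt.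
have ae : a < e / 2 / (K + 1) by near: a; exact: nbhs_right_lt.
have aeK : a * K <= e / 2.
  have : a * (K + 1) < e / 2 by rewrite -ltr_pdivlMr// ltr_wpDl.
  by lra.
have ue0 : 0 <= u + e / 2 by rewrite addr_ge0// ltW.
apply: (@le_trans _ _ (a%:E * ((u + e / 2) / a + K)%:E)%E).
  rewrite lee_wpmul2l ?lee_fin ?(ltW a0)// -integral_abel_affine//.
  apply: ge0_le_integral => //.
  - by move=> t _; rewrite mule_ge0// lee_fin abel_kernel_ge0// ltW.
  - by apply: emeasurable_funM; [exact: mabel|exact: mreg].
  - by apply: emeasurable_funM; [exact: mabel|exact: maffine].
  move=> t; rewrite /= in_itv/= andbT => t0.
  by rewrite lee_wpmul2l ?lee_fin ?abel_kernel_ge0 ?(ltW a0)// bK// ltW.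
rewrite -EFinM lee_fin mulrDr mulrC divfK ?gt_eqF//; lra.
Unshelve. all: end_near. Qed.

End costs.

(** * Rescaled costs as kernel averages *)

Section cost_identities.
Context {d} {Omega : measurableType d} {R : realType} (P : probability Omega R).
Context {H : R} (W : fractional_brownian_motion P H).
Variables (p : R) (h C : R -> R) (x : R).
Hypothesis hp : 0 <= p.
Hypothesis h_ge0 : forall u, 0 <= u -> 0 <= h u.
Hypothesis C_ge0 : forall y, 0 <= y -> 0 <= C y.
Hypothesis C_cont : {within `[0, +oo[, continuous C}.
Hypothesis hx : 0 <= x.
Local Notation mu := (@lebesgue_measure R).
Local Notation D := (`[0%R, +oo[%classic : set R).
Local Notation f u := (expected_cost P W C u x).
Local Notation EL u := (expected_regulator P W x u).
Local Notation cesaro_inner := (inner_cost p (cost_average P W C x cesaro_kernel) (cesaro_regulator P W x)).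
Local Notation abel_inner := (inner_cost p (cost_average P W C x abel_kernel) (abel_regulator P W x)).

Let cost_ge0 u t w : 0 <= t -> 0 <= C (workload W u x w t).
Proof. by move=> t0; rewrite C_ge0// workload_ge0. Qed.

Let f_ge0 u t : 0 <= t -> (0 <= f u t)%E.
Proof. exact: expected_cost_ge0. Qed.

Let EL_ge0 u t : (0 <= EL u t)%E.
Proof. by apply: integral_ge0 => w _; rewrite lee_fin regulator_ge0. Qed.

Let mreg u t : measurable_fun setT (fun w => (regulator W u x w t)%:E).
Proof. by apply/measurable_EFinP; exact: measurable_regulator. Qed.

Lemma measurable_path_cost u (A : set R) (g : R -> R) : measurable A -> A `<=` D ->
  (forall t, 0 <= t -> 0 <= g t) -> measurable_fun setT g ->
  measurable_fun setT (fun w => \int[mu]_(t in A) (g t * C (workload W u x w t))%:E)%E.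
Proof.
move=> mA AD g0 mg.
exact: (measurable_path_integral (fun t w => C (workload W u x w t))
  (fun t w => cost_ge0 u t w) (joint_measurable_cost P W u x C C_cont) A g mA AD g0 mg).
Qed.

Lemma expected_path_cost u (A : set R) (g : R -> R) : measurable A -> A `<=` D ->
  (forall t, 0 <= t -> 0 <= g t) -> measurable_fun setT g ->
  (\int[P]_w \int[mu]_(t in A) (g t * C (workload W u x w t))%:E =
   \int[mu]_(t in A) ((g t)%:E * f u t))%E.
Proof.
move=> mA AD g0 mg.
exact: (expected_path_integral P (fun t w => C (workload W u x w t))
  (fun t w => cost_ge0 u t w) (joint_measurable_cost P W u x C C_cont) A g mA AD g0 mg).
Qed.

Let itvD (T : R) : `[0%R, T]%classic `<=` D.
Proof. by move=> t /=; rewrite !in_itv/= andbT => /andP[]. Qed.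

Let measurable_cumulated_cost u T :
  measurable_fun setT (fun w => \int[mu]_(t in `[0%R, T]) (C (workload W u x w t))%:E)%E.
Proof.
have := measurable_path_cost u _ (cst 1) (measurable_itv `[0, T]) (itvD T) (fun _ _ => ler01) (measurable_cst _).
by congr measurable_fun; apply/funext => w; apply: eq_integral => t _; rewrite mul1r.
Qed.

Let cumulated_cost u T :
  (\int[P]_w \int[mu]_(t in `[0%R, T]) (C (workload W u x w t))%:E = \int[mu]_(t in `[0%R, T]) f u t)%E.
Proof.
have := expected_path_cost u _ (cst 1) (measurable_itv `[0, T]) (itvD T) (fun _ _ => ler01) (measurable_cst _).
under [X in _ = X -> _]eq_integral do rewrite mul1e.
by move=> <-; apply: eq_integral => w _; apply: eq_integral => t _; rewrite mul1r.
Qed.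

Let cumulated_ge0 u T : (0 <= \int[mu]_(t in `[0%R, T]) f u t)%E.
Proof. by apply: integral_ge0 => t /itvD; rewrite /= in_itv/= andbT; exact: f_ge0. Qed.

Let cesaroE u T : 0 < T ->
  cost_average P W C x cesaro_kernel T u = (T^-1%:E * \int[mu]_(t in `[0%R, T]) f u t)%E.
Proof.
move=> T0; apply: integral_cesaro => //; last by move=> t; exact: f_ge0.
exact: measurable_expected_cost.
Qed.

Lemma finite_horizon_costE u T : 0 < u -> 0 < T ->
  (T^-1%:E * finite_horizon_cost W h C p u x T)%E = ((h u)%:E + cesaro_inner T u)%E.
Proof.
move=> u0 T0; have Ti0 : 0 <= T^-1 by rewrite invr_ge0 ltW.
rewrite /finite_horizon_cost expectation.unlock cumulated_cost -/(EL u T).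
have pL0 : (0 <= p%:E * EL u T)%E by rewrite mule_ge0 ?lee_fin.
have hT0 : (0 <= (h u * T)%:E)%E by rewrite lee_fin mulr_ge0 ?h_ge0 ?(ltW u0)// ltW.
rewrite ge0_muleDr; [|exact: adde_ge0|exact: cumulated_ge0].
rewrite ge0_muleDr//.
rewrite -addeA; congr (_ + _)%E.
  by rewrite -EFinM mulrCA mulVf ?mulr1// gt_eqF.
by rewrite /inner_cost cesaroE// muleCA.
Qed.

Lemma average_costE u T : 0 < T ->
  (T^-1%:E * \int[P]_w (\int[mu]_(t in `[0%R, T]) (C (workload W u x w t))%:E
     + p%:E * (regulator W u x w T)%:E))%E = cesaro_inner T u.
Proof.
move=> T0; have Ti0 : 0 <= T^-1 by rewrite invr_ge0 ltW.
rewrite ge0_integralD//; last 3 first.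
- by move=> w _; apply: integral_ge0 => t /itvD; rewrite /= in_itv/= andbT lee_fin; exact: cost_ge0.
- by move=> w _; rewrite mule_ge0 ?lee_fin ?regulator_ge0.
- exact: measurable_funeM.
rewrite ge0_integralZl//; last by move=> w _; rewrite lee_fin regulator_ge0.
rewrite cumulated_cost -/(EL u T).
rewrite ge0_muleDr; [|exact: cumulated_ge0|by rewrite mule_ge0 ?lee_fin].
by rewrite /inner_cost cesaroE// addeC muleCA.
Qed.

Lemma discounted_costE u a : 0 < u -> 0 < a ->
  (a%:E * discounted_cost W h C p a u x)%E = ((h u)%:E + abel_inner a u)%E.
Proof.
move=> u0 a0; have D0 t : D t -> 0 <= t by rewrite /= in_itv/= andbT.
have mD : measurable D by exact: measurable_itv.
have reg_ge0 t w : 0 <= t -> 0 <= regulator W u x w t by move=> _; exact: regulator_ge0.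
have abel0 t : 0 <= t -> 0 <= abel_kernel a t by move=> _; rewrite abel_kernel_ge0// ltW.
have mexp : measurable_fun setT (fun t : R => expR (- (a * t))).
  apply: continuous_measurable_fun => t.
  apply: continuous_comp; last exact: continuous_expR.
  by apply: continuousN; exact: mulrl_continuous.
have mexpD : measurable_fun D (fun t : R => (expR (- (a * t)))%:E).
  by apply/measurable_EFinP; exact: measurable_funTS.
have hu0 : 0 <= h u by rewrite h_ge0// ltW.
have mcost w : measurable_fun D (fun t => (expR (- (a * t)) * C (workload W u x w t))%:E).
  have jm := joint_measurable_cost P W u x C C_cont.
  have m1 : measurable_fun D (fun t : R => C (workload W u x w (Num.max t 0))).
    by apply: measurable_funTS; exact: (measurable_fun_pair1 w jm).
  apply/measurable_EFinP; apply: measurable_funM; first exact: measurable_funTS.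
  apply: eq_measurable_fun m1 => t; rewrite inE => /D0 t0.
  by rewrite max_l.
pose K w := (\int[mu]_(t in D) (expR (- (a * t)) * C (workload W u x w t))%:E)%E.
pose L w := (\int[mu]_(r in D) (abel_kernel a r * regulator W u x w r)%:E)%E.
have K0 w : (0 <= K w)%E.
  by apply: integral_ge0 => t /D0 t0; rewrite lee_fin mulr_ge0 ?expR_ge0// cost_ge0.
have L0 w : (0 <= L w)%E.
  by apply: integral_ge0 => t /D0 t0; rewrite lee_fin mulr_ge0 ?abel_kernel_ge0 ?(ltW a0)// regulator_ge0.
have mK : measurable_fun setT K.
  by apply: measurable_path_cost => // t _; exact: expR_ge0.
have mL : measurable_fun setT L.
  exact: (measurable_path_integral (fun t w => regulator W u x w t)
    reg_ge0 (joint_measurable_regulator P W u x) D (abel_kernel a)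
    mD (@subset_refl _ D) abel0 (measurable_abel_kernel a)).
(* On each path, [h u] integrates to [h u / a], and [stieltjes_laplace] turns the [dL] term into a
   Lebesgue integral of the regulator, which vanishes up to time 0 because [0 <= x]. *)
have -> : discounted_cost W h C p a u x = (\int[P]_w ((h u / a)%:E + K w + p%:E * L w))%E.
  apply: eq_integral => w _; congr (_ + p%:E * _)%E; last first.
    rewrite stieltjes_laplace//; last first.
      move=> t; rewrite le_eqVlt => /predU1P[->|]; first exact: regulator_at0.
      exact: regulator_neg.
  transitivity (\int[mu]_(t in D) ((h u)%:E * (expR (- (a * t)))%:E +
      (expR (- (a * t)) * C (workload W u x w t))%:E))%E.
    by apply: eq_integral => t _; rewrite mulrDr EFinD -EFinM [h u * _]mulrC.
  rewrite ge0_integralD//; last 4 first.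
  - by move=> t _; rewrite mule_ge0 ?lee_fin ?expR_ge0.
  - exact: measurable_funeM.
  - by move=> t /D0 t0; rewrite lee_fin mulr_ge0 ?expR_ge0// cost_ge0.
  - exact: mcost.
  congr (_ + _)%E; rewrite ge0_integralZl//.
  by rewrite integral_expRN// -EFinM.
rewrite ge0_integralD//; last 4 first.
- by move=> w _; rewrite adde_ge0// lee_fin divr_ge0// ltW.
- exact: emeasurable_funD.
- by move=> w _; rewrite mule_ge0.
- exact: measurable_funeM.
rewrite ge0_integralD//; last first.
  by move=> w _; rewrite lee_fin divr_ge0// ltW.
rewrite probability_integral_cst ge0_integralZl//.
rewrite expected_path_cost//.
rewrite (expected_path_integral P (fun t w => regulator W u x w t)
  reg_ge0 (joint_measurable_regulator P W u x) D (abel_kernel a)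
  mD (@subset_refl _ D) abel0 (measurable_abel_kernel a)).
rewrite -[X in (_ + p%:E * X)%E]/(average abel_kernel (EL u) a).
have eC0 : (0 <= \int[mu]_(t in D) ((expR (- (a * t)))%:E * f u t))%E.
  by apply: integral_ge0 => t /D0 t0; rewrite mule_ge0 ?f_ge0// lee_fin expR_ge0.
have av0 : (0 <= average abel_kernel (EL u) a)%E.
  by apply: integral_ge0 => t /D0 t0; rewrite mule_ge0// lee_fin abel_kernel_ge0// ltW.
have ha0 : (0 <= (h u / a)%:E)%E by rewrite lee_fin divr_ge0// ltW.
rewrite ge0_muleDr; [|exact: adde_ge0|by rewrite mule_ge0// lee_fin].
rewrite ge0_muleDr; [|exact: ha0|exact: eC0].
rewrite -EFinM mulrC divfK ?gt_eqF// -addeA; congr (_ + _)%E.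
rewrite /inner_cost /abel_regulator addeC muleCA; congr (_ + _)%E.
rewrite /cost_average integral_abel//; last by move=> t; exact: f_ge0.
exact: measurable_expected_cost.
Qed.

End cost_identities.

Lemma cesaro_kernel_density {R : realType} :
  \forall T \near pinfty_nbhs R, [/\ (forall t, 0 <= cesaro_kernel T t),
    measurable_fun setT (cesaro_kernel T) &
    (\int[lebesgue_measure]_(t in `[0%R, +oo[) (cesaro_kernel T t)%:E = 1)%E].
Proof.
apply: filterS (nbhs_pinfty_gt (num_real (0 : R))) => T T0; split.
- by move=> t; rewrite /cesaro_kernel; case: ifP => // _; rewrite invr_ge0 ltW.
- exact: measurable_cesaro_kernel.
- exact: cesaro_kernel_prob.
Qed.

Lemma abel_kernel_density {R : realType} :
  \forall a \near (0 : R)^'+, [/\ (forall t, 0 <= abel_kernel a t),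
    measurable_fun setT (abel_kernel a) &
    (\int[lebesgue_measure]_(t in `[0%R, +oo[) (abel_kernel a t)%:E = 1)%E].
Proof.
apply: filterS (nbhs_right_gt 0) => a a0; split.
- by move=> t; rewrite abel_kernel_ge0// ltW.
- exact: measurable_abel_kernel.
- exact: abel_kernel_prob.
Qed.

Theorem theorem6p3 (R : realType) (d : measure_display)
  (Omega : measurableType d) (P : probability Omega R)
  (H : R) (hH : 1 / 2 <= H < 1) (W : fractional_brownian_motion P H)
  (p : R) (hp : 0 <= p)
  (h : R -> R)
  (h_ge0 : forall u, 0 <= u -> 0 <= h u)
  (h_cont : {within `[0, +oo[, continuous h})
  (h_mono : forall u v, 0 <= u -> u <= v -> h u <= h v)
  (h_lim : h u @[u --> +oo] --> +oo)
  (C : R -> R)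
  (C_ge0 : forall y, 0 <= y -> 0 <= C y)
  (C_cont : {within `[0, +oo[, continuous C})
  (C_mono : forall y z, 0 <= y -> y <= z -> C y <= C z)
  (C_growth : exists K gamma : R, [/\ 0 < K, 0 < gamma &
    forall y, 0 <= y -> C y <= K * (1 + y `^ gamma)])
  (x : R) (hx : 0 <= x) :
  (alpha%:E * discounted_value W h C p alpha x)%E @[alpha --> 0^'+]
    --> average_value W h C p x
  /\ ((T^-1)%:E * finite_horizon_value W h C p x T)%E @[T --> +oo]
    --> average_value W h C p x.
Proof.
have pos_oo : \forall T \near pinfty_nbhs R, 0 < T by exact: nbhs_pinfty_gt.
have cesaro_prob := @cesaro_kernel_density R.
have abel_prob := @abel_kernel_density R.
pose avg kern := cost_average P W C x kern.
pose G := limit_cost P W C.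
have avg_ge u r : 0 < u -> (r%:E < G u)%E ->
    \forall T \near +oo, (r%:E <= avg cesaro_kernel T u)%E.
  exact: (cost_average_ge P hH W C x C_ge0 C_cont C_mono _ _ cesaro_prob
    cesaro_kernel_escape).
have avg_le u r : 0 < u -> (G u < r%:E)%E ->
    \forall T \near +oo, (avg cesaro_kernel T u <= r%:E)%E.
  exact: (cost_average_le P hH W C x C_ge0 C_cont C_mono hx _ _ cesaro_prob
    cesaro_kernel_escape C_growth).
(* The brackets from below and above make the upper limit a true limit, so the long-run value is the
   common target of both convergences. *)
have averageE : average_value W h C p x =
    ereal_inf [set ((h u)%:E + ((p * u)%:E + G u))%E | u in `]0, +oo[].
  congr ereal_inf; apply: eq_imagel => u /=; rewrite in_itv/= andbT => u0.
  congr (_ + _)%E; apply: limf_esup_bracket => r Gr.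
    apply: filterS2 pos_oo (inner_cost_ge _ _ _ _ _ hp
      avg_ge (cesaro_regulator_ge P hH W x hx) u r u0 Gr) => T T0.
    by rewrite average_costE.
  apply: filterS2 pos_oo (inner_cost_le _ _ _ _ _ hp
    avg_le (cesaro_regulator_le P hH W x hx) u r u0 Gr) => T T0.
  by rewrite average_costE.
rewrite averageE; split.
- apply: cvg_trans (value_limit (0^'+) h p G (avg abel_kernel) (abel_regulator P W x)
    hp h_cont h_lim _ _ _ _ _ _).
  (* A positive finite factor passes through the infimum over the rates. *)
  + apply: near_eq_cvg; apply: filterS (nbhs_right_gt 0) => a a0.
    rewrite /discounted_value -ereal_inf_pZl// image_comp; congr ereal_inf.
    apply: eq_imagel => u /=; rewrite in_itv/= andbT => u0.
    by rewrite discounted_costE.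
  + exact: (cost_average_ge0 P W C x C_ge0 _ _ abel_prob).
  + exact: (cost_average_mono P W C x C_ge0 C_cont C_mono _ _ abel_prob).
  + exact: (cost_average_ge P hH W C x C_ge0 C_cont C_mono _ _ abel_prob
      abel_kernel_escape).
  + exact: (cost_average_le P hH W C x C_ge0 C_cont C_mono hx _ _ abel_prob
      abel_kernel_escape C_growth).
  + exact: (abel_regulator_ge P hH W x hx).
  + exact: (abel_regulator_le P hH W x hx).
- apply: cvg_trans (value_limit (pinfty_nbhs R) h p G (avg cesaro_kernel) (cesaro_regulator P W x)
    hp h_cont h_lim _ _ avg_ge avg_le _ _).
  + apply: near_eq_cvg; apply: filterS pos_oo => T T0.
    have Ti0 : 0 < T^-1 by rewrite invr_gt0.
    rewrite /finite_horizon_value -ereal_inf_pZl// image_comp; congr ereal_inf.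
    apply: eq_imagel => u /=; rewrite in_itv/= andbT => u0.
    by rewrite finite_horizon_costE.
  + exact: (cost_average_ge0 P W C x C_ge0 _ _ cesaro_prob).
  + exact: (cost_average_mono P W C x C_ge0 C_cont C_mono _ _ cesaro_prob).
  + exact: (cesaro_regulator_ge P hH W x hx).
  + exact: (cesaro_regulator_le P hH W x hx).
Qed.
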